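(* Let $g$ be any $T^n$-invariant Riemannian metric on $S^m$, $m=2n$ or $m=2n-1$, whose volume form is the same as for the round metric. (i) Let $e\in M_{2^n}(C^\infty(S^{2n}_\theta))$ be the projection $e=\frac12\big(\mathbf 1+\sum_{\mu=1}^n(\Gamma^{\mu*}u^\mu+\Gamma^\mu u^{\mu*})+\gamma u\big)$. Then the Dirac operator $D_\theta$ of $S^{2n}_\theta$ associated to the metric $g$ satisfies $$\big\langle(e-\tfrac12)[D_\theta,e]^{2n}\big\rangle=\gamma,$$ where $\langle\ \rangle$ is the projection on the commutant of $M_{2^n}(\mathbb{C})$ and $\gamma$ on the right-hand side is the $\mathbb{Z}_2$-grading of the spinor Hilbert space. (ii) Let $U\in M_{2^{n-1}}(C^\infty(S^{2n-1}_\theta))$ be the unitary $U=\sum_{\mu=1}^n(\bar\sigma^\mu v^\mu+\sigma^\mu\bar v^\mu)$. Then the Dirac operator $D_\theta$ of $S^{2n-1}_\theta$ associated to the metric $g$ satisfies $$\big\langle U[D_\theta,U^*]\big([D_\theta,U][D_\theta,U^*]\big)^{n-1}\big\rangle=1,$$ where $\langle\ \rangle$ is the projection on the commutant of $M_{2^{n-1}}(\mathbb{C})$.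
   Context: $n\ge2$, $\theta\in M_n(\mathbb{R})$ antisymmetric, $\lambda^{\mu\nu}=e^{i\theta_{\mu\nu}}$, $T^n=\mathbb{R}^n/\mathbb{Z}^n$. Action: $T^n$ acts on $S^{2n}\subset\mathbb{C}^n\times\mathbb{R}$ and $S^{2n-1}\subset\mathbb{C}^n$ by $\sigma_s(z^\mu_{(0)})=e^{2\pi is_\mu}z^\mu_{(0)}$ on the classical complex coordinates, fixing the last real coordinate $u$. $C^\infty(T^n_\theta)$: rapidly decreasing series in unitaries $U^1,\dots,U^n$ with $U^\mu U^\nu=\lambda^{\mu\nu}U^\nu U^\mu$, action $\tau_s(U^\mu)=e^{2\pi is_\mu}U^\mu$. $C^\infty(S^m_\theta)$ is the subalgebra of $C^\infty(S^m)\widehat\otimes C^\infty(T^n_\theta)$ fixed by all $\sigma_s\otimes\tau_{-s}$. In it, $u^\mu=z^\mu_{(0)}\otimes U^\mu$, $u^{\mu*}$ its adjoint, and $u=u\otimes\mathbf 1$ for $m=2n$; $v^\mu=z^\mu_{(0)}\otimes U^\mu$, $\bar v^\mu=v^{\mu*}$ for $m=2n-1$. Clifford algebra: $\Gamma^\mu,\Gamma^{\mu*}=(\Gamma^\mu)^*\in M_{2^n}(\mathbb{C})$ satisfy $\Gamma^\mu\Gamma^\nu+\lambda^{\nu\mu}\Gamma^\nu\Gamma^\mu=0$, $\Gamma^{\mu*}\Gamma^{\nu*}+\lambda^{\nu\mu}\Gamma^{\nu*}\Gamma^{\mu*}=0$, $\Gamma^{\mu*}\Gamma^\nu+\lambda^{\mu\nu}\Gamma^\nu\Gamma^{\mu*}=\delta^{\mu\nu}\mathbf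 1$ (irreducible representation); $\gamma=\prod_\mu[\Gamma^{\mu*},\Gamma^\mu]$ in the formula for $e$. In a basis where $\gamma=\mathrm{diag}(\mathbf 1,-\mathbf 1)$, $\Gamma^\mu=\begin{pmatrix}0&\sigma^\mu\\ \bar\sigma^{\mu*}&0\end{pmatrix}$, $\Gamma^{\mu*}=\begin{pmatrix}0&\bar\sigma^\mu\\ \sigma^{\mu*}&0\end{pmatrix}$ define $\sigma^\mu,\bar\sigma^\mu\in M_{2^{n-1}}(\mathbb{C})$. Dirac operator: let $D$ be the Dirac operator of $(S^m,g)$ on sections of the spin bundle $S$. There is a twofold covering $p:\tilde T^n\to T^n$ and a lift $\tilde s\mapsto V_{\tilde s}$ of $\sigma$ to $S$ commuting with $D$. Let $\tilde T^n_\theta=T^n_{\frac12\theta}$ with canonical action $\tilde\tau$ of $\tilde T^n$, $C^\infty(T^n_\theta)$ being identified with the $\ker p$-invariants of $C^\infty(\tilde T^n_\theta)$; $L^2(\tilde T^n_\theta)$ is the completion for the normalized trace. $\mathcal{H}_\theta$ is the subspace of $L^2(S^m,S)\widehat\otimes L^2(\tilde T^n_\theta)$ fixed by all $V_{\tilde s}\otimes\tilde\tau_{-\tilde s}$, $D_\theta$ is the restriction of $D\otimes I$ to $\mathcal{H}_\theta$, and for $m=2n$ the grading of $\mathcal{H}_\theta$ is induced by that of $S$. $M_N(C^\infty(S^m_\theta))$ acts on $\mathbb{C}^N\otimes\mathcal{H}_\theta$, $D_\theta$ acts there as $I\otimes D_\theta$, and the projection $\langle\ \rangle$ on the commutant of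 $M_N(\mathbb{C})$ is the map $A\otimes T\mapsto\frac1N\mathrm{tr}(A)\,T$. Normalization convention: the round metric on $S^m$ (its radius) and the orientation are normalized, depending only on $m$, so that the stated identity holds in the classical case $\theta=0$ with $g$ the round metric. *)

(* Defs.v *)
From HB Require Import structures.
From mathcomp Require Import all_boot all_order all_algebra.
From mathcomp Require Import complex.
From mathcomp Require Import all_classical all_reals all_analysis.

Set Implicit Arguments.
Unset Strict Implicit.
Unset Printing Implicit Defensive.

Import Order.TTheory GRing.Theory Num.Theory.
Import numFieldNormedType.Exports.

Local Open Scope classical_set_scope.
Local Open Scope ring_scope.

(** * Smooth functions *)

Section Smooth.
Variables (R : realType) (V : normedModType R).

Definition iter_derive (vs : seq V) (f : V -> R) : V -> R :=
  foldr (fun (v : V) (h : V -> R) (x : V) => ('D_v h x : R)) f vs.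

Definition smooth_on (O : set V) (f : V -> R) : Prop :=
  forall (vs : seq V) (x : V), O x -> differentiable (iter_derive vs f) x.

Definition csmooth_on (O : set V) (f : V -> R[i]) : Prop :=
  smooth_on O (fun x => complex.Re (f x)) /\
  smooth_on O (fun x => complex.Im (f x)).

Definition mxsmooth_on (p q : nat) (O : set V) (f : V -> 'M[R[i]]_(p, q)) :
    Prop :=
  forall i j, csmooth_on O (fun x => f x i j).

Definition mxderive (p q : nat) (f : V -> 'M[R[i]]_(p, q)) (v x : V) :
    'M[R[i]]_(p, q) :=
  \matrix_(i, j) (('D_v (fun y => complex.Re (f y i j)) x : R) +i*
                  ('D_v (fun y => complex.Im (f y i j)) x : R))%C.

End Smooth.

Definition cis (R : realType) (t : R) : R[i] := (cos t +i* sin t)%C.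

Definition conjmx (R : realType) (p q : nat) (A : 'M[R[i]]_(p, q)) :
  'M[R[i]]_(p, q) := map_mx (@Num.conj R[i]) A.

Definition adjmx (R : realType) (p q : nat) (A : 'M[R[i]]_(p, q)) :
  'M[R[i]]_(q, p) := conjmx A^T.

Definition normsq (R : realType) (z : R[i]) : R :=
  complex.Re z ^+ 2 + complex.Im z ^+ 2.

Definition clim (R : realType) (u : nat -> R[i]) : R[i] :=
  (lim ((fun M => complex.Re (u M)) @ \oo) +i*
   lim ((fun M => complex.Im (u M)) @ \oo))%C.

(** * The sphere S^m in R^(m+1)

    A function on S^m is a function on R^(m+1) of which only the values at
    points of S^m matter: it is differentiated after composition with the
    radial projection [sproj].  Similarly a tangent vector at x is a vector of
    R^(m+1) orthogonal to x. *)

Section Sphere.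
Variables (R : realType) (m : nat).
Let E := 'rV[R]_m.+1.

Definition dotp (v w : E) : R := \sum_j v 0 j * w 0 j.

Definition sphere : set E := [set x | dotp x x = 1].

Definition sproj (x : E) : E := (Num.sqrt (dotp x x))^-1 *: x.

Definition punctured : set E := [set x | x != 0].

Definition tangent (x v : E) : Prop := dotp x v = 0.

Definition ssmooth (f : E -> R) : Prop := smooth_on punctured (f \o sproj).

Definition smxsmooth (p q : nat) (f : E -> 'M[R[i]]_(p, q)) : Prop :=
  mxsmooth_on punctured (f \o sproj).

Definition sderive (f : E -> R) (v x : E) : R := 'D_v (f \o sproj) x.

Definition smxderive (p q : nat) (f : E -> 'M[R[i]]_(p, q)) (v x : E) :
  'M[R[i]]_(p, q) := mxderive (f \o sproj) v x.

Definition vector_field (X : E -> E) : Prop :=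
  (forall j, ssmooth (fun x => X x 0 j)) /\
  (forall x, sphere x -> tangent x (X x)).

Definition vfderive (Y : E -> E) (v x : E) : E :=
  \row_j sderive (fun y => Y y 0 j) v x.

Definition lie_bracket (X Y : E -> E) (x : E) : E :=
  vfderive Y (X x) x - vfderive X (Y x) x.

Definition riemannian (g : E -> E -> E -> R) : Prop :=
  [/\ forall x v w, sphere x -> tangent x v -> tangent x w ->
        g x v w = g x w v,
      forall x (a : R) v v' w, sphere x -> tangent x v -> tangent x v' ->
        tangent x w -> g x (a *: v + v') w = a * g x v w + g x v' w,
      forall x v, sphere x -> tangent x v -> v != 0 -> 0 < g x v v
    & forall X Y, vector_field X -> vector_field Y ->
        ssmooth (fun x => g x (X x) (Y x))].

(* The round metric of the sphere of radius r, transported to the unit sphere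
   on which the coordinate functions live. *)
Definition round (r : R) (x v w : E) : R := r ^+ 2 * dotp v w.

(* The orientation of S^m is that of the boundary of the unit ball, reversed
   when eps is true; vs lists m tangent vectors at x as rows. *)
Definition orient (eps : bool) (x : E) (vs : 'M[R]_(m, m.+1)) : R :=
  (-1) ^+ eps * \det (col_mx x vs : 'M[R]_m.+1).

Definition volume_form (g : E -> E -> E -> R) (eps : bool) (x : E)
    (vs : 'M[R]_(m, m.+1)) : R :=
  Num.sg (orient eps x vs) *
  Num.sqrt (\det (\matrix_(a, b) g x (row a vs) (row b vs))).

Definition same_volume_form (eps : bool) (g g' : E -> E -> E -> R) : Prop :=
  forall x (vs : 'M[R]_(m, m.+1)), sphere x ->
    (forall a, tangent x (row a vs)) ->
    volume_form g eps x vs = volume_form g' eps x vs.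

Definition orthonormal_frame (g : E -> E -> E -> R) (x : E)
    (vs : 'M[R]_(m, m.+1)) : Prop :=
  (forall a, tangent x (row a vs)) /\
  (forall a b, g x (row a vs) (row b vs) = (a == b)%:R).

Definition levi_civita (g : E -> E -> E -> R)
    (nabla : (E -> E) -> (E -> E) -> (E -> E)) : Prop :=
  [/\ forall X Y, vector_field X -> vector_field Y ->
        vector_field (nabla X Y),
      forall (f : E -> R) X X' Y, ssmooth f -> vector_field X ->
        vector_field X' -> vector_field Y -> forall x, sphere x ->
        nabla (fun y => f y *: X y + X' y) Y x =
        f x *: nabla X Y x + nabla X' Y x,
      forall (f : E -> R) X Y Y', ssmooth f -> vector_field X ->
        vector_field Y -> vector_field Y' -> forall x, sphere x ->
        nabla X (fun y => f y *: Y y + Y' y) x =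
        sderive f (X x) x *: Y x + f x *: nabla X Y x + nabla X Y' x,
      forall X Y, vector_field X -> vector_field Y -> forall x, sphere x ->
        nabla X Y x - nabla Y X x = lie_bracket X Y x
    & forall X Y Z, vector_field X -> vector_field Y -> vector_field Z ->
        forall x, sphere x ->
        sderive (fun y => g y (Y y) (Z y)) (X x) x =
        g x (nabla X Y x) (Z x) + g x (Y x) (nabla X Z x)].

End Sphere.

(** * The torus action

    z^mu = x_(2 mu) + i x_(2 mu + 1) for mu < n, and for m = 2n the last real
    coordinate is u = x_(2n). *)

Section TorusAction.
Variables (R : realType) (m n : nat).
Let E := 'rV[R]_m.+1.

Definition zcoord (mu : 'I_n) (x : E) : R[i] :=
  (x 0 (inord mu.*2) +i* x 0 (inord mu.*2.+1))%C.

Definition ucoord (x : E) : R[i] := (x 0 ord_max)%:C%C.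

(* z^mu (rot s x) = e^(2 pi i s_mu) z^mu x; other coordinates are fixed. *)
Definition rot (s : 'rV[R]_n) (x : E) : E :=
  \row_(j < m.+1)
    if insub (j : nat)./2 is Some mu then
      let t := 2 * pi * s 0 (mu : 'I_n) in
      if odd j then sin t * x 0 (inord j.-1) + cos t * x 0 j
      else cos t * x 0 j - sin t * x 0 (inord j.+1)
    else x 0 j.

Definition torus_invariant (g : E -> E -> E -> R) : Prop :=
  forall s x v w, sphere x -> tangent x v -> tangent x w ->
    g (rot s x) (rot s v) (rot s w) = g x v w.

Definition lift_act (N : nat) (V : 'rV[R]_n -> E -> 'M[R[i]]_N) (s : 'rV[R]_n)
    (psi : E -> 'cV[R[i]]_N) (x : E) : 'cV[R[i]]_N :=
  V s x *m psi (rot s x).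

End TorusAction.

(** * Spinors and the Dirac operator

    For m >= 3 the spinor bundle of S^m is trivial as a Hermitian bundle: for
    the round metric it is the restriction of a constant (half-)spinor bundle
    of R^(m+1), and its isomorphism class does not depend on the metric.  So it
    is given as the product of S^m by C^N, N = 2^(floor (m/2)), while Clifford
    multiplication, spin connection and charge conjugation vary from point to
    point. *)

Section SpinGeometry.
Variables (R : realType) (m n : nat).
Let E := 'rV[R]_m.+1.
Let N := (2 ^ m./2)%N.
Let C := R[i].

Definition clifford_mult (g : E -> E -> E -> R) (c : E -> E -> 'M[C]_N) :
    Prop :=
  [/\ forall x (a : R) v w, sphere x -> tangent x v -> tangent x w ->
        c x (a *: v + w) = a%:C%C *: c x v + c x w,
      forall x v w, sphere x -> tangent x v -> tangent x w ->
        c x v *m c x w + c x w *m c x v = ((2 * g x v w)%:C%C)%:M,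
      forall x v, sphere x -> tangent x v -> adjmx (c x v) = c x v
    & forall X, vector_field X -> smxsmooth (fun x => c x (X x))].

(* chi is the complex volume element (-i)^(floor (m/2)) c(e_1)...c(e_m) of the
   oriented metric.  It is the Z_2-grading for m even; for m odd it is 1, which
   selects one of the two irreducible Clifford modules. *)
Definition chirality (g : E -> E -> E -> R) (eps : bool)
    (c : E -> E -> 'M[C]_N) (chi : E -> 'M[C]_N) : Prop :=
  (forall x vs, sphere x -> orthonormal_frame g x vs -> 0 < orient eps x vs ->
     chi x = (- 'i%C) ^+ m./2 *: \prod_(a < m) c x (row a vs)) /\
  (odd m -> forall x, sphere x -> chi x = 1%:M).

Definition spin_deriv (A : E -> E -> 'M[C]_N) (psi : E -> 'cV[C]_N) (v x : E) :
    'cV[C]_N :=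
  smxderive psi v x + A x v *m psi x.

(* The antiunitary psi |-> B conj(psi) commutes or anticommutes with Clifford
   multiplication: it distinguishes the spin connection among the
   Clifford connections. *)
Definition charge_conjugation (c : E -> E -> 'M[C]_N) (B : E -> 'M[C]_N) :
    Prop :=
  [/\ smxsmooth B,
      forall x, sphere x -> B x *m adjmx (B x) = 1%:M
    & exists sgn : bool, forall x v, sphere x -> tangent x v ->
        B x *m conjmx (c x v) = (-1) ^+ sgn *: (c x v *m B x)].

Definition spin_connection (nabla : (E -> E) -> (E -> E) -> (E -> E))
    (c : E -> E -> 'M[C]_N) (B : E -> 'M[C]_N) (A : E -> E -> 'M[C]_N) :
    Prop :=
  [/\ forall x (a : R) v w, sphere x -> tangent x v -> tangent x w ->
        A x (a *: v + w) = a%:C%C *: A x v + A x w,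
      forall X, vector_field X -> smxsmooth (fun x => A x (X x)),
      forall x v, sphere x -> tangent x v -> adjmx (A x v) = - A x v,
      forall X Y (psi : E -> 'cV[C]_N), vector_field X -> vector_field Y ->
        smxsmooth psi -> forall x, sphere x ->
        spin_deriv A (fun y => c y (Y y) *m psi y) (X x) x =
        c x (nabla X Y x) *m psi x + c x (Y x) *m spin_deriv A psi (X x) x
    & forall (psi : E -> 'cV[C]_N) x v, smxsmooth psi -> sphere x ->
        tangent x v ->
        spin_deriv A (fun y => B y *m conjmx (psi y)) v x =
        B x *m conjmx (spin_deriv A psi v x)].

Definition dirac_operator (g : E -> E -> E -> R) (c A : E -> E -> 'M[C]_N)
    (D : (E -> 'cV[C]_N) -> (E -> 'cV[C]_N)) : Prop :=
  forall psi x vs, smxsmooth psi -> sphere x -> orthonormal_frame g x vs ->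
    D psi x =
    - 'i%C *: \sum_(a < m) c x (row a vs) *m spin_deriv A psi (row a vs) x.

(* The covering torus is R^n / {s in Z^n : s_1 + ... + s_n even}, a twofold
   covering of R^n / Z^n; a rotation by 2 pi in one coordinate plane lifts to -1
   on spinors. *)
Definition torus_lift (D : (E -> 'cV[C]_N) -> (E -> 'cV[C]_N))
    (V : 'rV[R]_n -> E -> 'M[C]_N) : Prop :=
  [/\ mxsmooth_on [set p : 'rV[R]_n * E | p.2 != 0]
        (fun p => V p.1 (sproj p.2)),
      forall s x, sphere x -> V s x *m adjmx (V s x) = 1%:M,
      forall s t x, sphere x -> V (s + t) x = V s x *m V t (rot s x),
      forall (k : 'rV[int]_n) x, (2 %| (\sum_mu k 0 mu)%R)%Z -> sphere x ->
        V (map_mx intr k) x = 1%:M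
    & forall s (psi : E -> 'cV[C]_N) x, smxsmooth psi -> sphere x ->
        D (lift_act V s psi) x = lift_act V s (D psi) x].

Record spin_geometry (g : E -> E -> E -> R) (eps : bool) := SpinGeometry {
  cliff : E -> E -> 'M[C]_N;
  grading : E -> 'M[C]_N;
  tangent_conn : (E -> E) -> (E -> E) -> (E -> E);
  charge : E -> 'M[C]_N;
  spin_form : E -> E -> 'M[C]_N;
  dirac_op : (E -> 'cV[C]_N) -> (E -> 'cV[C]_N);
  spin_lift : 'rV[R]_n -> E -> 'M[C]_N;
  cliffP : clifford_mult g cliff;
  gradingP : chirality g eps cliff grading;
  tangent_connP : levi_civita g tangent_conn;
  chargeP : charge_conjugation cliff charge;
  spin_formP : spin_connection tangent_conn cliff charge spin_form;
  diracP : dirac_operator g cliff spin_form dirac_op;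
  liftP : torus_lift dirac_op spin_lift
}.

(* The Riemannian measure of g is that of a round metric, that is, up to a
   factor which is irrelevant here, the rotation invariant measure. *)
Definition round_measure
    (mu : {measure set (g_sigma_algebraType (@open E)) -> \bar R}) : Prop :=
  [/\ mu (~` @sphere R m) = 0%E,
      (0 < mu (@sphere R m) < +oo)%E
    & forall (O : 'M[R]_m.+1) (A : set (g_sigma_algebraType (@open E))),
        O *m O^T = 1%:M -> measurable A ->
        mu [set x | A ((x : E) *m O)] = mu A].

End SpinGeometry.

(** * The noncommutative torus and the space H_theta

    The smooth algebra of the covering noncommutative torus is spanned by Weyl
    unitaries W(k/2), where k is an integer vector with all entries of the same
    parity, and
      W(a) W(b) = exp ((i/2) sum theta_(mu nu) a_mu b_nu) W(a + b).
    The weights below are the doubled vectors k.  The invariants of the kernel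
    of the covering are the even k, and U^mu = W(e_mu) satisfies
    U^mu U^nu = e^(i theta_(mu nu)) U^nu U^mu.  The W(k/2) are orthonormal in
    L^2, on which the algebra acts by left multiplication.  The family (f_k) of
    functions (sections) stands for sum_k f_k (x) W(k/2). *)

Section Theta.
Variables (R : realType) (m n : nat).
Let E := 'rV[R]_m.+1.
Let C := R[i].
Let weight := 'rV[int]_n.

Definition antisymmetric_mx (theta : 'M[R]_n) : Prop := theta^T = - theta.

Definition weyl_phase (theta : 'M[R]_n) (k l : weight) : C :=
  cis (8^-1 *
    \sum_mu \sum_nu theta mu nu * (k 0 mu)%:~R * (l 0 nu)%:~R).

Definition cover_weight (k : weight) : Prop :=
  forall mu nu, (2 %| (k 0 mu - k 0 nu)%R)%Z.

Definition base_weight (k : weight) : Prop := forall mu, (2 %| (k 0 mu)%R)%Z.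

Definition weight_size (k : weight) : R := 1 + \sum_mu `|k 0 mu|%:~R.

(* e^(- 2 pi i k.s / 2), the action of -s on W(k/2) *)
Definition weight_char (k : weight) (s : 'rV[R]_n) : C :=
  cis (- pi * \sum_mu (k 0 mu)%:~R * s 0 mu).

(* Smooth families, rapidly decreasing for the topology of C^infinity(S^m) *)
Definition rapid (p : nat) (F : weight -> E -> 'cV[C]_p) : Prop :=
  (forall k, smxsmooth (F k)) /\
  (forall (vs : seq E) (d : nat) (j : 'I_p), exists K : R,
     forall k x, sphere x ->
       `|iter_derive vs (fun y => complex.Re (F k (sproj y) j 0)) x|
         * weight_size k ^+ d <= K /\
       `|iter_derive vs (fun y => complex.Im (F k (sproj y) j 0)) x|
         * weight_size k ^+ d <= K).

Definition alg := weight -> E -> C.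

(* C^infinity(S^m_theta) *)
Definition Cinf_theta (a : alg) : Prop :=
  [/\ rapid (fun k x => (a k x)%:M : 'cV[C]_1),
      forall k x, ~ base_weight k -> sphere x -> a k x = 0
    & forall k s x, sphere x -> weight_char k s * a k (rot s x) = a k x].

Definition aone : alg := fun k _ => (k == 0)%:R.

(* f (x) W(k/2) *)
Definition atens (f : E -> C) (k : weight) : alg :=
  fun l x => if l == k then f x else 0.

Definition astar (a : alg) : alg := fun k x => (a (- k) x)^*.

Definition ugen (mu : 'I_n) : alg := atens (zcoord mu) (2 *: delta_mx 0 mu).

Definition ureal : alg := atens (@ucoord R m) 0.

Definition weight_of_box (M : nat) (l : {ffun 'I_n -> 'I_(M.*2.+1)}) : weight :=
  \row_mu ((l mu)%:Z - M%:Z).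

Section Operators.
Variables (N : nat) (theta : 'M[R]_n).

Definition sections := weight -> E -> 'cV[C]_N.

(* The action of sum_l a_l (x) W(l/2); the series over l is the limit of its
   partial sums over the cubes [-M, M]^n. *)
Definition alg_act (a : alg) (psi : sections) : sections := fun k x =>
  \col_j clim (fun M : nat =>
     \sum_(l : {ffun 'I_n -> 'I_(M.*2.+1)})
        let w := weight_of_box l in
        weyl_phase theta w (k - w) * a w x * psi (k - w) x j 0).

(* C^M (x) sections, and the action of M_M(algebra) on it *)
Definition msections (M : nat) := 'I_M -> sections.

Definition mact (M : nat) (a : 'I_M -> 'I_M -> alg) (Phi : msections M) :
  msections M := fun i k x => \sum_j alg_act (a i j) (Phi j) k x.

Section Hilbert.
Variables (mu : {measure set (g_sigma_algebraType (@open E)) -> \bar R})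
          (V : 'rV[R]_n -> E -> 'M[C]_N).

Definition norm2 (psi : sections) : \bar R :=
  (\esum_(k in [set: weight])
     \int[mu]_(x in @sphere R m) (\sum_(j < N) normsq (psi k x j ord0))%:E)%E.

(* H_theta; its elements are represented by functions, equality of elements
   being [ae_eq_sec]. *)
Definition in_H (psi : sections) : Prop :=
  [/\ forall k j,
        measurable_fun (@sphere R m : set (g_sigma_algebraType (@open E)))
          (fun x => complex.Re (psi k x j 0)) /\
        measurable_fun (@sphere R m : set (g_sigma_algebraType (@open E)))
          (fun x => complex.Im (psi k x j 0)),
      (norm2 psi < +oo)%E,
      forall k, ~ cover_weight k -> {ae mu, forall x, sphere x -> psi k x = 0}
    & forall s k, {ae mu, forall x, sphere x ->
        weight_char k s *: lift_act V s (psi k) x = psi k x}].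

Definition ae_eq_sec (psi phi : sections) : Prop :=
  forall k, {ae mu, forall x, sphere x -> psi k x = phi k x}.

(* The core of smooth elements of H_theta *)
Definition smooth_H (psi : sections) : Prop :=
  [/\ rapid psi,
      forall k x, ~ cover_weight k -> sphere x -> psi k x = 0
    & forall s k x, sphere x ->
        weight_char k s *: lift_act V s (psi k) x = psi k x].

Definition mnorm2 (M : nat) (Phi : msections M) : \bar R :=
  (\sum_(i < M) norm2 (Phi i))%E.

Definition in_MH (M : nat) (Phi : msections M) : Prop :=
  forall i, in_H (Phi i).

Definition ae_eq_msec (M : nat) (Phi Psi : msections M) : Prop :=
  forall i, ae_eq_sec (Phi i) (Psi i).

Definition bounded_op (M : nat) (T : msections M -> msections M) : Prop :=
  [/\ forall Phi, in_MH Phi -> in_MH (T Phi),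
      forall (a : C) Phi Psi, in_MH Phi -> in_MH Psi ->
        ae_eq_msec (T (fun i k x => a *: Phi i k x + Psi i k x))
                   (fun i k x => a *: T Phi i k x + T Psi i k x)
    & exists K : R, forall Phi, in_MH Phi ->
        (mnorm2 (T Phi) <= K%:E * mnorm2 Phi)%E].

(* D_theta, the restriction of D (x) I *)
Definition dirac_theta (D : (E -> 'cV[C]_N) -> (E -> 'cV[C]_N))
  (psi : sections) : sections := fun k => D (psi k).

(* [I (x) D_theta, a] on the smooth elements *)
Definition dirac_comm (M : nat) (D : (E -> 'cV[C]_N) -> (E -> 'cV[C]_N))
    (a : 'I_M -> 'I_M -> alg) (Phi : msections M) : msections M :=
  fun i k x => dirac_theta D (mact a Phi i) k x
             - mact a (fun j => dirac_theta D (Phi j)) i k x.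

(* T is the bounded operator [D_theta, a] on C^M (x) H_theta: as smooth
   elements are dense in H_theta, T is unique up to almost everywhere
   equality. *)
Definition is_dirac_comm (M : nat) (D : (E -> 'cV[C]_N) -> (E -> 'cV[C]_N))
    (a : 'I_M -> 'I_M -> alg) (T : msections M -> msections M) : Prop :=
  bounded_op T /\
  (forall Phi, (forall i, smooth_H (Phi i)) ->
     ae_eq_msec (T Phi) (dirac_comm D a Phi)).

End Hilbert.

(* The map A (x) T |-> (1/M) tr(A) T on operators on C^M (x) H_theta *)
Definition commutant_proj (M : nat) (T : msections M -> msections M)
    (psi : sections) : sections := fun k x =>
  M%:R^-1 *:
    \sum_(i < M) T (fun j l y => if j == i then psi l y else 0) i k x.

Definition grade (chi : E -> 'M[C]_N) (psi : sections) : sections :=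
  fun k x => chi x *m psi k x.

End Operators.

(** * The Clifford algebra, the projection e and the unitary U *)

Definition lam (theta : 'M[R]_n) (mu nu : 'I_n) : C := cis (theta mu nu).

Definition theta_clifford (p : nat) (theta : 'M[R]_n) (Gam : 'I_n -> 'M[C]_p) :
    Prop :=
  forall mu nu,
  [/\ Gam mu *m Gam nu + lam theta nu mu *: (Gam nu *m Gam mu) = 0,
      adjmx (Gam mu) *m adjmx (Gam nu) +
        lam theta nu mu *: (adjmx (Gam nu) *m adjmx (Gam mu)) = 0
    & adjmx (Gam mu) *m Gam nu +
        lam theta mu nu *: (Gam nu *m adjmx (Gam mu)) = ((mu == nu)%:R)%:M].

(* Subspaces of column vectors are row spaces of transposes. *)
Definition irreducible_rep (p : nat) (Gam : 'I_n -> 'M[C]_p) : Prop :=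
  (0 < p)%N /\
  forall W : 'M[C]_p,
    (forall mu, stablemx W (Gam mu)^T /\ stablemx W (adjmx (Gam mu))^T) ->
    W = 0 \/ row_full W.

Definition gamma_elt (p : nat) (Gam : 'I_n -> 'M[C]_p) : 'M[C]_p :=
  \prod_(mu < n) (adjmx (Gam mu) *m Gam mu - Gam mu *m adjmx (Gam mu)).

Definition proj_e (p : nat) (Gam : 'I_n -> 'M[C]_p) : 'I_p -> 'I_p -> alg :=
  fun i j k x => 2^-1 *
    ((i == j)%:R * aone k x
     + \sum_mu (adjmx (Gam mu) i j * ugen mu k x
                + Gam mu i j * astar (ugen mu) k x)
     + gamma_elt Gam i j * ureal k x).

Definition half_one (p : nat) : 'I_p -> 'I_p -> alg :=
  fun i j k x => 2^-1 * (i == j)%:R * aone k x.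

Definition asub (p : nat) (a b : 'I_p -> 'I_p -> alg) : 'I_p -> 'I_p -> alg :=
  fun i j k x => a i j k x - b i j k x.

(* The generators of odd spheres are the same formulas z^mu (x) U^mu. *)
Definition unit_U (h : nat) (sig sigb : 'I_n -> 'M[C]_h) :
    'I_h -> 'I_h -> alg :=
  fun i j k x => \sum_mu (sigb mu i j * ugen mu k x
                          + sig mu i j * astar (ugen mu) k x).

Definition mstar (p : nat) (a : 'I_p -> 'I_p -> alg) : 'I_p -> 'I_p -> alg :=
  fun i j => astar (a j i).

(* Gamma^mu in a basis in which gamma = diag(1, -1) *)
Definition block_Gam (h : nat) (sig sigb : 'I_n -> 'M[C]_h) (mu : 'I_n) :
    'M[C]_(h + h) :=
  block_mx 0 (sig mu) (adjmx (sigb mu)) 0.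

End Theta.

(* Main.v *)
(* The twists cancel: the products of the [Gam mu] with the generators of the
   noncommutative torus satisfy the relations of the ordinary Clifford algebra.
   Hence at a point x of the sphere e = (1 + F(x)) / 2, resp. U, is an affine
   function of the coordinates whose linear part F is spanned by classical
   anticommuting generators, and in an orthonormal tangent frame e_a the Leibniz
   rule gives [D, F] = -i sum_a F(e_a) c(e_a).
   The normalized partial trace over the matrix factor, applied to the elements
   of the right torus weight, behaves as a cyclic trace. It therefore kills each
   product of generators missing a letter, and the remaining ones add up to m!
   times the determinant of (x, e_1, ..., e_m) times the volume element
   c(e_1) ... c(e_m). As the volume form is the round one, that determinant is
   r^-m up to the orientation sign, and r^(2n) = (2n)! / 2^(2n+1), resp.
   r^(2n-1) = (2n-1)!, makes the constant 1. For odd spheres U and its adjoint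
   are the off-diagonal blocks of F, so the words are traced against
   (1 +- gamma) / 2; the part without gamma vanishes since F anticommutes with
   [D, F] and m is odd. *)

From HB Require Import structures.
Require Import Defs.
From mathcomp Require Import all_boot all_order all_algebra perm.
From mathcomp Require Import complex.
From mathcomp Require Import all_classical all_reals all_analysis.
From mathcomp Require Import measurable_realfun ring lra zify.
Import Order.TTheory GRing.Theory Num.Theory.
Import numFieldNormedType.Exports.

Set Implicit Arguments.
Unset Strict Implicit.
Unset Printing Implicit Defensive.

Local Open Scope classical_set_scope.
Local Open Scope ring_scope.

(** * Cyclic traces of products of anticommuting elements *)

(** Weyl factors shift the weight and carry phases, so the trace over the matrix factor is not
    cyclic on all operators. It is cyclic on those whose Weyl weight matches the degree of their
    matrix under the number operators [Gamma^{mu*} Gamma^mu]: a product of nonzero total weight then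
    has a traceless matrix, and opposite weights meet with phase 1. Clifford multiplication acts on
    the spinor side and commutes with all of this, so it is kept as a fixed right factor. The
    commutator of [D] with a coordinate is Clifford multiplication by a gradient. This gives the
    bounded extension explicitly and makes the final identity hold at every point of the sphere.
    Stability of [H_theta] requires a gradient that is smooth, although spheres have no global frame
    in general (a Gram matrix of tangential coordinate fields is inverted instead), and torus
    equivariant (this is extracted from the commutation of the lift with [D]). The power of 2 in
    [r^(2n)] collects one factor 1/2 from [e - 1/2] and one from each commutator; the orientation
    sign [(-1)^n] absorbs [(-i)^(2n)]. *)

Section AnticommutingProducts.
Variables (A : pzRingType) (I : finType) (G : I -> A).
Hypothesis anti : forall i j, i != j -> G i * G j = - (G j * G i).

Lemma anticomm_prod (z : A) (s : seq I) : (forall i, i \in s -> z * G i = - (G i * z)) ->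
  z * (\prod_(i <- s) G i) = (-1) ^+ size s * (\prod_(i <- s) G i) * z.
Proof.
elim: s => [|i s IH] H; first by rewrite big_nil expr0 !mulr1 mul1r.
rewrite !big_cons mulrA H ?mem_head // mulNr -mulrA IH; last first.
  by move=> j js; apply: H; rewrite inE js orbT.
by rewrite /= exprS mulN1r !mulNr !mulrA commr_sign.
Qed.

(** On both sides the first of the two letters is carried across [v] at the cost of the same sign;
    the letters then stand next to each other and differ by a single exchange. *)
Lemma prod_swap (u v w : seq I) (a b : I) : uniq (u ++ a :: v ++ b :: w) ->
  \prod_(i <- u ++ a :: v ++ b :: w) G i =
  - \prod_(i <- u ++ b :: v ++ a :: w) G i.
Proof.
rewrite cat_uniq => /and3P[_ _]; rewrite cons_uniq => /andP[].
rewrite mem_cat inE !negb_or => /and3P[av ab _].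
rewrite cat_uniq cons_uniq /= negb_or => /and3P[_ /andP[bv _] _].
rewrite !big_cat !big_cons !big_cat !big_cons /= -mulrN; congr (_ * _).
rewrite !mulrA [G a * _]anticomm_prod; last first.
  by move=> i iv; apply: anti; apply: contraNneq av => ->.
rewrite [G b * _]anticomm_prod; last first.
  by move=> i iv; apply: anti; apply: contraNneq bv => ->.
by rewrite -(mulrA _ (G a) (G b)) (anti ab) mulrN !mulNr !mulrA.
Qed.

Lemma map_tperm_id (x y : I) (s : seq I) : x \notin s -> y \notin s ->
  [seq tperm x y i | i <- s] = s.
Proof.
move=> xs ys; rewrite -[RHS]map_id; apply/eq_in_map => i si /=.
by rewrite tpermD //; [apply: contraNneq xs|apply: contraNneq ys] => ->.
Qed.

Lemma prod_map_tperm (x y : I) (s : seq I) : uniq s -> x \in s -> y \in s ->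
  x != y -> \prod_(i <- s) G (tperm x y i) = - \prod_(i <- s) G i.
Proof.
wlog: x y / (index x s < index y s)%N => [W us xs ys xy|ixy us xs ys xy].
  case: (ltngtP (index x s) (index y s)) => h; first exact: W.
    by rewrite tpermC; apply: W; rewrite // eq_sym.
  by move: xy; rewrite -(nth_index x xs) h nth_index // eqxx.
rewrite -(big_map (tperm x y) xpredT G).
case/splitPr: xs us ixy ys => u t us.
have xu : x \notin u.
  by move: us; rewrite cat_uniq /= negb_or => /and3P[_ /andP[]].
rewrite !index_cat (negPf xu) /= eqxx addn0 => ixy; rewrite mem_cat inE.
have yu : y \notin u.
  by apply: contraTN ixy => yu; rewrite yu -leqNgt ltnW // index_mem.
rewrite (negPf yu) eq_sym (negPf xy) /= => yt.
case/splitPr: yt us ixy => v w us _.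
move: (us); rewrite cat_uniq cons_uniq mem_cat inE !negb_or => /and3P[_ _].
case/andP=> /and3P[xv _ xw]; rewrite cat_uniq cons_uniq /= negb_or.
case/and3P=> _ /andP[yv _] /andP[yw _].
rewrite (prod_swap us) opprK map_cat /= map_cat /= tpermL tpermR.
by rewrite !map_tperm_id.
Qed.

End AnticommutingProducts.

(** Induction on a decomposition into transpositions: the family permuted by [s] is again
    anticommuting, so each further transposition only changes the sign. *)
Lemma prod_perm_anti (A : pzRingType) (d : nat) (G : 'I_d -> A) (s : 'S_d) :
  (forall i j, i != j -> G i * G j = - (G j * G i)) ->
  \prod_(i < d) G (s i) = (-1) ^+ s * \prod_(i < d) G i.
Proof.
move=> anti; case: (prod_tpermP s) => ts -> {s} /=.
elim: ts => [_|t ts IH] /=.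
  by rewrite big_nil odd_perm1 expr0 mul1r; apply: eq_bigr => i _; rewrite perm1.
case/andP=> nt dts; rewrite big_cons odd_permM odd_tperm nt.
set s := (\prod_(i <- ts) tperm i.1 i.2)%g in IH *.
under eq_bigr do rewrite permM.
rewrite (@prod_map_tperm _ _ (fun j => G (s j))) ?index_enum_uniq ?mem_index_enum //; last first.
  by move=> i j ij; apply: anti; apply: contraNneq ij => /perm_inj ->.
transitivity (- \prod_(i < d) G (s i)) => //.
by rewrite IH // signr_addb expr1 mulN1r mulNr.
Qed.

Lemma prodM_comm (A : pzRingType) (d : nat) (F G : 'I_d -> A) :
  (forall i j, GRing.comm (F i) (G j)) ->
  \prod_(i < d) (F i * G i) = \prod_(i < d) F i * \prod_(i < d) G i.
Proof.
move=> FG; elim: d F G FG => [|d IH] F G FG; first by rewrite !big_ord0 mulr1.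
rewrite !big_ord_recl IH => [|i j]; last exact: FG.
rewrite -!mulrA; congr (_ * _); rewrite !mulrA; congr (_ * _).
by apply: commr_prod => i _; apply: commr_sym; apply: FG.
Qed.

Section CyclicTrace.
Variables (C : numFieldType) (A : pzRingType) (sc : {rmorphism C -> A}).
Hypothesis scC : forall c a, sc c * a = a * sc c.

Section Determinant.
Variables (tau : {additive A -> C}) (tw : A -> Prop).
Hypothesis tauZ : forall c a, tau (sc c * a) = c * tau a.
Hypothesis tw1 : tw 1.
Hypothesis twM : forall a b, tw a -> tw b -> tw (a * b).
Hypothesis tau_cyc : forall a b, tw a -> tw b -> tau (a * b) = tau (b * a).
Variables (d : nat) (K : A) (G : 'I_d -> A).
Hypotheses (twK : tw K) (twG : forall j, tw (G j)).
Hypothesis anti : forall i j, i != j -> G i * G j = - (G j * G i).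
Hypothesis sqG : forall j, G j * G j = 1.
Hypothesis KG : forall j, K * G j = (-1) ^+ d.+1 * (G j * K).

(* A word of length d with a repeated letter misses a letter a; inserting a a
   and moving one of them around by cyclicity changes the sign. *)
Lemma tau_word_noninj (f : 'I_d -> 'I_d) : ~~ injectiveb f ->
  tau (K * \prod_(i < d) G (f i)) = 0.
Proof.
(* A self-map of a finite set that is not injective misses a value: a section of a surjective [f]
   would be injective, hence bijective, and [f] would be its inverse. *)
move=> nf; have [a ha] : exists a, forall i, f i != a.
  apply: contrapT => /forallNP H; move/negP: nf; apply; apply/injectiveP.
  have sf : forall a, exists i, f i = a.
    move=> a; apply: contrapT => /forallNP Ha; apply: (H a) => i.
    by apply/eqP; apply: Ha.
  have [g gK] := choice sf.
  have gi : injective g by move=> x y /(congr1 f); rewrite !gK.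
  have gb := injF_bij gi.
  by move=> x y; rewrite -(f_invF gi x) -(f_invF gi y) !gK => ->.
pose W := \prod_(i < d) G (f i).
have GW : G a * W = (-1) ^+ d * (W * G a).
  rewrite /W -(big_map f xpredT G) anticomm_prod //.
    by rewrite size_map /index_enum -enumT size_enum_ord mulrA.
  move=> i /mapP[j _ ->]; apply: anti; rewrite eq_sym; exact: ha.
have twW : tw W by apply: (big_ind tw).
have GK : G a * K = (-1) ^+ d.+1 * (K * G a).
  by rewrite KG mulrA -exprMn_comm // mulN1r opprK expr1n mul1r.
(* Crossing [K] costs [(-1)^(d+1)] and crossing the [d] letters of [W] costs [(-1)^d]: the total
   exponent is odd, which explains the sign in [KG]. *)
have : tau (K * W) = - tau (K * W).
  rewrite -{1}[K * W]mul1r -(sqG a) -mulrA tau_cyc //; last first.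
    by apply: twM => //; apply: twM.
  rewrite (mulrA (G a) K W) GK.
  have -> : (-1) ^+ d.+1 * (K * G a) * W * G a =
    (-1) ^+ d.+1 * (K * (G a * W) * G a) by rewrite !mulrA.
  rewrite GW (mulrA K) (commr_sign K) -!mulrA sqG mulr1.
  rewrite !raddfMsign mulrA -exprD addSn addnn exprS -signr_odd odd_double.
  by rewrite mulr1 mulN1r.
by move/eqP; rewrite -subr_eq0 opprK -mulr2n mulrn_eq0 => /eqP.
Qed.

(** The product is expanded over all choices of one letter per factor. Choices with a repetition
    vanish; the others are permutations, and the signs of sorting them produce the Leibniz
    formula. *)
Lemma tau_det (v : 'M[C]_d) :
  tau (K * \prod_(i < d) \sum_j sc (v i j) * G j) =
  \det v * tau (K * \prod_(i < d) G i).
Proof.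
rewrite bigA_distr_bigA /= mulr_sumr raddf_sum /=.
have E (f : {ffun 'I_d -> 'I_d}) :
  tau (K * \prod_(i < d) (sc (v i (f i)) * G (f i))) =
  (\prod_i v i (f i)) * tau (K * \prod_(i < d) G (f i)).
  rewrite prodM_comm -?rmorph_prod /=; last by move=> i j; exact: scC.
  by rewrite mulrA -scC -mulrA tauZ.
rewrite (bigID (fun f : {ffun 'I_d -> 'I_d} => injectiveb f)) /= addrC big1.
  rewrite add0r /determinant mulr_suml.
  rewrite (reindex (fun s : 'S_d => pval s)) /=; last first.
    pose in_Sd := insubd (1%g : 'S_d).
    by exists in_Sd => /= f Uf; first apply: val_inj; apply: insubdK.
  apply: eq_big => [s|s _]; rewrite ?(valP s) // E.
  under [X in _ * tau (_ * X)]eq_bigr do rewrite pvalE.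
  rewrite prod_perm_anti // mulrA (commr_sign K) -mulrA raddfMsign mulrA.
  rewrite [_ * (-1) ^+ _]mulrC; congr (_ * _ * _).
  by apply: eq_bigr => i _; rewrite pvalE.
by move=> f nf; rewrite E tau_word_noninj ?mulr0.
Qed.

End Determinant.
End CyclicTrace.

Section PartialTrace.
Variables (C : numFieldType) (A : pzRingType) (sc : {rmorphism C -> A}).
Hypothesis scC : forall c a, sc c * a = a * sc c.
Variables (tau : {additive A -> C}) (tw rt : A -> Prop).
Hypothesis tauZ : forall c a, tau (sc c * a) = c * tau a.
Hypothesis tw1 : tw 1.
Hypothesis twM : forall a b, tw a -> tw b -> tw (a * b).
Hypothesis rt1 : rt 1.
Hypothesis rtM : forall a b, rt a -> rt b -> rt (a * b).
Hypothesis tau_cyc : forall a b r, tw a -> tw b -> rt r ->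
  tau (a * b * r) = tau (b * a * r).
Variables (m : nat) (G : 'I_(1 + m) -> A).
Hypothesis twG : forall j, tw (G j).
Hypothesis anti : forall i j, i != j -> G i * G j = - (G j * G i).
Hypothesis sqG : forall j, G j * G j = 1.
Variable r : 'I_m -> A.
Hypothesis rtr : forall a, rt (r a).
Hypothesis anti_r : forall i j, i != j -> r i * r j = - (r j * r i).
Hypothesis rG : forall a j, r a * G j = G j * r a.

Definition clifford_elt (v : 'rV[C]_(1 + m)) : A := \sum_j sc (v 0 j) * G j.

Variables (x : 'rV[C]_(1 + m)) (e : 'M[C]_(m, 1 + m)).

Lemma clifford_elt_expand :
  (\sum_a clifford_elt (row a e) * r a) ^+ m =
  \sum_(f : {ffun 'I_m -> 'I_m})
     (\prod_(i < m) clifford_elt (row (f i) e)) * \prod_(i < m) r (f i).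
Proof.
have <- : \prod_(i < m) \sum_a clifford_elt (row a e) * r a =
    (\sum_a clifford_elt (row a e) * r a) ^+ m.
  by rewrite prodr_const card_ord.
rewrite bigA_distr_bigA /=.
apply: eq_bigr => f _; rewrite prodM_comm // => i j.
apply: commr_sym; apply: commr_sum => k _; rewrite /GRing.comm.
by rewrite mulrA -scC -!mulrA rG.
Qed.

Lemma det_row_perm_bottom (s : 'S_m) :
  \det (col_mx x (row_perm s e)) = (-1) ^+ s * \det (col_mx x e : 'M[C]_(1 + m)).
Proof.
have -> : col_mx x (row_perm s e) = lift0_mx (perm_mx s) *m col_mx x e.
  by rewrite mul_block_col mul1mx !mul0mx addr0 add0r -row_permE.
by rewrite det_mulmx det_ublock det1 mul1r det_perm.
Qed.

(** For a fixed word in the [r a], the functional sending [X] to [tau (X * word)] is still cyclic,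
    so [tau_det] gives the determinant with first row [x] and the rows of [e] chosen by [f], which
    is zero if [f] repeats an index. A permutation contributes its sign twice, once through the
    determinant and once through sorting the word, so all [m!] remaining terms are equal. *)
Lemma tau_volume (K : A) : tw K ->
  (forall j, K * G j = (-1) ^+ m.+2 * (G j * K)) ->
  tau (K * clifford_elt x * (\sum_a clifford_elt (row a e) * r a) ^+ m) =
  m`!%:R * \det (col_mx x e : 'M[C]_(1 + m)) *
    tau (K * (\prod_j G j) * \prod_a r a).
Proof.
move=> twK KG; rewrite clifford_elt_expand mulr_sumr raddf_sum /=.
pose v (f : {ffun 'I_m -> 'I_m}) : 'M[C]_(1 + m) :=
  col_mx x (\matrix_(i < m) (row (f i) e)).
have E (f : {ffun 'I_m -> 'I_m}) :
  tau (K * clifford_elt x *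
       ((\prod_(i < m) clifford_elt (row (f i) e)) * \prod_(i < m) r (f i))) =
  \det (v f) * tau (K * (\prod_j G j) * \prod_(i < m) r (f i)).
  set rf := \prod_(i < m) r (f i).
  have rtf : rt rf by apply: (big_ind rt).
  have add_tf : zmod_morphism (fun X => tau (X * rf)).
    by move=> X Y; rewrite mulrBl raddfB.
  pose tf : {additive A -> C} :=
    HB.pack (fun X => tau (X * rf)) (GRing.isZmodMorphism.Build _ _ _ add_tf).
  have /= <- := @tau_det C A sc scC tf tw _ tw1 twM _ _ K G twK twG anti sqG KG (v f).
  - congr (tau _); rewrite mulrA; congr (_ * _); rewrite -mulrA; congr (_ * _).
    rewrite big_split_ord big_ord1 /=; congr (_ * _).
      by apply: eq_bigr => j _; rewrite col_mxEu.
    apply: eq_bigr => i _; apply: eq_bigr => j _.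
    by rewrite col_mxEd !mxE.
  - by move=> c a; rewrite -mulrA tauZ.
  - by move=> a b ta tb; apply: tau_cyc.
under eq_bigr do rewrite E.
rewrite (bigID (fun f : {ffun 'I_m -> 'I_m} => injectiveb f)) /= addrC big1.
  rewrite add0r (reindex (@pval _)) /=; last first.
    pose in_Sm := insubd (1%g : 'S_m).
    by exists in_Sm => /= f Uf; first apply: val_inj; apply: insubdK.
  transitivity (\sum_(s : 'S_m) \det (col_mx x e : 'M[C]_(1 + m)) *
    tau (K * (\prod_j G j) * \prod_a r a)); last first.
    rewrite sumr_const -!mulrA [RHS]mulr_natl; congr (_ *+ _).
    by rewrite -card_Sn; apply: eq_card => s; rewrite !inE.
  apply: eq_big => [s|s _]; rewrite ?(valP s) //.
  have -> : v (pval s) = col_mx x (row_perm s e).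
    by congr col_mx; apply/matrixP => i j; rewrite !mxE pvalE.
  under [X in tau (_ * X)]eq_bigr do rewrite pvalE.
  rewrite (prod_perm_anti _ anti_r) mulrA commr_sign -mulrA raddfMsign.
  by rewrite det_row_perm_bottom mulrCA !mulrA -signr_addb addbb mul1r.
move=> f /injectivePn[i1 [i2 i12 fi]].
have ne : rshift 1 i1 != rshift 1 i2 by rewrite (inj_eq (@rshift_inj _ _)).
rewrite (determinant_alternate ne) ?mul0r // => j.
by rewrite !col_mxEd !mxE fi.
Qed.

(** Cyclicity carries the factor of [x] from the front of the tangent factors to their back, and
    anticommutation brings it to the front again with sign [(-1)^m = -1]. Each term therefore equals
    its own opposite. *)
Lemma tau_normal : odd m ->
  (forall a, clifford_elt x * clifford_elt (row a e) =
           - (clifford_elt (row a e) * clifford_elt x)) ->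
  (forall v, tw (clifford_elt v)) ->
  tau (clifford_elt x * (\sum_a clifford_elt (row a e) * r a) ^+ m) = 0.
Proof.
move=> om xe twc; rewrite clifford_elt_expand mulr_sumr raddf_sum /= big1 // => f _.
set rf := \prod_(i < m) r (f i).
have rtf : rt rf by apply: (big_ind rt).
have twf : tw (\prod_(i < m) clifford_elt (row (f i) e)) by apply: (big_ind tw).
apply/eqP; rewrite -[_ == 0]orFb -(mulrn_eq0 _ 2) mulr2n addr_eq0; apply/eqP.
rewrite {1}mulrA tau_cyc // -raddfN; congr (tau _).
rewrite mulrA -mulNr; congr (_ * _).
suff : forall k (h : 'I_k -> 'I_m),
    clifford_elt x * \prod_(i < k) clifford_elt (row (h i) e) =
    (-1) ^+ k * (\prod_(i < k) clifford_elt (row (h i) e) * clifford_elt x).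
  by move=> /(_ m f) ->; rewrite -signr_odd om expr1 mulN1r opprK.
elim=> [|k IH] h; first by rewrite !big_ord0 expr0 !mul1r mulr1.
rewrite !big_ord_recl mulrA xe mulNr -mulrA IH exprS mulN1r !mulNr.
by rewrite !mulrA commr_sign.
Qed.

End PartialTrace.

(** * Clifford generators twisted by Weyl operators *)

Section LinearEndomorphisms.
Variables (K : comPzRingType) (V : lmodType K).

(** Linear maps are bundled into a ring under composition, so that the identities proved above in an
    abstract ring apply to operators. *)
Record lin_end := LinEnd { lin_fun :> V -> V; lin_funP : linear lin_fun }.

HB.instance Definition _ := gen_eqMixin lin_end.
HB.instance Definition _ := gen_choiceMixin lin_end.

Lemma lin_end_ext (f g : lin_end) : (forall v, f v = g v) -> f = g.
Proof.
case: f g => [f lf] [g lg] /= /funext fg; subst g.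
by congr LinEnd; exact: Prop_irrelevance.
Qed.

Lemma lin_endD (f : lin_end) u v : f (u + v) = f u + f v.
Proof. by have := lin_funP f 1 u v; rewrite !scale1r. Qed.

Lemma lin_endZ (f : lin_end) a u : f (a *: u) = a *: f u.
Proof.
have f0 : f 0 = 0 by apply: (addrI (f 0)); rewrite -lin_endD !addr0.
by have := lin_funP f a u 0; rewrite !addr0 f0 addr0.
Qed.

Program Definition lin_zero := @LinEnd (fun=> 0) _.
Next Obligation. by move=> a u v; rewrite scaler0 addr0. Qed.
Program Definition lin_one := @LinEnd id _.
Next Obligation. by []. Qed.
Program Definition lin_add (f g : lin_end) := @LinEnd (fun v => f v + g v) _.
Next Obligation.
by move=> f g a u v; rewrite !lin_endD !lin_endZ scalerDr addrACA.
Qed.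
Program Definition lin_opp (f : lin_end) := @LinEnd (fun v => - f v) _.
Next Obligation.
by move=> f a u v; rewrite lin_endD lin_endZ opprD scalerN.
Qed.
Program Definition lin_mul (f g : lin_end) := @LinEnd (fun v => f (g v)) _.
Next Obligation. by move=> f g a u v; rewrite !(lin_endD, lin_endZ). Qed.

Fact lin_addA : associative lin_add.
Proof. by move=> f g h; apply: lin_end_ext => v; apply: addrA. Qed.
Fact lin_addC : commutative lin_add.
Proof. by move=> f g; apply: lin_end_ext => v; apply: addrC. Qed.
Fact lin_add0 : left_id lin_zero lin_add.
Proof. by move=> f; apply: lin_end_ext => v; apply: add0r. Qed.
Fact lin_addN : left_inverse lin_zero lin_opp lin_add.
Proof. by move=> f; apply: lin_end_ext => v; apply: addNr. Qed.
HB.instance Definition _ :=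
  GRing.isZmodule.Build lin_end lin_addA lin_addC lin_add0 lin_addN.

Fact lin_mulA : associative lin_mul.
Proof. by move=> f g h; apply: lin_end_ext. Qed.
Fact lin_mul1l : left_id lin_one lin_mul.
Proof. by move=> f; apply: lin_end_ext. Qed.
Fact lin_mul1r : right_id lin_one lin_mul.
Proof. by move=> f; apply: lin_end_ext. Qed.
Fact lin_mulDl : left_distributive lin_mul lin_add.
Proof. by move=> f g h; apply: lin_end_ext. Qed.
Fact lin_mulDr : right_distributive lin_mul lin_add.
Proof. by move=> f g h; apply: lin_end_ext => v /=; apply: lin_endD. Qed.
HB.instance Definition _ := GRing.Zmodule_isPzRing.Build lin_end
  lin_mulA lin_mul1l lin_mul1r lin_mulDl lin_mulDr.

Lemma lin_mulE (f g : lin_end) v : (f * g) v = f (g v). Proof. by []. Qed.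
Lemma lin_addE (f g : lin_end) v : (f + g) v = f v + g v. Proof. by []. Qed.
Lemma lin_oppE (f : lin_end) v : (- f) v = - f v. Proof. by []. Qed.
Lemma lin_sumE I r (P : pred I) (h : I -> lin_end) v :
  (\sum_(i <- r | P i) h i) v = \sum_(i <- r | P i) h i v.
Proof. by elim/big_rec2: _ => // i x y _ <-. Qed.

Program Definition lin_scalar (c : K) := @LinEnd ( *:%R c) _.
Next Obligation.
by move=> c a u v; rewrite scalerDr !scalerA mulrC.
Qed.

Fact lin_scalar_zmod : zmod_morphism lin_scalar.
Proof. by move=> a b; apply: lin_end_ext => v /=; apply: scalerBl. Qed.
Fact lin_scalar_monoid : monoid_morphism lin_scalar.
Proof.
split; first by apply: lin_end_ext => v /=; apply: scale1r.
by move=> a b; apply: lin_end_ext => v /=; rewrite scalerA.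
Qed.
HB.instance Definition _ :=
  GRing.isZmodMorphism.Build K lin_end lin_scalar lin_scalar_zmod.
HB.instance Definition _ :=
  GRing.isMonoidMorphism.Build K lin_end lin_scalar lin_scalar_monoid.

Lemma lin_scalarC c f : lin_scalar c * f = f * lin_scalar c.
Proof. by apply: lin_end_ext => v /=; rewrite lin_endZ. Qed.

End LinearEndomorphisms.

(** * Weyl operators with matrix coefficients *)

Section TwistedOperators.
Variables (R : realType) (n p N : nat) (theta : 'M[R]_n).
Hypothesis asym : antisymmetric_mx theta.
Let C := R[i].
Let weight := 'rV[int]_n.
Let V := (weight -> 'M[C]_(p, N)).

Lemma cisD (s t : R) : cis (s + t) = cis s * cis t.
Proof.
by rewrite /cis cosD sinD; apply/eqP; rewrite eq_complex /= eqxx addrC mulrC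
  [sin s * _]mulrC eqxx.
Qed.

Lemma cis0 : cis (0 : R) = 1. Proof. by rewrite /cis cos0 sin0. Qed.

Lemma cisN (t : R) : cis (- t) = (cis t)^*.
Proof. by rewrite /cis cosN sinN. Qed.

(** The exponent of [weyl_phase]; it is bilinear and antisymmetric, so comparing products of phases
    amounts to comparing sums. *)
Definition phase_form (k l : weight) : R :=
  8^-1 * \sum_mu \sum_nu theta mu nu * (k 0 mu)%:~R * (l 0 nu)%:~R.

Lemma weyl_phaseE k l : weyl_phase theta k l = cis (phase_form k l).
Proof. by []. Qed.

Lemma phase_formDl k k' l : phase_form (k + k') l = phase_form k l + phase_form k' l.
Proof.
rewrite /phase_form -mulrDr -big_split; congr (_ * _); apply: eq_bigr => mu _.
rewrite -big_split; apply: eq_bigr => nu _ /=.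
by rewrite mxE intrD mulrDr mulrDl.
Qed.

Lemma phase_form_anti k l : phase_form k l = - phase_form l k.
Proof.
rewrite /phase_form -mulrN exchange_big /= -sumrN; congr (_ * _).
apply: eq_bigr => mu _; rewrite -sumrN; apply: eq_bigr => nu _.
have -> : theta nu mu = - theta mu nu.
  by have /matrixP/(_ mu nu) := asym; rewrite !mxE.
by rewrite !mulNr mulrAC.
Qed.

Lemma phase_formDr k l l' : phase_form k (l + l') = phase_form k l + phase_form k l'.
Proof.
by rewrite phase_form_anti phase_formDl opprD -!phase_form_anti.
Qed.

Lemma phase_formNl k l : phase_form (- k) l = - phase_form k l.
Proof.
have f0 : phase_form 0 l = 0.
  by apply: (addrI (phase_form 0 l)); rewrite -phase_formDl !addr0.
by apply/eqP; rewrite -addr_eq0 -phase_formDl addNr f0.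
Qed.

Lemma phase_formNr k l : phase_form k (- l) = - phase_form k l.
Proof. by rewrite phase_form_anti phase_formNl -phase_form_anti. Qed.

Lemma phase_form_self k : phase_form k k = 0.
Proof.
by have /eqP := phase_form_anti k k; rewrite -addr_eq0 -mulr2n mulrn_eq0 => /eqP.
Qed.

(** Left multiplication by the tensor product of [M] and [W(w/2)], read on coefficients:
    [W(w/2) W((k-w)/2)] is [weyl_phase theta w (k - w)] times [W(k/2)]. The rows of [Phi k] belong
    to the matrix factor, its columns to the spinor components. *)
Definition twisted (M : 'M[C]_p) (w : weight) : V -> V :=
  fun Phi k => weyl_phase theta w (k - w) *: (M *m Phi (k - w)).

Program Definition tw_op (M : 'M[C]_p) (w : weight) : lin_end V :=
  @LinEnd _ V (twisted M w) _.
Next Obligation.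
move=> M w a u v; apply/funext => k; rewrite /twisted /= !fctE.
by rewrite mulmxDr -scalemxAr scalerDr !scalerA mulrC.
Qed.

(** A spinor endomorphism acts on the column index. The transpose undoes the order reversal of right
    multiplication, so [right_op] is multiplicative, and it commutes with every [tw_op]. *)
Program Definition right_op (Y : 'M[C]_N) : lin_end V :=
  @LinEnd _ V (fun Phi k => Phi k *m Y^T) _.
Next Obligation.
move=> Y a u v; apply/funext => k; rewrite /= !fctE.
by rewrite mulmxDl -scalemxAl.
Qed.

(** The Weyl relation: a bilinear exponent is a cocycle, so the phases collected on the two sides
    agree. *)
Lemma tw_opM M M' w w' : tw_op M w * tw_op M' w' =
  lin_scalar V (weyl_phase theta w w') * tw_op (M *m M') (w + w').
Proof.
apply: lin_end_ext => Phi; apply/funext => k.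
rewrite !lin_mulE /= /twisted /= !fctE opprD addrA -scalemxAr !scalerA mulmxA.
congr (_ *: _); rewrite !weyl_phaseE -!cisD; congr cis.
rewrite !(phase_formDl, phase_formDr, phase_formNl, phase_formNr) !phase_form_self.
ring.
Qed.

Lemma tw_opD M M' w : tw_op (M + M') w = tw_op M w + tw_op M' w.
Proof.
apply: lin_end_ext => Phi; apply/funext => k.
by rewrite lin_addE /= /twisted !fctE mulmxDl scalerDr.
Qed.

Lemma tw_opZ c M w : tw_op (c *: M) w = lin_scalar V c * tw_op M w.
Proof.
apply: lin_end_ext => Phi; apply/funext => k.
by rewrite lin_mulE /= /twisted !fctE -scalemxAl scalerA mulrC -scalerA.
Qed.

Lemma tw_opN M w : tw_op (- M) w = - tw_op M w.
Proof.
apply: lin_end_ext => Phi; apply/funext => k.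
by rewrite lin_oppE /= /twisted !fctE mulNmx scalerN.
Qed.

Lemma tw_op1 : tw_op 1%:M 0 = 1.
Proof.
apply: lin_end_ext => Phi; apply/funext => k.
rewrite /= /twisted subr0 mul1mx weyl_phaseE.
have -> : phase_form 0 k = 0.
  by apply: (addrI (phase_form 0 k)); rewrite -phase_formDl !addr0.
by rewrite cis0 scale1r.
Qed.

Lemma right_opM Y Y' : right_op (Y *m Y') = right_op Y * right_op Y'.
Proof.
apply: lin_end_ext => Phi; apply/funext => k.
by rewrite lin_mulE /= trmx_mul mulmxA.
Qed.

Lemma right_op1 : right_op 1%:M = 1.
Proof. by apply: lin_end_ext => Phi; apply/funext => k; rewrite /= trmx1 mulmx1. Qed.

Lemma right_opN Y : right_op (- Y) = - right_op Y.
Proof.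
apply: lin_end_ext => Phi; apply/funext => k.
by rewrite lin_oppE /= raddfN mulmxN.
Qed.

Lemma right_op_prod (I : Type) (s : seq I) (Y : I -> 'M[C]_N) :
  right_op (\prod_(i <- s) Y i) = \prod_(i <- s) right_op (Y i).
Proof.
elim: s => [|i s IH]; first by rewrite !big_nil right_op1.
by rewrite !big_cons -IH -right_opM.
Qed.

Lemma right_op_comm Y M w : right_op Y * tw_op M w = tw_op M w * right_op Y.
Proof.
apply: lin_end_ext => Phi; apply/funext => k.
by rewrite !lin_mulE /= /twisted -scalemxAl mulmxA.
Qed.

End TwistedOperators.

Lemma prod_ord_double (A : pzRingType) (n : nat) (F : nat -> A) :
  \prod_(j < n.*2) F j = \prod_(mu < n) (F mu.*2 * F mu.*2.+1).
Proof.
elim: n => [|n IH]; first by rewrite !big_ord0.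
by rewrite doubleS !big_ord_recr /= IH mulrA.
Qed.

Lemma sum_ord_double (A : nmodType) (n : nat) (F : nat -> A) :
  \sum_(j < n.*2) F j = \sum_(mu < n) (F mu.*2 + F mu.*2.+1).
Proof.
elim: n => [|n IH]; first by rewrite !big_ord0.
by rewrite doubleS !big_ord_recr /= IH addrA.
Qed.

(** * Creation and annihilation operators, and the Clifford generators made from them *)

Section CreationAnnihilation.
Variables (A : pzRingType) (n : nat) (L : 'I_n -> bool -> A) (I : A).
Hypothesis IC : forall a, I * a = a * I.
Hypothesis I2 : I * I = -1.
Hypothesis L_cross : forall mu nu b b', mu != nu ->
  L mu b * L nu b' = - (L nu b' * L mu b).
Hypothesis L_sq : forall mu b, L mu b * L mu b = 0.
Hypothesis L_one : forall mu, L mu true * L mu false + L mu false * L mu true = 1.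

Definition parity mu := L mu true * L mu false - L mu false * L mu true.
Definition chiral := \prod_mu parity mu.

(** Each pair of letters gives two anticommuting square roots of 1, at the indices [2 mu] and
    [2 mu + 1]. The default branch puts the chirality at index [2n], which completes them to the
    generators of a Clifford algebra in [2n + 1] dimensions. *)
Definition generator (j : nat) : A :=
  if insub j./2 is Some mu then
    if odd j then I * (L mu true - L mu false) else L mu true + L mu false
  else chiral.

Lemma parity_cross mu nu b : mu != nu -> parity mu * L nu b = L nu b * parity mu.
Proof.
move=> ne; rewrite /parity mulrBl mulrBr -!mulrA !(L_cross _ _ ne) !mulrN !mulrA.
by rewrite !(L_cross _ _ ne) !mulNr !opprK.
Qed.

Lemma parity_self mu b : parity mu * L mu b = - (L mu b * parity mu).
Proof.
rewrite /parity mulrBl mulrBr; case: b.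
  by rewrite -(mulrA (L mu false)) L_sq mulr0 subr0 mulrA L_sq mul0r sub0r opprK mulrA.
by rewrite -(mulrA (L mu true)) L_sq mulr0 sub0r (mulrA _ _ (L mu true)) L_sq mul0r subr0 mulrA.
Qed.

(** The product [X] of the two letters is idempotent and [parity mu = 2 X - 1]. *)
Lemma parity_sq mu : parity mu * parity mu = 1.
Proof.
have ft : L mu false * L mu true = 1 - L mu true * L mu false.
  by rewrite -(L_one mu) addrAC subrr add0r.
rewrite /parity ft; set X := L mu true * L mu false.
have LX : L mu true * X = 0 by rewrite /X mulrA L_sq mul0r.
have XX : X * X = X.
  transitivity (L mu true * (L mu false * L mu true) * L mu false).
    by rewrite !mulrA.
  by rewrite ft mulrBr mulr1 -/X LX subr0.
have -> : X - (1 - X) = X + X - 1 by rewrite opprB addrA addrAC.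
rewrite mulrBr mulr1 mulrDr !mulrBl !mulrDl XX !mul1r !addrK.
by rewrite opprB addrC subrK.
Qed.

Lemma parity_comm mu nu : parity mu * parity nu = parity nu * parity mu.
Proof.
have [->//|ne] := eqVneq mu nu.
have H b b' : parity mu * (L nu b * L nu b') = L nu b * L nu b' * parity mu.
  by rewrite mulrA parity_cross // -mulrA parity_cross // mulrA.
by rewrite [parity nu]/parity mulrBr !H -mulrBl.
Qed.

(** Exactly one factor of the chirality, the parity of index [mu], anticommutes with the letter; all
    the others commute with it. *)
Lemma chiral_L mu b : chiral * L mu b = - (L mu b * chiral).
Proof.
rewrite /chiral.
suff H (s : seq 'I_n) : uniq s -> (\prod_(i <- s) parity i) * L mu b =
    (-1) ^+ (mu \in s) * (L mu b * \prod_(i <- s) parity i).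
  by rewrite H ?index_enum_uniq // mem_index_enum expr1 mulN1r.
elim: s => [_|nu s IH]; first by rewrite big_nil mul1r mulr1 expr0 mul1r.
rewrite cons_uniq inE big_cons => /andP[ns us]; rewrite -mulrA IH //.
rewrite (mulrA (parity nu)) (commr_sign (parity nu)) -mulrA (mulrA (parity nu)) (mulrA (L mu b)).
have [->|ne] := eqVneq mu nu.
  by rewrite parity_self (negPf ns) expr0 mul1r expr1 mulN1r mulNr.
by rewrite parity_cross 1?eq_sym.
Qed.

Lemma chiral_sq : chiral * chiral = 1.
Proof.
rewrite /chiral -prodM_comm ?big1 // => [mu _|mu nu]; first exact: parity_sq.
exact: parity_comm.
Qed.

Lemma generator_double mu : generator (nat_of_ord mu).*2 = L mu true + L mu false.
Proof. by rewrite /generator doubleK valK odd_double. Qed.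

Lemma generator_doubleS mu :
  generator (nat_of_ord mu).*2.+1 = I * (L mu true - L mu false).
Proof. by rewrite /generator /= uphalf_double valK odd_double. Qed.

Lemma generator_top : generator n.*2 = chiral.
Proof. by rewrite /generator doubleK insubF ?ltnn. Qed.

Lemma generator_cases j : (j <= n.*2)%N ->
  [\/ exists mu : 'I_n, j = mu.*2, exists mu : 'I_n, j = mu.*2.+1 | j = n.*2].
Proof.
rewrite leq_eqVlt => /orP[/eqP ->|jn]; first by constructor 3.
have hj : (j./2 < n)%N by rewrite ltn_half_double.
have := odd_double_half j; case: (odd j) => /= <-.
  by constructor 2; exists (Ordinal hj).
by constructor 1; exists (Ordinal hj).
Qed.

Definition anticomm (a b : A) := a * b = - (b * a).

Lemma anticomm_sym a b : anticomm a b -> anticomm b a.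
Proof. by rewrite /anticomm => ->; rewrite opprK. Qed.

Lemma anticommD a b c : anticomm a b -> anticomm a c -> anticomm a (b + c).
Proof. by rewrite /anticomm mulrDr mulrDl => -> ->; rewrite opprD. Qed.

Lemma anticommN a b : anticomm a b -> anticomm a (- b).
Proof. by rewrite /anticomm mulrN mulNr => ->. Qed.

Lemma anticommI a b : anticomm a b -> anticomm a (I * b).
Proof. by rewrite /anticomm mulrA -IC -!mulrA => ->; rewrite mulrN. Qed.

Lemma anticomm_generator a (mu : 'I_n) : (forall b, anticomm a (L mu b)) ->
  anticomm a (generator mu.*2) /\ anticomm a (generator mu.*2.+1).
Proof.
move=> H; rewrite generator_double generator_doubleS; split.
  exact: anticommD.
by apply/anticommI/anticommD => //; apply: anticommN.
Qed.

Lemma generator_pair (mu : 'I_n) :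
  [/\ generator mu.*2 * generator mu.*2 = 1,
      generator mu.*2.+1 * generator mu.*2.+1 = 1,
      generator mu.*2 * generator mu.*2.+1 = - (I * parity mu)
    & anticomm (generator mu.*2) (generator mu.*2.+1)].
Proof.
rewrite /anticomm generator_double generator_doubleS; have h1 := L_one mu.
split.
- by rewrite mulrDr !mulrDl !L_sq add0r addr0 addrC.
- transitivity (I * I * ((L mu true - L mu false) * (L mu true - L mu false))).
    by set X := _ - _; rewrite -(mulrA I X) (mulrA X I) -(IC X) !mulrA.
  rewrite I2 mulN1r mulrBr !mulrBl !L_sq sub0r subr0 -opprD opprK addrC.
  exact: L_one.
- rewrite mulrA -IC -mulrA -mulrN; congr (_ * _).
  by rewrite mulrBr !mulrDl !L_sq add0r addr0 /parity opprB.
- rewrite mulrA -IC -!mulrA -mulrN; congr (_ * _).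
  by rewrite mulrBr mulrDr !mulrDl !mulNr !L_sq !(add0r, addr0, sub0r, subr0) opprD opprK.
Qed.

Lemma generator_sq j : (j <= n.*2)%N -> generator j * generator j = 1.
Proof.
case/generator_cases=> [[mu ->]|[mu ->]|->]; try by case: (generator_pair mu).
by rewrite generator_top chiral_sq.
Qed.

Lemma generator_anti j k : (j <= n.*2)%N -> (k <= n.*2)%N -> j != k ->
  generator j * generator k = - (generator k * generator j).
Proof.
have top (mu : 'I_n) : anticomm chiral (generator (nat_of_ord mu).*2) /\ anticomm chiral (generator mu.*2.+1).
  by apply: anticomm_generator => b; apply: chiral_L.
have cross (mu nu : 'I_n) : mu != nu ->
    [/\ anticomm (generator mu.*2) (generator nu.*2),
        anticomm (generator mu.*2) (generator nu.*2.+1),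
        anticomm (generator mu.*2.+1) (generator nu.*2)
      & anticomm (generator mu.*2.+1) (generator nu.*2.+1)].
  move=> ne.
  have H b : anticomm (L nu b) (generator mu.*2) /\ anticomm (L nu b) (generator mu.*2.+1).
    by apply: anticomm_generator => b'; apply: L_cross; rewrite eq_sym.
  have [? ?] := anticomm_generator (fun b => anticomm_sym (proj1 (H b))).
  by have [? ?] := anticomm_generator (fun b => anticomm_sym (proj2 (H b))).
rewrite -/(anticomm _ _).
case/generator_cases=> [[mu ->]|[mu ->]|->];
  case/generator_cases=> [[nu ->]|[nu ->]|->]; rewrite ?eqxx //;
  rewrite ?generator_top => jk;
  try (by case: (top mu)); try (by apply/anticomm_sym; case: (top mu));
  try (by case: (top nu)).
- by have [|] := cross mu nu => //; apply: contraNneq jk => ->.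
- have [->|ne] := eqVneq mu nu; last by have [] := cross _ _ ne.
  by case: (generator_pair nu).
- have [->|ne] := eqVneq mu nu; last by have [] := cross _ _ ne.
  by apply/anticomm_sym; case: (generator_pair nu).
- by have [|] := cross mu nu => //; apply: contraNneq jk => ->.
Qed.

(** Each pair of generators multiplies to [- I * parity mu], and the central factors [- I] can be
    collected in front. *)
Lemma prod_generator :
  \prod_(j < n.*2) generator j = (- I) ^+ n * chiral.
Proof.
rewrite prod_ord_double /chiral.
have -> : (- I) ^+ n = \prod_(mu < n) (- I) by rewrite prodr_const card_ord.
rewrite -prodM_comm => [|mu nu]; last first.
  by rewrite /GRing.comm mulNr mulrN IC.
by apply: eq_bigr => mu _; rewrite mulNr; case: (generator_pair mu).
Qed.

End CreationAnnihilation.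

(** * Clifford matrices paired with Weyl unitaries *)

Section LetterOperators.
Variables (R : realType) (n p N : nat) (theta : 'M[R]_n).
Hypothesis asym : antisymmetric_mx theta.
Let C := R[i].
Let weight := 'rV[int]_n.
Let V := (weight -> 'M[C]_(p, N)).
Variable Gam : 'I_n -> 'M[C]_p.
Hypothesis GamP : theta_clifford theta Gam.

Definition letter_mx (mu : 'I_n) (b : bool) : 'M[C]_p :=
  if b then adjmx (Gam mu) else Gam mu.

(** Weights are doubled, so the entries 2 and -2 stand for [U^mu] and its adjoint. The adjoint
    matrix goes with [U^mu], as in the formula for [e]; hence [true] selects both. *)
Definition letter_weight (mu : 'I_n) (b : bool) : weight :=
  (if b then 2 else - 2) *: delta_mx 0 mu.

Lemma theta_anti mu nu : theta nu mu = - theta mu nu.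
Proof. by have /matrixP/(_ mu nu) := asym; rewrite !mxE. Qed.

Lemma theta_diag mu : theta mu mu = 0.
Proof. by have := theta_anti mu mu; lra. Qed.

(** Two entries of absolute value 2 against the factor 1/8 leave one half of [theta mu nu]. *)
Lemma letter_phase mu nu b b' :
  phase_form theta (letter_weight mu b) (letter_weight nu b') =
  (-1) ^+ (b (+) b') * (theta mu nu / 2).
Proof.
rewrite /phase_form (bigD1 mu) //= [X in _ + X]big1 ?addr0 => [|i ne]; last first.
  by rewrite big1 // => j _; rewrite !mxE (negPf ne) andbF mulr0 mulr0 mul0r.
rewrite (bigD1 nu) //= [X in _ + X]big1 ?addr0 => [|i ne]; last first.
  by rewrite !mxE (negPf ne) andbF !mulr0.
rewrite /letter_weight !mxE !eqxx /= !mulr1.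
by case: b; case: b'; rewrite /= ?expr0 ?expr1 ?mulN1r ?mul1r ?rmorphN /=; field; rewrite ?pnatr_eq0.
Qed.

Lemma letter_cross mu nu b b' : mu != nu ->
  letter_mx mu b *m letter_mx nu b' =
  - (cis (- ((-1) ^+ (b (+) b') * theta mu nu)) *: (letter_mx nu b' *m letter_mx mu b)).
Proof.
move=> ne; have [h1 h2 h3] := GamP mu nu; have [_ _ h4] := GamP nu mu.
have H (c : C) (X Y : 'M[C]_p) : X + c *: Y = 0 -> X = - (c *: Y).
  by move/eqP; rewrite addr_eq0 => /eqP.
case: b b' => [] [] /=; rewrite ?expr0 ?expr1 ?mulN1r ?opprK ?mul1r; apply: H.
- by rewrite -theta_anti.
- by rewrite h3 (negPf ne) raddf0.
(* This order of the mixed product is not among the given relations for [mu, nu]; it is the mixed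
   relation with the indices exchanged, up to an invertible phase. *)
- apply: (scalerI (a := cis (- theta mu nu))).
    rewrite cisN conjC_eq0; apply: contraTneq (isT) => e0.
    have := cisD (theta mu nu) (- theta mu nu).
    by rewrite e0 mul0r subrr cis0 => /eqP; rewrite oner_eq0.
  rewrite scalerDr scalerA -cisD addNr cis0 scale1r scaler0 addrC.
  by rewrite -theta_anti h4 eq_sym (negPf ne) raddf0.
- by rewrite -theta_anti.
Qed.

Lemma letter_sq mu b : letter_mx mu b *m letter_mx mu b = 0.
Proof.
have [h1 h2 _] := GamP mu mu.
have H (X : 'M[C]_p) : X + lam theta mu mu *: X = 0 -> X = 0.
  by rewrite /lam theta_diag cis0 scale1r -mulr2n -scaler_nat => /eqP;
    rewrite scaler_eq0 pnatr_eq0 /= => /eqP.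
by case: b; apply: H.
Qed.

Lemma letter_one mu :
  letter_mx mu true *m letter_mx mu false + letter_mx mu false *m letter_mx mu true = 1%:M.
Proof.
by have [_ _] := GamP mu mu; rewrite /lam theta_diag cis0 scale1r eqxx.
Qed.

Definition letter_op mu b : lin_end V :=
  tw_op N theta (letter_mx mu b) (letter_weight mu b).

Let I := lin_scalar V ('i%C : C).

(** Exchanging the Weyl factors replaces a phase of exponent [theta/2] by its inverse, and the ratio
    of the two is exactly the twist in the matrix relation [letter_cross]. An untwisted
    anticommutation remains. *)
Lemma letter_op_cross mu nu b b' : mu != nu ->
  letter_op mu b * letter_op nu b' = - (letter_op nu b' * letter_op mu b).
Proof.
move=> ne.
have E : weyl_phase theta (letter_weight mu b) (letter_weight nu b') *
    cis (- ((-1) ^+ (b (+) b') * theta mu nu)) =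
  weyl_phase theta (letter_weight nu b') (letter_weight mu b).
  rewrite !weyl_phaseE -cisD !letter_phase; congr cis.
  rewrite (theta_anti nu mu) [in RHS]addbC.
  by rewrite mulNr mulrN -[theta nu mu]opprK -theta_anti; field.
rewrite /letter_op !(tw_opM N asym) (letter_cross _ _ ne) -!tw_opZ.
rewrite (addrC (letter_weight nu b')) scalerN scalerA E tw_opN.
by [].
Qed.

Lemma letter_op_sq mu b : letter_op mu b * letter_op mu b = 0.
Proof.
rewrite /letter_op (tw_opM N asym) letter_sq -tw_opZ scaler0.
by apply: lin_end_ext => Phi; apply/funext => k; rewrite /= /twisted mul0mx scaler0.
Qed.

Lemma letter_op_true_false mu b : letter_op mu b * letter_op mu (~~ b) =
  tw_op N theta (letter_mx mu b *m letter_mx mu (~~ b)) 0.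
Proof.
rewrite /letter_op (tw_opM N asym) weyl_phaseE letter_phase theta_diag mul0r mulr0.
rewrite cis0 rmorph1 mul1r; congr tw_op.
by rewrite /letter_weight -scalerDl; case: b; rewrite scale0r.
Qed.

Lemma letter_op_one mu : letter_op mu true * letter_op mu false +
  letter_op mu false * letter_op mu true = 1.
Proof.
by rewrite (letter_op_true_false mu true) (letter_op_true_false mu false)
  -tw_opD letter_one tw_op1.
Qed.

Lemma imag_op_sq : I * I = -1.
Proof. by rewrite /I -rmorphM /= -expr2 sqr_i rmorphN1. Qed.

Lemma imag_opC a : I * a = a * I. Proof. exact: lin_scalarC. Qed.

(** Each parity has weight zero, so no Weyl phase survives in the product and only the matrix
    [gamma] is left. *)
Lemma chiral_letter_op : chiral letter_op = tw_op N theta (gamma_elt Gam) 0.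
Proof.
have tw0 : {morph (fun M : 'M[C]_p => tw_op N theta M 0) : a b / a *m b >-> a * b}.
  by move=> a b; rewrite tw_opM // addr0 weyl_phaseE phase_form_self // cis0 rmorph1 mul1r.
rewrite /chiral /gamma_elt.
elim: (index_enum 'I_n) => [|mu s IH]; first by rewrite !big_nil tw_op1.
rewrite !big_cons IH -mulmxE tw0; congr (_ * _).
rewrite /parity (letter_op_true_false mu true) (letter_op_true_false mu false) /=.
rewrite tw_opD; congr (_ + _).
by rewrite tw_opN.
Qed.

End LetterOperators.

(** * The torus grading and the cyclicity of the partial trace *)

Section Grading.
Variables (R : realType) (n p N : nat) (theta : 'M[R]_n).
Hypothesis asym : antisymmetric_mx theta.
Let C := R[i].
Let weight := 'rV[int]_n.
Let V := (weight -> 'M[C]_(p, N)).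
Variable Gam : 'I_n -> 'M[C]_p.
Hypothesis GamP : theta_clifford theta Gam.

Let number mu := letter_mx Gam mu true *m letter_mx Gam mu false.

(* Weights live on the double cover of the torus, so they are twice the degrees
   for the commutators with the number operators. *)
Definition graded (M : 'M[C]_p) (w : weight) : Prop :=
  forall mu, (number mu *m M - M *m number mu) *+ 2 = (w 0 mu)%:~R *: M.

(** The commutator with a number operator is a derivation, so degrees add. *)
Lemma gradedM M M' w w' : graded M w -> graded M' w' -> graded (M *m M') (w + w').
Proof.
move=> g g' mu.
have -> : number mu *m (M *m M') - M *m M' *m number mu =
  (number mu *m M - M *m number mu) *m M' + M *m (number mu *m M' - M' *m number mu).
  by rewrite mulmxBl mulmxBr !mulmxA addrA subrK.
rewrite mxE intrD scalerDl.
have -> : (w 0 mu)%:~R *: (M *m M') = ((w 0 mu)%:~R *: M) *m M'.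
  by rewrite scalemxAl.
have -> : (w' 0 mu)%:~R *: (M *m M') = M *m ((w' 0 mu)%:~R *: M').
  by rewrite scalemxAr.
rewrite -g -g' !mulr2n.
move: (_ - _) (_ - _) => a a'.
by rewrite mulmxDl mulmxDr addrACA.
Qed.

Lemma gradedZ c M w : graded M w -> graded (c *: M) w.
Proof.
by move=> g mu; rewrite -scalemxAr -scalemxAl -scalerBr scalerMnr g !scalerA mulrC.
Qed.

Lemma graded1 : graded 1%:M 0.
Proof. by move=> mu; rewrite mulmx1 mul1mx subrr mul0rn mxE scale0r. Qed.

(** A letter raises or lowers its own number operator by one. A number operator of another index
    contains a letter and its adjoint, whose twists against the given letter are inverse to each
    other, so the two commute. *)
Lemma graded_letter mu b : graded (letter_mx Gam mu b) (letter_weight mu b).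
Proof.
move=> nu; rewrite /number /letter_weight !mxE eqxx andTb.
have [->|ne] := eqVneq nu mu; last first.
  rewrite mulr0 scale0r -mulmxA (letter_cross asym GamP _ _ ne) mulmxN -scalemxAr.
  rewrite (mulmxA (letter_mx Gam nu true) (letter_mx Gam mu b)).
  rewrite (letter_cross asym GamP _ _ ne) mulNmx -scalemxAl scalerN opprK.
  rewrite scalerA -cisD -mulmxA [X in cis X](_ : _ = 0) ?cis0 ?scale1r ?subrr ?mul0rn //.
  by case: b; rewrite /= ?expr0 ?expr1; ring.
rewrite mulr1; have h1 := letter_one asym GamP mu.
have /= sq := letter_sq asym GamP mu.
case: b => /=.
  rewrite (mulmxA (adjmx _) (adjmx _)) (sq true) mul0mx subr0 -mulmxA.
  have -> : Gam mu *m adjmx (Gam mu) = 1%:M - adjmx (Gam mu) *m Gam mu.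
    by rewrite -h1 addrAC subrr add0r.
  by rewrite mulmxBr mulmx1 mulmxA (sq true) mul0mx subr0 scaler_nat.
rewrite -mulmxA (sq false) mulmx0 sub0r mulmxA.
have -> : Gam mu *m adjmx (Gam mu) = 1%:M - adjmx (Gam mu) *m Gam mu.
  by rewrite -h1 addrAC subrr add0r.
by rewrite mulmxBl mul1mx -mulmxA (sq false) mulmx0 subr0 -scaler_nat scalerN rmorphN scaleNr.
Qed.

(** A nonzero entry of the weight exhibits [M] as a multiple of a commutator, whose trace is
    zero. *)
Lemma graded_trace M w : graded M w -> w != 0 -> \tr M = 0.
Proof.
move=> g /eqP w0; have [mu wm] : exists mu, w 0 mu != 0.
  apply: contrapT => /forallNP H; apply: w0; apply/rowP => mu; rewrite mxE.
  by apply/eqP; move/negP: (H mu); rewrite negbK.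
have /(congr1 mxtrace) := g mu; rewrite -scaler_nat !linearZ /= linearB /= mxtrace_mulC.
rewrite subrr mulr0 => /esym/eqP; rewrite mulf_eq0 intr_eq0 (negPf wm) /=.
by move/eqP.
Qed.

(** Sums of operators in which matrix degree and Weyl weight agree; closing under sums reduces
    cyclicity to homogeneous pairs. *)
Inductive graded_span : lin_end V -> Prop :=
| graded_span_op M w of graded M w : graded_span (tw_op N theta M w)
| graded_spanD X Y of graded_span X & graded_span Y : graded_span (X + Y).

Lemma graded_span1 : graded_span 1.
Proof. by rewrite -(tw_op1 p N theta); constructor; apply: graded1. Qed.

Lemma graded_spanZ c X : graded_span X -> graded_span (lin_scalar V c * X).
Proof.
elim=> [M w g|Y Z _ hY _ hZ]; last by rewrite mulrDr; constructor.
by rewrite -tw_opZ; constructor; apply: gradedZ.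
Qed.

Lemma graded_spanM X Y : graded_span X -> graded_span Y -> graded_span (X * Y).
Proof.
move=> sX sY; elim: sX => [M w g|X1 X2 _ h1 _ h2]; last by rewrite mulrDl; constructor.
elim: sY => [M' w' g'|Y1 Y2 _ h1 _ h2]; last by rewrite mulrDr; constructor.
by rewrite (tw_opM N asym) -tw_opZ; constructor; apply/gradedZ/gradedM.
Qed.

Lemma graded_spanN X : graded_span X -> graded_span (- X).
Proof. by move/(graded_spanZ (-1)); rewrite rmorphN1 mulN1r. Qed.

Lemma graded_span_letter mu b : graded_span (letter_op N theta Gam mu b).
Proof. by constructor; apply: graded_letter. Qed.

Lemma graded_span_chiral : graded_span (chiral (letter_op N theta Gam)).
Proof.
apply: (big_ind graded_span); [exact: graded_span1|exact: graded_spanM|].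
move=> mu _; apply: graded_spanD; last apply: graded_spanN;
  by apply: graded_spanM; apply: graded_span_letter.
Qed.

Definition gen : nat -> lin_end V :=
  generator (letter_op N theta Gam) (lin_scalar V ('i%C : C)).

Lemma graded_span_gen j : graded_span (gen j).
Proof.
rewrite /gen /generator; case: insub => [mu|]; last exact: graded_span_chiral.
have l b := graded_span_letter mu b.
case: odd; last exact: graded_spanD.
by apply/graded_spanZ/graded_spanD => //; apply: graded_spanN.
Qed.

Section Trace.
Variables (psi : weight -> 'rV[C]_N) (k : weight) (j : 'I_N).

(** The normalized trace over the matrix factor, applied to [psi] and evaluated at the weight [k]
    and the spinor component [j]. Fixing these makes it a scalar functional, as the abstract part
    requires. *)
Definition partial_trace (X : lin_end V) : C :=
  p%:R^-1 * \sum_i X (fun l => delta_mx i 0 *m psi l) k i j.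

Fact partial_trace_additive : zmod_morphism partial_trace.
Proof.
move=> X Y; rewrite /partial_trace -mulrBr -sumrB; congr (_ * _).
by apply: eq_bigr => i _; rewrite lin_addE lin_oppE !fctE !mxE.
Qed.
HB.instance Definition _ :=
  GRing.isZmodMorphism.Build (lin_end V) C partial_trace partial_trace_additive.

Lemma partial_traceZ c X : partial_trace (lin_scalar V c * X) = c * partial_trace X.
Proof.
rewrite /partial_trace [RHS]mulrCA; congr (_ * _); rewrite mulr_sumr.
by apply: eq_bigr => i _; rewrite /= fctE mxE.
Qed.

Lemma partial_trace_op M w Y : partial_trace (tw_op N theta M w * right_op _ _ Y) =
  p%:R^-1 * (weyl_phase theta w (k - w) * \tr M * (psi (k - w) *m Y^T) 0 j).
Proof.
rewrite /partial_trace; congr (_ * _).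
rewrite /mxtrace mulr_sumr mulr_suml; apply: eq_bigr => i _.
rewrite lin_mulE /= /twisted mxE -mulrA; congr (_ * _).
by rewrite -(mulmxA (delta_mx i 0)) (mulmxA M) -colE mxE big_ord1 [col i M i 0]mxE.
Qed.

Lemma partial_trace_right Y : (0 < p)%N ->
  partial_trace (right_op _ _ Y) = (psi k *m Y^T) 0 j.
Proof.
move=> p0; rewrite -[right_op _ _ Y]mul1r -(tw_op1 p N theta) partial_trace_op subr0.
have -> : weyl_phase theta 0 k = 1.
  rewrite weyl_phaseE (_ : phase_form _ _ _ = 0) ?cis0 //.
  by apply: (addrI (phase_form theta 0 k)); rewrite -phase_formDl !addr0.
by rewrite mul1r mxtrace1 mulrA mulVf ?mul1r // pnatr_eq0 -lt0n.
Qed.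

Definition right_mult (X : lin_end V) : Prop := exists Y, X = right_op _ _ Y.

(** For homogeneous operators of weights [w] and [w'] the matrix traces agree, but the Weyl phases
    of the two orders need not. If [w + w'] is not zero both sides vanish by [graded_trace]; if
    [w' = - w] both phases are 1, because the form is antisymmetric. *)
Lemma partial_trace_cyc X Y Z : graded_span X -> graded_span Y -> right_mult Z ->
  partial_trace (X * Y * Z) = partial_trace (Y * X * Z).
Proof.
move=> sX sY [W ->]; elim: sX => [M w g|X1 X2 _ h1 _ h2]; last first.
  by rewrite mulrDl mulrDr !mulrDl !raddfD /= h1 h2.
elim: sY => [M' w' g'|Y1 Y2 _ h1 _ h2]; last first.
  by rewrite mulrDl mulrDr !mulrDl !raddfD /= h1 h2.
rewrite !(tw_opM N asym) -!tw_opZ (addrC w') !partial_trace_op !mxtraceZ.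
rewrite (mxtrace_mulC M').
have [w0|ne] := eqVneq (w + w') 0; last first.
  by rewrite (graded_trace (gradedM g g') ne) !mulr0.
have -> : w' = - w by apply/eqP; rewrite -addr_eq0 addrC w0.
by rewrite !(weyl_phaseE, phase_formNl, phase_formNr asym, phase_form_self asym).
Qed.

End Trace.
End Grading.

Section AnticommutationRelation.
Variables (C : comPzRingType) (A : pzRingType) (sc : {rmorphism C -> A}).
Hypothesis scC : forall c a, sc c * a = a * sc c.
Variables (d : nat) (G : 'I_d -> A).
Hypothesis anti : forall i j, i != j -> G i * G j = - (G j * G i).
Hypothesis sqG : forall j, G j * G j = 1.

Lemma clifford_relation (u v : 'rV[C]_d) :
  (\sum_j sc (u 0 j) * G j) * (\sum_j sc (v 0 j) * G j) +
  (\sum_j sc (v 0 j) * G j) * (\sum_j sc (u 0 j) * G j) =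
  sc ((\sum_j u 0 j * v 0 j) *+ 2).
Proof.
have E (a b : 'rV[C]_d) :
    (\sum_j sc (a 0 j) * G j) * (\sum_j sc (b 0 j) * G j) =
    \sum_i \sum_j sc (a 0 i * b 0 j) * (G i * G j).
  rewrite mulr_suml; apply: eq_bigr => i _; rewrite mulr_sumr.
  apply: eq_bigr => j _; rewrite rmorphM /= -!mulrA; congr (_ * _).
  by rewrite mulrA -scC mulrA.
rewrite !E [X in _ + X]exchange_big -big_split /= -sumrMnl rmorph_sum /=.
apply: eq_bigr => i _; rewrite -big_split (bigD1 i) //= big1 ?addr0.
  by rewrite !sqG !mulr1 [v 0 i * _]mulrC -mulr2n rmorphMn.
by move=> j ji; rewrite (anti ji) mulrN [v 0 j * _]mulrC addrN.
Qed.

End AnticommutationRelation.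

Ltac letter_relations :=
  by move=> *; first [exact: imag_opC | exact: imag_op_sq
    | exact: letter_op_cross | exact: letter_op_sq | exact: letter_op_one].

(** * The partial trace of a full product of tangent factors *)

Section VolumeFormula.
Variables (R : realType) (n p N m : nat) (theta : 'M[R]_n).
Hypothesis asym : antisymmetric_mx theta.
Hypothesis p_gt0 : (0 < p)%N.
Let C := R[i].
Let weight := 'rV[int]_n.
Let V := (weight -> 'M[C]_(p, N)).
Variable Gam : 'I_n -> 'M[C]_p.
Hypothesis GamP : theta_clifford theta Gam.
Variable c : 'I_m -> 'M[C]_N.
Hypothesis anti_c : forall a b, a != b -> c a *m c b = - (c b *m c a).

Let sc : {rmorphism C -> lin_end V} := lin_scalar V.
(** For [m = 2n] the last index selects the chirality. For [m = 2n - 1] the chirality is left out of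
    the generators and becomes available as the prefactor [K]. *)
Definition gens (j : 'I_(1 + m)) : lin_end V := gen N theta Gam j.

Definition celt (v : 'rV[C]_(1 + m)) : lin_end V := clifford_elt sc gens v.

Variables (x : 'rV[C]_(1 + m)) (e : 'M[C]_(m, 1 + m)).
Variables (psi : weight -> 'rV[C]_N) (k : weight) (j : 'I_N).

Let r a : lin_end V := right_op n p (c a).
Let tau : {additive lin_end V -> C} := partial_trace psi k j.

Lemma right_mult_r a : right_mult (r a). Proof. by exists (c a). Qed.
Lemma right_mult1 : right_mult (1 : lin_end V).
Proof. by exists 1%:M; rewrite right_op1. Qed.
Lemma right_multM (X Y : lin_end V) : right_mult X -> right_mult Y -> right_mult (X * Y).
Proof. by move=> [a ->] [b ->]; exists (a *m b); rewrite right_opM. Qed.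
Lemma right_anti a b : a != b -> r a * r b = - (r b * r a).
Proof. by move=> ab; rewrite /r -!right_opM anti_c // right_opN. Qed.

Lemma right_graded Y (X : lin_end V) : graded_span theta Gam X ->
  right_op n p Y * X = X * right_op n p Y.
Proof.
elim=> [M w _|X1 X2 _ h1 _ h2]; first exact: right_op_comm.
by rewrite mulrDr mulrDl h1 h2.
Qed.

Hypothesis m_le : (m <= n.*2)%N.

Let gens_le (a : 'I_(1 + m)) : (a <= n.*2)%N.
Proof. by apply: leq_trans m_le; rewrite -ltnS; exact: ltn_ord. Qed.

Lemma gens_anti a b : a != b -> gens a * gens b = - (gens b * gens a).
Proof.
move=> ab; by apply: generator_anti => //; letter_relations.
Qed.

Lemma gens_sq a : gens a * gens a = 1.
Proof.
by apply: generator_sq => //; letter_relations.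
Qed.

Lemma celt_relation u v :
  celt u * celt v + celt v * celt u = sc ((\sum_a u 0 a * v 0 a) *+ 2).
Proof.
apply: clifford_relation; [exact: lin_scalarC|exact: gens_anti|exact: gens_sq].
Qed.

Lemma graded_celt u : graded_span theta Gam (celt u).
Proof.
rewrite /celt /clifford_elt; apply: (big_ind (graded_span theta Gam)).
- by have := graded_spanZ 0 (@graded_span1 R n p N theta Gam); rewrite rmorph0 mul0r.
- by move=> *; constructor.
- by move=> a _; apply/graded_spanZ/graded_span_gen.
Qed.

Definition chi_op : lin_end V := chiral (letter_op N theta Gam).

Lemma chi_op_gens (a : 'I_(1 + m)) : (a < n.*2)%N -> chi_op * gens a = - (gens a * chi_op).
Proof.
move=> lt; rewrite /chi_op /gens /gen.
rewrite -(generator_top (letter_op N theta Gam) (lin_scalar V 'i%C)).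
apply: generator_anti => //; try letter_relations.
by rewrite eq_sym (ltn_eqF lt).
Qed.

Lemma chi_op_sq : chi_op * chi_op = 1.
Proof.
apply: chiral_sq; letter_relations.
Qed.

Lemma prod_gen : \prod_(a < n.*2) gen N theta Gam a = sc ((- 'i%C) ^+ n) * chi_op.
Proof.
rewrite prod_generator; try letter_relations.
by rewrite rmorphXn /= rmorphN.
Qed.

(** The last hypothesis says that [K] completes the word of all generators to a scalar: [K = 1] if
    the chirality is one of them, [K = chi_op] otherwise. *)
Lemma partial_trace_volume_gen (K : lin_end V) : graded_span theta Gam K ->
  (forall a, K * gens a = (-1) ^+ m.+2 * (gens a * K)) ->
  K * \prod_a gens a = sc ((- 'i%C) ^+ n) ->
  partial_trace psi k j (K * celt x * (\sum_a celt (row a e) * r a) ^+ m) =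
  m`!%:R * \det (col_mx x e : 'M[C]_(1 + m)) *
  ((- 'i%C) ^+ n * (psi k *m (\prod_a c a)^T) 0 j).
Proof.
move=> gK KG KP.
have /= -> := @tau_volume C _ sc (@lin_scalarC _ _) tau (graded_span theta Gam)
  (@right_mult R n p N) _ (@graded_span1 R n p N theta Gam) _ right_mult1 right_multM _ m gens
  _ gens_anti gens_sq r right_mult_r right_anti _ x e K gK KG.
- congr (_ * _); rewrite KP /tau /= partial_traceZ /r -right_op_prod.
  by rewrite (partial_trace_right theta).
- by move=> *; apply: partial_traceZ.
- by move=> *; apply: graded_spanM.
- by move=> *; apply: (partial_trace_cyc asym (Gam := Gam)).
- by move=> a; apply: graded_span_gen.
- by move=> a b; rewrite /r right_graded //; apply: graded_span_gen.
Qed.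

Lemma partial_trace_even : m = n.*2 ->
  partial_trace psi k j (celt x * (\sum_a celt (row a e) * r a) ^+ m) =
  m`!%:R * \det (col_mx x e : 'M[C]_(1 + m)) *
  ((- 'i%C) ^+ n * (psi k *m (\prod_a c a)^T) 0 j).
Proof.
move=> mE; rewrite -[celt x]mul1r; apply: partial_trace_volume_gen.
- exact: graded_span1.
- by move=> a; rewrite mul1r mulr1 -signr_odd /= negbK mE odd_double expr0 mul1r.
- rewrite mul1r; have -> : \prod_a gens a = \prod_(a < n.*2.+1) gen N theta Gam a.
    by rewrite -mE.
  by rewrite big_ord_recr /= prod_gen -mulrA /gen generator_top chi_op_sq mulr1.
Qed.

(** By the Clifford relation, orthogonality of [x] to the rows of [e] makes [celt x] anticommute
    with their images, so [tau_normal] removes the summand 1. The summand [chi_op] takes the place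
    of [K]: it anticommutes with all generators, which is the required sign for odd [m]. *)
Lemma partial_trace_odd : m.+1 = n.*2 -> (forall a, \sum_b x 0 b * e a b = 0) ->
  partial_trace psi k j ((1 + chi_op) * (celt x * (\sum_a celt (row a e) * r a) ^+ m)) =
  m`!%:R * \det (col_mx x e : 'M[C]_(1 + m)) *
  ((- 'i%C) ^+ n * (psi k *m (\prod_a c a)^T) 0 j).
Proof.
move=> mE xe; have om : odd m by have := odd_double n; rewrite -mE /= => /negbFE.
rewrite mulrDl mul1r raddfD /= mulrA partial_trace_volume_gen.
- have /= -> := @tau_normal C _ sc (@lin_scalarC _ _) tau (graded_span theta Gam)
    (@right_mult R n p N) (@graded_span1 R n p N theta Gam) _ right_mult1 right_multM _ m gens
    r right_mult_r _ x e om _ graded_celt; first by rewrite add0r.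
  + by move=> *; apply: graded_spanM.
  + by move=> *; apply: (partial_trace_cyc asym (Gam := Gam)).
  + by move=> a b; rewrite /r right_graded //; apply: graded_span_gen.
  + move=> a; apply/eqP; rewrite -addr_eq0; apply/eqP.
    rewrite [LHS]celt_relation; under eq_bigr do rewrite mxE.
    by rewrite xe mul0rn rmorph0.
- exact: graded_span_chiral.
- move=> a; rewrite chi_op_gens; last by rewrite -mE; exact: ltn_ord.
  by rewrite -signr_odd /= negbK om expr1 mulN1r.
- have -> : \prod_a gens a = \prod_(a < n.*2) gen N theta Gam a by rewrite -mE.
  by rewrite prod_gen mulrA -lin_scalarC -mulrA chi_op_sq mulr1.
Qed.

End VolumeFormula.

(** * Smooth functions on the sphere *)

Section SmoothCalculus.
Variables (R : realType) (V : normedModType R).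
Implicit Types (f g : V -> R) (O : set V).

(** Differentiability depends on the germ only; this transports smoothness along equalities that
    hold on an open set. *)
Lemma near_eq_differentiable f g (x : V) :
  (\near x, f x = g x) -> differentiable f x -> differentiable g x.
Proof.
move=> fg df; have [dfc /eqaddoP dfE] := (diff_locallyP _ _).1 df.
have fgx : f x = g x := nbhs_singleton fg.
have gE : g \o shift x = cst (g x) + 'd f x +o_ 0 id.
  apply/eqaddoP => eps e0.
  have fgs : \forall h \near (0 : V), f (h + x) = g (h + x).
    by move: fg; rewrite (near_shift 0 x) subr0.
  by apply: filterS2 fgs (dfE eps e0) => h E; rewrite !fctE /= -fgx -E.
by apply/diff_locallyP; rewrite (diff_unique dfc gE).
Qed.

(** The product and chain rules express derivatives through other functions, so smoothness is proved
    by induction on the order, for all functions at once. *)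
Definition smooth_upto (k : nat) O f : Prop :=
  forall (vs : seq V) x, (size vs <= k)%N -> O x -> differentiable (iter_derive vs f) x.

Lemma smooth_uptoP O f : smooth_on O f <-> forall k, smooth_upto k O f.
Proof.
split=> [H k vs x _|H vs x]; first exact: H.
exact: (H (size vs)).
Qed.

(** The last vector of the list is the first to act. Peeling it off turns a higher derivative of [f]
    into a derivative of lower order of ['D_v f]. *)
Lemma iter_derive_rcons vs v f : iter_derive (rcons vs v) f = iter_derive vs ('D_v f).
Proof. by rewrite /iter_derive foldr_rcons. Qed.

Lemma smooth_upto_le k l O f : (k <= l)%N -> smooth_upto l O f -> smooth_upto k O f.
Proof. by move=> kl H vs x s; apply: H; exact: leq_trans kl. Qed.

Lemma smooth_upto0 k O f x : smooth_upto k O f -> O x -> differentiable f x.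
Proof. by move=> H Ox; apply: (H [::]). Qed.

Lemma smooth_upto_derive k O f v : smooth_upto k.+1 O f -> smooth_upto k O ('D_v f).
Proof.
by move=> H vs x s; rewrite -iter_derive_rcons; apply: H; rewrite size_rcons.
Qed.

Lemma smooth_uptoS k O f : (forall x, O x -> differentiable f x) ->
  (forall v, smooth_upto k O ('D_v f)) -> smooth_upto k.+1 O f.
Proof.
move=> df dd vs; case/lastP: vs => [x _|vs v x]; first exact: df.
by rewrite size_rcons ltnS iter_derive_rcons; apply: dd.
Qed.

Lemma iter_derive_eq O f g : open O -> (forall x, O x -> f x = g x) ->
  forall vs x, O x -> iter_derive vs f x = iter_derive vs g x.
Proof.
move=> oO fg vs; elim: vs => [|v vs IH] x Ox /=; first exact: fg.
by apply: near_eq_derive; apply: filterS IH (open_nbhs_nbhs _).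
Qed.

Lemma smooth_upto_eq k O f g : open O -> (forall x, O x -> f x = g x) ->
  smooth_upto k O f -> smooth_upto k O g.
Proof.
move=> oO fg H vs x s Ox; apply: near_eq_differentiable (H vs x s Ox).
by apply: filterS (iter_derive_eq oO fg _) (open_nbhs_nbhs _).
Qed.

Lemma smooth_upto_cst k O (a : R) : smooth_upto k O (cst a : V -> R).
Proof.
(* The derivative of the constant [a] is the constant 0, so the induction has to carry both. *)
suff : smooth_upto k O (cst a : V -> R) /\ smooth_upto k O (cst 0 : V -> R) by case.
elim: k => [|k [IHa IH0]].
  by split=> -[|//] x _ _; apply: differentiable_cst.
split; apply: smooth_uptoS; do ?[by move=> *; apply: differentiable_cst];
  move=> v; rewrite (_ : 'D_v _ = cst 0) //; apply/funext => x; exact: derive_cst.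
Qed.

Lemma smooth_uptoD k O f g : open O -> smooth_upto k O f -> smooth_upto k O g ->
  smooth_upto k O (fun x => f x + g x).
Proof.
move=> oO; elim: k f g => [|k IH] f g sf sg.
  by case=> [|//] x _ Ox; apply: differentiableD; [exact: (sf [::])|exact: (sg [::])].
apply: smooth_uptoS => [x Ox|v].
  by apply: differentiableD; [exact: (smooth_upto0 sf)|exact: (smooth_upto0 sg)].
have := IH _ _ (smooth_upto_derive v sf) (smooth_upto_derive v sg).
apply: smooth_upto_eq => // x Ox; rewrite -[RHS]/('D_v (f + g) x) deriveD //.
  by apply: diff_derivable; exact: (smooth_upto0 sf).
by apply: diff_derivable; exact: (smooth_upto0 sg).
Qed.

Lemma smooth_uptoM k O f g : open O -> smooth_upto k O f -> smooth_upto k O g ->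
  smooth_upto k O (fun x => f x * g x).
Proof.
move=> oO; elim: k f g => [|k IH] f g sf sg.
  by case=> [|//] x _ Ox; apply: differentiableM; [exact: (sf [::])|exact: (sg [::])].
apply: smooth_uptoS => [x Ox|v].
  by apply: differentiableM; [exact: (smooth_upto0 sf)|exact: (smooth_upto0 sg)].
have := smooth_uptoD oO
  (IH _ _ (smooth_upto_le (leqnSn k) sf) (smooth_upto_derive v sg))
  (IH _ _ (smooth_upto_le (leqnSn k) sg) (smooth_upto_derive v sf)).
apply: smooth_upto_eq => // x Ox; rewrite -[RHS]/('D_v (f * g) x) deriveM //.
  by apply: diff_derivable; exact: (smooth_upto0 sf).
by apply: diff_derivable; exact: (smooth_upto0 sg).
Qed.

Lemma smooth_on_cst O (a : R) : smooth_on O (fun=> a : R).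
Proof. by apply/smooth_uptoP => k; apply: smooth_upto_cst. Qed.

Lemma smooth_onD O f g : open O -> smooth_on O f -> smooth_on O g ->
  smooth_on O (fun x => f x + g x).
Proof.
move=> oO /smooth_uptoP sf /smooth_uptoP sg; apply/smooth_uptoP => k.
exact: smooth_uptoD.
Qed.

Lemma smooth_onM O f g : open O -> smooth_on O f -> smooth_on O g ->
  smooth_on O (fun x => f x * g x).
Proof.
move=> oO /smooth_uptoP sf /smooth_uptoP sg; apply/smooth_uptoP => k.
exact: smooth_uptoM.
Qed.

Lemma smooth_on_eq O f g : open O -> (forall x, O x -> f x = g x) ->
  smooth_on O f -> smooth_on O g.
Proof.
move=> oO fg /smooth_uptoP sf; apply/smooth_uptoP => k; exact: smooth_upto_eq (sf k).
Qed.

Lemma smooth_on_sum O (I : Type) (s : seq I) (P : pred I) (F : I -> V -> R) : open O ->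
  (forall i, smooth_on O (F i)) -> smooth_on O (fun x => \sum_(i <- s | P i) F i x).
Proof.
move=> oO sF; elim: s => [|i s IH].
  by under eq_fun do rewrite big_nil; exact: smooth_on_cst.
under eq_fun do rewrite big_cons; case: (P i) => //; exact: smooth_onD.
Qed.

Lemma smooth_on_prod O (I : Type) (s : seq I) (P : pred I) (F : I -> V -> R) : open O ->
  (forall i, smooth_on O (F i)) -> smooth_on O (fun x => \prod_(i <- s | P i) F i x).
Proof.
move=> oO sF; elim: s => [|i s IH].
  by under eq_fun do rewrite big_nil; exact: smooth_on_cst.
under eq_fun do rewrite big_cons; case: (P i) => //; exact: smooth_onM.
Qed.

(* A function whose derivatives are smooth functions of itself and of smooth
   functions is smooth. *)
Lemma smooth_on_bootstrap O f (F : V -> (V -> R) -> V -> R) : open O ->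
  (forall x, O x -> differentiable f x) ->
  (forall v x, O x -> 'D_v f x = F v f x) ->
  (forall k v, smooth_upto k O f -> smooth_upto k O (F v f)) ->
  smooth_on O f.
Proof.
move=> oO df DF sF; apply/smooth_uptoP; elim=> [|k IH].
  by case=> [|//] x _; exact: df.
apply: smooth_uptoS => // v; apply: smooth_upto_eq (sF k v IH) => // x Ox.
by rewrite DF.
Qed.

Lemma smooth_onV O f : open O -> (forall x, O x -> f x != 0) -> smooth_on O f ->
  smooth_on O (fun x => (f x)^-1).
Proof.
move=> oO f0 sf; have df x : O x -> differentiable f x := @sf [::] x.
(* With [h = 1/f] the derivative is [- h^2 f'], polynomial in [h] itself. *)
apply: (@smooth_on_bootstrap _ _
  (fun v h x => h x * h x * (-1 * 'D_v f x))) => // [x Ox|v x Ox|k v sh].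
- exact: differentiableV (df x Ox) (f0 x Ox).
- rewrite deriveV ?f0 //; last exact/diff_derivable/df.
  by rewrite -exprVn expr2 mulN1r mulrN scaleNr.
- apply: smooth_uptoM => //; first exact: smooth_uptoM.
  apply: smooth_uptoM => //; first exact: smooth_upto_cst.
  by apply: smooth_upto_derive; apply: (smooth_uptoP _ _).1.
Qed.

Lemma differentiable_sqrt (x : R) : 0 < x -> differentiable (@Num.sqrt R) x.
Proof.
by move=> x0; apply/derivable1_diffP; have [] := is_derive1_sqrt x0.
Qed.

Lemma derive_sqrt f x v : differentiable f x -> 0 < f x ->
  'D_v (fun y => Num.sqrt (f y)) x = (2 * Num.sqrt (f x))^-1 * 'D_v f x.
Proof.
move=> df f0; have ds := differentiable_sqrt f0.
rewrite deriveE; last exact: differentiable_comp.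
rewrite (_ : (fun y => _) = @Num.sqrt R \o f) // diff_comp //= deriveE //.
have L (t : R) : 'd (@Num.sqrt R) (f x) t = t * 'd (@Num.sqrt R) (f x) 1.
  by have := linearZ_LR ('d (@Num.sqrt R) (f x)) t 1; rewrite /GRing.scale /= mulr1.
rewrite L mulrC; congr (_ * _); rewrite -deriveE //.
by have [_ <-] := is_derive1_sqrt f0.
Qed.

Lemma smooth_on_invsqrt O f : open O -> (forall x, O x -> 0 < f x) -> smooth_on O f ->
  smooth_on O (fun x => (Num.sqrt (f x))^-1).
Proof.
move=> oO f0 sf; have df x : O x -> differentiable f x := @sf [::] x.
have s0 x : O x -> Num.sqrt (f x) != 0 by move=> /f0; rewrite -sqrtr_gt0 => /gt_eqF->.
have ds x : O x -> differentiable (fun y => Num.sqrt (f y)) x.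
  by move=> Ox; apply: differentiable_comp (df x Ox) (differentiable_sqrt (f0 x Ox)).
(* With [h = f^(-1/2)] the derivative is [- h^3 f' / 2]. *)
apply: (@smooth_on_bootstrap _ _
  (fun v h x => h x * h x * (h x * (- 2^-1 * 'D_v f x)))) => // [x Ox|v x Ox|k v sh].
- exact: differentiableV (ds x Ox) (s0 x Ox).
- rewrite deriveV ?s0 //; last exact/diff_derivable/ds.
  rewrite (derive_sqrt v (df x Ox) (f0 x Ox)) /GRing.scale /=.
  by have := s0 x Ox; move: (Num.sqrt _) => s sn; field.
- apply: smooth_uptoM => //; first exact: smooth_uptoM.
  apply: smooth_uptoM => //; apply: smooth_uptoM => //; first exact: smooth_upto_cst.
  by apply: smooth_upto_derive; apply: (smooth_uptoP _ _).1.
Qed.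

End SmoothCalculus.

(** * Coordinates, radial projection and compactness of the sphere *)

Section SphereSmoothness.
Variables (R : realType) (m : nat).
Let E := 'rV[R]_m.+1.
Implicit Types (x v : E).

Lemma open_punctured : open (@punctured R m).
Proof.
rewrite (_ : @punctured R m = ~` [set 0]); last first.
  by apply/seteqP; split=> x /=; [move/eqP|move/eqP].
by apply: closed_openC; exact/accessible_closed_set1/hausdorff_accessible/norm_hausdorff.
Qed.

Lemma dotpC x v : dotp x v = dotp v x.
Proof. by apply: eq_bigr => j _; rewrite mulrC. Qed.

Lemma dotpDr x v w : dotp x (v + w) = dotp x v + dotp x w.
Proof. by rewrite -big_split; apply: eq_bigr => j _; rewrite mxE mulrDr. Qed.

Lemma dotpZr x a v : dotp x (a *: v) = a * dotp x v.
Proof. by rewrite mulr_sumr; apply: eq_bigr => j _; rewrite mxE mulrCA. Qed.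

Lemma dotp0 x : dotp x 0 = 0.
Proof. by rewrite -(scale0r 0) dotpZr mul0r. Qed.

Lemma dotp_gt0 x : x != 0 -> 0 < dotp x x.
Proof.
move=> x0; rewrite lt_neqAle eq_sym; apply/andP; split; last first.
  by apply: sumr_ge0 => j _; rewrite -expr2 sqr_ge0.
apply: contra x0 => /eqP d0; apply/eqP/rowP => j; rewrite mxE.
have nn (i : 'I_m.+1) : xpredT i -> 0 <= x 0 i * x 0 i by rewrite -expr2 sqr_ge0.
by apply/eqP; rewrite -[_ == 0]orbb -mulf_eq0; apply/eqP/(psumr_eq0P nn).
Qed.

Lemma sphere_punctured x : sphere x -> punctured x.
Proof.
move=> sx; apply/eqP => x0; have := sx; rewrite /sphere /= x0 dotp0 => /eqP.
by rewrite eq_sym oner_eq0.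
Qed.

Lemma sproj_sphere x : sphere x -> sproj x = x.
Proof. by rewrite /sphere /sproj /= => ->; rewrite sqrtr1 invr1 scale1r. Qed.

Lemma sphere_sproj x : punctured x -> sphere (sproj x).
Proof.
move=> /dotp_gt0 x0; rewrite /sphere /sproj /= dotpZr dotpC dotpZr mulrA -expr2.
by rewrite exprVn sqr_sqrtr ?mulVf ?gt_eqF // ltW.
Qed.

Lemma continuous_coord (j : 'I_m.+1) : continuous (fun x : E => x 0 j).
Proof. exact: coord_continuous. Qed.

Lemma derive_coord v x (j : 'I_m.+1) : 'D_v (fun y : E => y 0 j : R) x = v 0 j.
Proof.
rewrite deriveE; last exact: differentiable_coord.
have @f : {linear E -> R}.
  by exists (fun N : E => N 0 j); do 2![eexists]; do ?[constructor];
     rewrite ?mxE// => ? *; rewrite ?mxE//; move=> ?; rewrite !mxE.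
by rewrite -[fun _ => _]/(f : E -> R) diff_lin //; exact: continuous_coord.
Qed.

Lemma smooth_coord (O : set E) (j : 'I_m.+1) : open O -> smooth_on O (fun y : E => y 0 j : R).
Proof.
move=> oO; apply: (@smooth_on_bootstrap _ _ _ _ (fun v _ => cst (v 0 j))) => //.
- by move=> x _; exact: differentiable_coord.
- by move=> v x _; exact: derive_coord.
- by move=> k v _; exact: smooth_upto_cst.
Qed.

Lemma smooth_dotp (O : set E) : open O -> smooth_on O (fun y : E => dotp y y).
Proof.
move=> oO; apply: smooth_on_sum => // j.
by apply: smooth_onM => //; exact: smooth_coord.
Qed.

Lemma ssmooth_coord (j : 'I_m.+1) : ssmooth (fun y : E => y 0 j : R).
Proof.
rewrite /ssmooth (_ : _ \o _ = fun y : E => (Num.sqrt (dotp y y))^-1 * y 0 j); last first.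
  by apply/funext => y; rewrite /= mxE.
apply: smooth_onM; [exact: open_punctured| |exact/smooth_coord/open_punctured].
apply: smooth_on_invsqrt; [exact: open_punctured|exact: dotp_gt0|exact/smooth_dotp/open_punctured].
Qed.

Lemma derive_dotp v x : 'D_v (fun y : E => dotp y y) x = 2 * dotp x v.
Proof.
have -> : (fun y : E => dotp y y) = \sum_j ((fun y : E => y 0 j : R) * (fun y : E => y 0 j : R)).
  by apply/funext => y; rewrite fct_sumE.
have dj (j : 'I_m.+1) : derivable (fun y : E => y 0 j : R) x v.
  exact/diff_derivable/differentiable_coord.
rewrite derive_sum => [|j]; last exact: derivableM.
rewrite mulr_sumr; apply: eq_bigr => j _; rewrite deriveM // derive_coord.
by rewrite /GRing.scale /=; ring.
Qed.

(** In a tangent direction the Euclidean norm is stationary, so composing with the radial projection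
    does not change the derivative of a coordinate. *)
Lemma sderive_coord v x (j : 'I_m.+1) : sphere x -> tangent x v ->
  sderive (fun y : E => y 0 j : R) v x = v 0 j.
Proof.
move=> sx tx; have px := sphere_punctured sx.
rewrite /sderive (_ : _ \o _ =
  (fun y : E => (Num.sqrt (dotp y y))^-1) * (fun y : E => y 0 j : R)); last first.
  by apply/funext => y; rewrite /= mxE.
have q0 := dotp_gt0 px; have dq := smooth_dotp open_punctured [::] px.
have ds : differentiable (fun y : E => Num.sqrt (dotp y y)) x.
  exact: differentiable_comp dq (differentiable_sqrt q0).
have s0 : Num.sqrt (dotp x x) != 0 by rewrite gt_eqF // sqrtr_gt0.
rewrite deriveM; last first.
- exact/diff_derivable/differentiable_coord.
- by apply: derivableV => //; apply: diff_derivable.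
rewrite derive_coord deriveV //; last exact: diff_derivable.
rewrite (derive_sqrt v dq q0) derive_dotp tx !mulr0 scaler0 scaler0 addr0.
by rewrite sx sqrtr1 invr1 scale1r.
Qed.

Lemma compact_sphere : compact (@sphere R m).
Proof.
apply: bounded_closed_compact.
  exists 1; split; first exact: num_real.
  move=> M M1 x sx; suff : `|x| <= M by [].
  rewrite [leLHS]/Num.norm /= mx_normrE; apply: bigmax_le => [|[i j] _ /=].
    exact: ltW (lt_trans ltr01 M1).
  rewrite (ord1 i) (le_trans _ (ltW M1)) // -(@ler_pXn2r _ 2) ?nnegrE //.
  rewrite expr1n -sx /dotp (bigD1 j) //= -[`|_| ^+ 2]normrX ger0_norm ?sqr_ge0 //.
  by rewrite -expr2 lerDl sumr_ge0 // => i' _; rewrite -expr2 sqr_ge0.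
rewrite (_ : @sphere R m = (fun x : E => dotp x x) @^-1` [set 1]) //.
apply: (preimage_closed _ (@closed_eq _ _)) => x _.
by apply/differentiable_continuous; apply: (smooth_dotp openT [::]).
Qed.

End SphereSmoothness.

(** * Complex-valued smooth functions through their real and imaginary parts *)

Section ComplexValued.
Variables (R : realType) (V : normedModType R).
Let C := R[i].
Implicit Types (f g : V -> C) (O : set V).

Definition cdiff f x : Prop :=
  differentiable (fun y => complex.Re (f y)) x /\
  differentiable (fun y => complex.Im (f y)) x.

Definition cderive f (v x : V) : C :=
  (('D_v (fun y => complex.Re (f y)) x : R) +i*
   ('D_v (fun y => complex.Im (f y)) x : R))%C.

Lemma csmooth_cdiff O f x : csmooth_on O f -> O x -> cdiff f x.
Proof. by move=> [a b] Ox; split; [exact: (a [::])|exact: (b [::])]. Qed.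

Lemma csmooth_cst O (c : C) : csmooth_on O (fun _ : V => c).
Proof. by split; apply: smooth_on_cst. Qed.

Lemma csmoothD O f g : open O -> csmooth_on O f -> csmooth_on O g ->
  csmooth_on O (fun x => f x + g x).
Proof.
move=> oO [fr fi] [gr gi]; split.
  rewrite (_ : (fun x => _) = fun x => complex.Re (f x) + complex.Re (g x)); last first.
    by apply/funext => x; rewrite raddfD.
  exact: smooth_onD.
rewrite (_ : (fun x => _) = fun x => complex.Im (f x) + complex.Im (g x)); last first.
  by apply/funext => x; rewrite raddfD.
exact: smooth_onD.
Qed.

Lemma csmoothM O f g : open O -> csmooth_on O f -> csmooth_on O g ->
  csmooth_on O (fun x => f x * g x).
Proof.
move=> oO [fr fi] [gr gi]; split.
  rewrite (_ : (fun x => _) = fun x => complex.Re (f x) * complex.Re (g x) +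
     -1 * (complex.Im (f x) * complex.Im (g x))); last first.
    by apply/funext => x; rewrite mulN1r; case: (f x) (g x) => [a b] [c d].
  apply: smooth_onD => //; first exact: smooth_onM.
  by apply: smooth_onM; [|exact: smooth_on_cst|exact: smooth_onM].
rewrite (_ : (fun x => _) = fun x => complex.Re (f x) * complex.Im (g x) +
     complex.Im (f x) * complex.Re (g x)); last first.
  by apply/funext => x; case: (f x) (g x) => [a b] [c d].
by apply: smooth_onD => //; exact: smooth_onM.
Qed.

Lemma csmoothZ O (c : C) f : open O -> csmooth_on O f -> csmooth_on O (fun x => c * f x).
Proof. by move=> oO; apply: csmoothM => //; exact: csmooth_cst. Qed.

Lemma csmooth_real O (f : V -> R) : smooth_on O f -> csmooth_on O (fun x => (f x)%:C%C).
Proof. by move=> sf; split => //; exact: smooth_on_cst. Qed.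

Lemma csmooth_sum O (I : Type) (s : seq I) (P : pred I) (F : I -> V -> C) : open O ->
  (forall i, csmooth_on O (F i)) -> csmooth_on O (fun x => \sum_(i <- s | P i) F i x).
Proof.
move=> oO sF; elim: s => [|i s IH].
  by under eq_fun do rewrite big_nil; exact: csmooth_cst.
by under eq_fun do rewrite big_cons; case: (P i) => //; exact: csmoothD.
Qed.

Lemma cderive_cst (c : C) v x : cderive (fun=> c) v x = 0.
Proof. by rewrite /cderive !derive_cst. Qed.

Lemma cderiveD f g v x : cdiff f x -> cdiff g x ->
  cderive (fun y => f y + g y) v x = cderive f v x + cderive g v x.
Proof.
move=> [fr fi] [gr gi]; rewrite /cderive.
rewrite (_ : (fun y => complex.Re _) =
  (fun y => complex.Re (f y)) + (fun y => complex.Re (g y))); last first.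
  by apply/funext => y; rewrite raddfD.
rewrite (_ : (fun y => complex.Im _) =
  (fun y => complex.Im (f y)) + (fun y => complex.Im (g y))); last first.
  by apply/funext => y; rewrite raddfD.
by rewrite !deriveD //; apply: diff_derivable.
Qed.

Lemma cderive_realM (r : V -> R) f v x : differentiable r x -> cdiff f x ->
  cderive (fun y => (r y)%:C%C * f y) v x =
  (r x)%:C%C * cderive f v x + ('D_v r x)%:C%C * f x.
Proof.
move=> dr [fr fi]; rewrite /cderive.
rewrite (_ : (fun y => complex.Re _) = r * (fun y => complex.Re (f y))); last first.
  by apply/funext => y; rewrite /= !fctE; case: (f y) => a b /=; rewrite mul0r subr0.
rewrite (_ : (fun y => complex.Im _) = r * (fun y => complex.Im (f y))); last first.
  by apply/funext => y; rewrite /= !fctE; case: (f y) => a b /=; rewrite mul0r addr0.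
rewrite !deriveM; try exact: diff_derivable.
rewrite /GRing.scale /=; case: (f x) => a b /=; apply/eqP.
by rewrite eq_complex /= !mul0r !subr0 !addr0 [a * _]mulrC [b * _]mulrC !eqxx.
Qed.

Lemma cderiveZ (c : C) f v x : cdiff f x ->
  cderive (fun y => c * f y) v x = c * cderive f v x.
Proof.
move=> [fr fi]; rewrite /cderive; case: c => a b.
rewrite (_ : (fun y => complex.Re ((a +i* b)%C * f y)) =
   a *: (fun y => complex.Re (f y)) + (- b) *: (fun y => complex.Im (f y))); last first.
  by apply/funext => y; rewrite !fctE; case: (f y) => c d /=; rewrite /GRing.scale /= mulNr.
rewrite (_ : (fun y => complex.Im ((a +i* b)%C * f y)) =
   a *: (fun y => complex.Im (f y)) + b *: (fun y => complex.Re (f y))); last first.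
  by apply/funext => y; rewrite !fctE; case: (f y) => c d /=; rewrite /GRing.scale.
have d1 : derivable (fun y => complex.Re (f y)) x v by exact: diff_derivable.
have d2 : derivable (fun y => complex.Im (f y)) x v by exact: diff_derivable.
rewrite (deriveD (derivableZ d1) (derivableZ d2)) (deriveD (derivableZ d2) (derivableZ d1)).
rewrite (deriveZ a d1) (deriveZ (- b) d2) (deriveZ a d2) (deriveZ b d1).
by apply/eqP; rewrite eq_complex /= /GRing.scale /= mulNr !eqxx.
Qed.

Lemma cdiffZ (c : C) f x : cdiff f x -> cdiff (fun y => c * f y) x.
Proof.
move=> [fr fi]; case: c => a b; split.
  rewrite (_ : (fun y => complex.Re ((a +i* b)%C * f y)) =
   a *: (fun y => complex.Re (f y)) + (- b) *: (fun y => complex.Im (f y))).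
    by apply: differentiableD; apply: differentiableZ.
  by apply/funext => y; rewrite !fctE; case: (f y) => c d /=; rewrite /GRing.scale /= mulNr.
rewrite (_ : (fun y => complex.Im ((a +i* b)%C * f y)) =
   a *: (fun y => complex.Im (f y)) + b *: (fun y => complex.Re (f y))).
  by apply: differentiableD; apply: differentiableZ.
by apply/funext => y; rewrite !fctE; case: (f y) => c d /=; rewrite /GRing.scale.
Qed.

Lemma cdiffD f g x : cdiff f x -> cdiff g x -> cdiff (fun y => f y + g y) x.
Proof.
move=> [fr fi] [gr gi]; split.
  rewrite (_ : (fun y => _) = (fun y => complex.Re (f y)) + (fun y => complex.Re (g y))).
    exact: differentiableD.
  by apply/funext => y; rewrite raddfD.
rewrite (_ : (fun y => _) = (fun y => complex.Im (f y)) + (fun y => complex.Im (g y))).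
  exact: differentiableD.
by apply/funext => y; rewrite raddfD.
Qed.

Lemma cderive_sum (I : Type) (s : seq I) (F : I -> V -> C) v x :
  (forall i, cdiff (F i) x) ->
  cdiff (fun y => \sum_(i <- s) F i y) x /\
  cderive (fun y => \sum_(i <- s) F i y) v x = \sum_(i <- s) cderive (F i) v x.
Proof.
move=> dF; elim: s => [|i s [d IH]].
  rewrite (_ : (fun y => _) = fun=> 0); last by apply/funext => y; rewrite big_nil.
  by rewrite big_nil cderive_cst; split=> //; split; exact: differentiable_cst.
under eq_fun do rewrite big_cons; rewrite big_cons -IH.
by split; [exact: cdiffD|rewrite cderiveD].
Qed.

Lemma mxderiveE (p q : nat) (f : V -> 'M[C]_(p, q)) v x i j :
  mxderive f v x i j = cderive (fun y => f y i j) v x.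
Proof. by rewrite mxE. Qed.

End ComplexValued.

Section SphereBounds.
Variables (R : realType) (m : nat).
Let E := 'rV[R]_m.+1.

Lemma bounded_on_sphere (h : E -> R) :
  (forall x, sphere x -> {for x, continuous h}) ->
  exists K, forall x, sphere x -> `|h x| <= K.
Proof.
move=> ch; have : {within @sphere R m, continuous h}.
  apply: continuous_in_subspaceT => x; rewrite inE; exact: ch.
move/continuous_compact => /(_ (@compact_sphere R m)) /compact_bounded[K [_ HK]].
by exists (K + 1) => x sx; apply: HK; [rewrite ltrDl|exists x].
Qed.

Lemma smooth_bounded_on_sphere (h : E -> R) (vs : seq E) :
  smooth_on (@punctured R m) h ->
  exists K, forall x, sphere x -> `|iter_derive vs h x| <= K.
Proof.
move=> sh; apply: bounded_on_sphere => x sx; apply: differentiable_continuous.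
exact/sh/sphere_punctured.
Qed.

Lemma ssmooth_bounded (f : E -> R) : ssmooth f ->
  exists K, forall x, sphere x -> `|f x| <= K.
Proof.
move=> sf; have [K HK] := smooth_bounded_on_sphere [::] sf; exists K => x sx.
by rewrite -[x in f x](sproj_sphere sx); exact: HK.
Qed.

End SphereBounds.

Lemma unitmx_inj (F : fieldType) (d : nat) (A : 'M[F]_d) :
  (forall w : 'rV_d, w *m A = 0 -> w = 0) -> A \in unitmx.
Proof.
move=> H; rewrite -row_free_unit -kermx_eq0; apply/eqP/row_matrixP => i.
by rewrite row0; apply: H; apply/sub_kermxP; exact: row_sub.
Qed.

Section SmoothDeterminant.
Variables (R : realType) (V : normedModType R) (O : set V).
Hypothesis oO : open O.

Lemma smooth_det (d : nat) (A : V -> 'M[R]_d) :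
  (forall i j, smooth_on O (fun x => A x i j)) -> smooth_on O (fun x => \det (A x)).
Proof.
move=> sA; apply: smooth_on_sum => // s.
by apply: smooth_onM => //; [exact: smooth_on_cst|exact: smooth_on_prod].
Qed.

(** Cramer's formula: the cofactors are polynomial in the entries and the determinant does not
    vanish on [O]. *)
Lemma smooth_invmx (d : nat) (A : V -> 'M[R]_d) :
  (forall i j, smooth_on O (fun x => A x i j)) ->
  (forall x, O x -> A x \in unitmx) ->
  forall i j, smooth_on O (fun x => invmx (A x) i j).
Proof.
move=> sA uA i j.
apply: (@smooth_on_eq _ _ _ (fun x => (\det (A x))^-1 * cofactor (A x) j i)) => //.
  by move=> x Ox; rewrite /invmx uA // !mxE.
apply: smooth_onM => //.
  apply: smooth_onV => // [x Ox|]; last exact: smooth_det.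
  by have := uA x Ox; rewrite unitmxE unitfE.
apply: smooth_onM => //; first exact: smooth_on_cst.
apply: smooth_det => a b.
by under eq_fun do rewrite !mxE; exact: sA.
Qed.

End SmoothDeterminant.

(** * Orthonormal frames and Clifford multiplication *)

Section Riemannian.
Variables (R : realType) (m : nat).
Let E := 'rV[R]_m.+1.
Implicit Types (x v w : E).
Variable g : E -> E -> E -> R.
Hypothesis gR : riemannian g.

(** At a point of the sphere, the tangential part of a basis vector of the ambient space. These
    [m + 1] fields are globally smooth and span every tangent space, and so replace a global
    frame. *)
Definition coord_field (b : 'I_m.+1) x : E := delta_mx 0 b - x 0 b *: x.

Lemma dotp_delta x b : dotp x (delta_mx 0 b) = x 0 b.
Proof.
rewrite /dotp (bigD1 b) //= big1 => [|j jb]; rewrite mxE ?eqxx ?mulr1 ?addr0 //.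
by rewrite (negPf jb) mulr0.
Qed.

Lemma tangent_coord_field b x : sphere x -> tangent x (coord_field b x).
Proof.
rewrite /sphere /tangent /coord_field /= => sx; rewrite dotpDr -scaleN1r dotpZr.
by rewrite dotpZr sx dotp_delta mulr1 mulN1r subrr.
Qed.

Lemma ssmoothM (f h : E -> R) : ssmooth f -> ssmooth h -> ssmooth (fun x => f x * h x).
Proof. by move=> sf sh; apply: smooth_onM => //; exact: open_punctured. Qed.

Lemma ssmoothD (f h : E -> R) : ssmooth f -> ssmooth h -> ssmooth (fun x => f x + h x).
Proof. by move=> sf sh; apply: smooth_onD => //; exact: open_punctured. Qed.

Lemma ssmooth_cst (a : R) : ssmooth (fun _ : E => a).
Proof. exact: smooth_on_cst. Qed.

Lemma vector_field_coord b : vector_field (coord_field b).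
Proof.
split=> [j|x]; last exact: tangent_coord_field.
rewrite (_ : (fun x => _) = fun x => ((0 == 0 :> 'I_1) && (j == b))%:R +
    -1 * (x 0 b * x 0 j)); last first.
  by apply/funext => x; rewrite !mxE mulN1r.
apply: ssmoothD; first exact: ssmooth_cst.
by apply: ssmoothM; [exact: ssmooth_cst|apply: ssmoothM; exact: ssmooth_coord].
Qed.

Lemma tangentD x (a : R) v w : tangent x v -> tangent x w -> tangent x (a *: v + w).
Proof. by rewrite /tangent dotpDr dotpZr => -> ->; rewrite mulr0 addr0. Qed.

Lemma tangent0 x : tangent x 0. Proof. exact: dotp0. Qed.

Lemma coord_field_sum x (v : E) :
  \sum_b v 0 b *: coord_field b x = v - dotp x v *: x.
Proof.
rewrite /coord_field; under eq_bigr do rewrite scalerBr scalerA.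
rewrite sumrB -row_sum_delta; congr (_ - _); rewrite scaler_suml.
by apply: eq_bigr => b _; rewrite mulrC.
Qed.

(** Linearity of [g] is available on tangent vectors only, so the tangency of the partial sums is
    carried through the induction. *)
Lemma metric_sum_l x (I : finType) (a : I -> R) (u : I -> E) w : sphere x ->
  (forall i, tangent x (u i)) -> tangent x w ->
  tangent x (\sum_i a i *: u i) /\
  g x (\sum_i a i *: u i) w = \sum_i a i * g x (u i) w.
Proof.
case: gR => _ glin _ _ sx tu tw.
have g0 : g x 0 w = 0.
  have := glin x 1 0 0 w sx (tangent0 x) (tangent0 x) tw.
  by rewrite scaler0 addr0 mul1r => /eqP; rewrite addrC -subr_eq subrr => /eqP.
apply: (big_rec2 (fun v s => tangent x v /\ g x v w = s)); first by split=> //; exact: tangent0.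
by move=> i s v _ [tv <-]; split; [exact: tangentD|rewrite glin].
Qed.

Lemma metric_sym x v w : sphere x -> tangent x v -> tangent x w -> g x v w = g x w v.
Proof. by case: gR => gs _ _ _; exact: gs. Qed.

Definition gram x : 'M[R]_m.+1 :=
  \matrix_(a, b) g x (coord_field a x) (coord_field b x).

(* The Gram matrix of the (overcomplete) coordinate fields, made invertible in
   the radial direction. *)
Definition gram_hat x : 'M[R]_m.+1 := gram x + x^T *m x.

Lemma gram_tangent x v a : sphere x -> tangent x v ->
  \sum_b gram x a b * v 0 b = g x (coord_field a x) v.
Proof.
move=> sx tv; have tP b := tangent_coord_field b sx.
have [_ H] := metric_sum_l (fun b => v 0 b) sx tP (tP a).
rewrite -[in RHS](subr0 v) -(scale0r x) -[in RHS]tv -coord_field_sum.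
rewrite metric_sym //; last by have [] := metric_sum_l (fun b => v 0 b) sx tP (tP a).
by rewrite H; apply: eq_bigr => b _; rewrite mxE mulrC metric_sym.
Qed.

Lemma gram_hat_tangent x v a : sphere x -> tangent x v ->
  \sum_b gram_hat x a b * v 0 b = g x (coord_field a x) v.
Proof.
move=> sx tv; rewrite -gram_tangent //.
under eq_bigr do rewrite mxE mulrDl; rewrite big_split /= -[RHS]addr0; congr (_ + _).
under eq_bigr do rewrite mxE big_ord1 mxE -mulrA; rewrite -mulr_sumr.
by rewrite -[X in _ * X]/(dotp x v) tv mulr0.
Qed.

(** Let [v] be the tangential part of a row vector [w] in the kernel. Pairing with tangent vectors
    gives [g x v u = 0] for all of them, hence [v = 0] by definiteness. Pairing with [x], which
    [gram x] annihilates, removes the radial part. *)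
Lemma gram_hat_unit x : sphere x -> gram_hat x \in unitmx.
Proof.
move=> sx; apply: unitmx_inj => w wG; have tP b := tangent_coord_field b sx.
pose v := w - dotp x w *: x.
have tv : tangent x v by rewrite /tangent dotpDr -scaleN1r !dotpZr sx mulr1 mulN1r subrr.
have wE : w = v + dotp x w *: x by rewrite subrK.
have H (u : E) : tangent x u -> g x v u = 0.
  move=> tu; rewrite /v -coord_field_sum.
  have [_ ->] := metric_sum_l (fun b => w 0 b) sx tP tu.
  transitivity (\sum_b (w *m gram_hat x) 0 b * u 0 b); last first.
    by rewrite wG big1 // => b _; rewrite mxE mul0r.
  under [RHS]eq_bigr do rewrite mxE mulr_suml.
  rewrite exchange_big; apply: eq_bigr => a _ /=; rewrite -gram_hat_tangent //.
  by rewrite mulr_sumr; apply: eq_bigr => b _; rewrite mulrA.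
have v0 : v = 0.
  apply/eqP; apply: contraT => vn; case: gR => _ _ gpos _.
  by have := gpos x v sx tv vn; rewrite H // ltxx.
have gx (a : 'I_m.+1) : \sum_b gram x a b * x 0 b = 0.
  have tP' := tP a; have [tsum H'] := metric_sum_l (fun b => x 0 b) sx tP tP'.
  transitivity (g x (\sum_b x 0 b *: coord_field b x) (coord_field a x)).
    rewrite H'; apply: eq_bigr => b _; rewrite mxE mulrC; congr (_ * _).
    exact: metric_sym.
  rewrite coord_field_sum sx scale1r subrr.
  have [_ ] := metric_sum_l (fun _ : 'I_0 => 0) sx (fun i => tP a) tP'.
  by rewrite !big_ord0.
have xw : dotp x w = 0.
  have : \sum_b (w *m gram_hat x) 0 b * x 0 b = 0.
    by rewrite big1 // => b _; rewrite wG mxE mul0r.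
  under eq_bigr do rewrite mxE mulr_suml.
  rewrite exchange_big /= => e0; rewrite -[LHS]mulr1 -[in X in _ * X]sx -e0 /dotp mulr_suml.
  apply: eq_bigr => a _; under [RHS]eq_bigr do rewrite -mulrA; rewrite -mulr_sumr.
  under [in RHS]eq_bigr do rewrite mxE mulrDl; rewrite big_split /= gx add0r.
  rewrite [x 0 a * _]mulrC -mulrA mulr_sumr; congr (_ * _); apply: eq_bigr => b _.
  by rewrite mxE big_ord1 mxE mulrA.
by rewrite wE v0 xw scale0r addr0.
Qed.

Lemma ssmooth_gram_hat a b : ssmooth (fun x => gram_hat x a b).
Proof.
rewrite (_ : (fun x => _) = fun x => g x (coord_field a x) (coord_field b x) + x 0 a * x 0 b).
  apply: ssmoothD; last by apply: ssmoothM; exact: ssmooth_coord.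
  by case: gR => _ _ _; apply; exact: vector_field_coord.
by apply/funext => x; rewrite !mxE big_ord1 !mxE.
Qed.

Lemma ssmooth_gram_inv a b : ssmooth (fun x => invmx (gram_hat x) a b).
Proof.
rewrite /ssmooth -[_ \o _]/(fun x => invmx ((gram_hat \o sproj (m := m)) x) a b).
apply: smooth_invmx; first exact: open_punctured.
  by move=> i j; exact: ssmooth_gram_hat.
by move=> x px; apply: gram_hat_unit; exact: sphere_sproj.
Qed.

Section Frame.
Variables (x : E) (vs : 'M[R]_(m, m.+1)).
Hypothesis sx : sphere x.
Hypothesis fr : orthonormal_frame g x vs.

Lemma frame_coef (a : 'I_m -> R) c :
  g x (\sum_b a b *: row b vs) (row c vs) = a c.
Proof.
have [t o] := fr; have [_ ->] := metric_sum_l a sx t (t c).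
rewrite (bigD1 c) //= o eqxx mulr1 big1 ?addr0 // => b /negPf bc.
by rewrite o bc mulr0.
Qed.

(** In a vanishing combination the dot product with [x] isolates the radial coefficient, and the
    pairing by [g] then isolates each of the others. *)
Lemma frame_unit : (col_mx x vs : 'M[R]_(1 + m)) \in unitmx.
Proof.
have [t o] := fr; apply: unitmx_inj => w; rewrite -[w]hsubmxK mul_row_col.
rewrite [lsubmx w]mx11_scalar mul_scalar_mx mulmx_sum_row => H.
set a := lsubmx w 0 0 in H *; set v := \sum_i _ in H.
have tv : tangent x v by have [] := metric_sum_l (fun i => rsubmx w 0 i) sx t (tangent0 x).
have a0 : a = 0.
  have := congr1 (dotp x) H; rewrite dotpDr dotpZr sx mulr1 dotp0.
  by rewrite (tv : dotp x v = 0) addr0.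
have v0 : v = 0 by move: H; rewrite a0 scale0r add0r.
suff -> : rsubmx w = 0 by rewrite a0 raddf0 row_mx0.
apply/rowP => i; rewrite [RHS]mxE -(frame_coef (fun i => rsubmx w 0 i) i) -/v v0.
have [_ ] := metric_sum_l (fun _ : 'I_0 => 0) sx (fun _ => t i) (t i).
by rewrite !big_ord0.
Qed.

Lemma frame_expansion v : tangent x v -> v = \sum_a g x v (row a vs) *: row a vs.
Proof.
have [t o] := fr; move=> tv; pose w := v *m invmx (col_mx x vs : 'M[R]_(1 + m)).
have : v = w *m (col_mx x vs : 'M[R]_(1 + m)) by rewrite mulmxKV // frame_unit.
rewrite -[w]hsubmxK mul_row_col [lsubmx w]mx11_scalar mul_scalar_mx mulmx_sum_row.
set u := \sum_i _ => H.
have tu : tangent x u by have [] := metric_sum_l (fun i => rsubmx w 0 i) sx t (tangent0 x).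
have a0 : lsubmx w 0 0 = 0.
  have := congr1 (dotp x) H; rewrite dotpDr dotpZr sx mulr1.
  by rewrite (tu : dotp x u = 0) (tv : dotp x v = 0) addr0.
rewrite a0 scale0r add0r in H; rewrite {1}H; apply: eq_bigr => a _.
by rewrite H frame_coef.
Qed.

(** The combination of coordinate fields with row [j] of the inverse Gram matrix pairs with a frame
    vector to its [j]-th entry. It is therefore the [g]-gradient of the [j]-th coordinate
    function. *)
Lemma gradient_frame j a :
  \sum_b invmx (gram_hat x) j b * g x (coord_field b x) (row a vs) = vs a j.
Proof.
have [t o] := fr; under eq_bigr do rewrite -gram_hat_tangent // mulr_sumr.
rewrite exchange_big /=.
under eq_bigr => b _ do (under eq_bigr do rewrite mulrA; rewrite -mulr_suml).
transitivity (\sum_b (invmx (gram_hat x) *m gram_hat x) j b * row a vs 0 b).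
  by apply: eq_bigr => b _; rewrite [X in _ = X * _]mxE.
rewrite mulVmx ?gram_hat_unit // (bigD1 j) //= big1 => [|b bj].
  by rewrite !mxE eqxx mul1r addr0.
by rewrite mxE eq_sym (negPf bj) mul0r.
Qed.

End Frame.

End Riemannian.

Section Frames.
Variables (R : realType) (m : nat).
Let E := 'rV[R]_m.+1.
Implicit Types (x v w : E).
Variable g : E -> E -> E -> R.
Hypothesis gR : riemannian g.

(** A dimension count supplies the next vector: [k] orthogonality conditions and one of tangency
    leave a nonzero solution in dimension [m + 1] as long as [k < m]. It is then normalized. *)
Lemma orthonormal_family x k : sphere x -> (k <= m)%N ->
  exists us : 'M[R]_(k, m.+1), (forall a, tangent x (row a us)) /\
    (forall a b, g x (row a us) (row b us) = (a == b)%:R).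
Proof.
move=> sx; elim: k => [_|k IH km]; first by exists 0; split=> [[]|[]].
have [us [t o]] := IH (ltnW km).
pose Z : 'M[R]_(m.+1, k + 1) :=
  row_mx (\matrix_(b, a) g x (coord_field b x) (row a us)) x^T.
have kZ : kermx Z != 0.
  rewrite kermx_eq0 /row_free neq_ltn; apply/orP; left.
  by apply: leq_ltn_trans (rank_leq_col Z) _; rewrite addn1.
pose w := nz_row (kermx Z).
have w0 : w != 0 by rewrite nz_row_eq0.
have : w *m Z = 0 by apply/sub_kermxP; exact: nz_row_sub.
rewrite mul_mx_row -[RHS]row_mx0 => /eq_row_mx[wg wx].
have tw : tangent x w.
  have /matrixP/(_ 0 0) := wx; rewrite !mxE => wx0; rewrite /tangent -[RHS]wx0.
  by apply: eq_bigr => j _; rewrite mxE mulrC.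
have gw a : g x w (row a us) = 0.
  have tP b := tangent_coord_field b sx.
  have [_ H] := metric_sum_l gR (fun b => w 0 b) sx tP (t a).
  have {1}-> : w = \sum_b w 0 b *: coord_field b x.
    by rewrite coord_field_sum (tw : dotp x w = 0) scale0r subr0.
  rewrite H.
  have /matrixP/(_ 0 a) := wg; rewrite !mxE => e0; rewrite -[RHS]e0.
  by apply: eq_bigr => b _; rewrite mxE.
have [gs gl gp _] := gR; have gww := gp x w sx tw w0.
pose s := (Num.sqrt (g x w w))^-1; pose u := s *: w.
have tu : tangent x u by rewrite /tangent dotpZr tw mulr0.
have gl0 v v' (a : R) : tangent x v -> tangent x v' -> g x (a *: v) v' = a * g x v v'.
  move=> tv tv'; have [_] := metric_sum_l gR (fun _ : 'I_1 => a) sx (fun _ => tv) tv'.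
  by rewrite !big_ord1.
have gu a : g x u (row a us) = 0 by rewrite gl0 ?gw ?mulr0.
have guu : g x u u = 1.
  rewrite gl0 // gs // gl0 // mulrA -expr2 exprVn sqr_sqrtr ?ltW //.
  by rewrite mulVf // gt_eqF.
exists (col_mx u us : 'M[R]_(1 + k, m.+1)).
have rowE (a : 'I_(1 + k)) : row a (col_mx u us : 'M[R]_(1 + k, m.+1)) =
    match fintype.split a with inl _ => u | inr b => row b us end.
  by apply/rowP => j; rewrite !mxE; case: fintype.split => b; rewrite ?mxE ?(ord1 b).
split=> [a|a b]; rewrite !rowE; first by case: fintype.split.
rewrite -(inj_eq (can_inj (@splitK 1 k))); case: fintype.split => a'; case: fintype.split => b'.
- by rewrite (ord1 a') (ord1 b') eqxx guu.
- by rewrite gu.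
- by rewrite gs // gu.
- by rewrite o.
Qed.

Lemma oriented_frame eps x : sphere x -> (0 < m)%N ->
  exists vs, orthonormal_frame g x vs /\ 0 < orient eps x vs.
Proof.
move=> sx m0; have [us fr] := orthonormal_family sx (leqnn m).
have /= := frame_unit gR sx fr; rewrite unitmxE unitfE => d0.
have [|le0] := ltP 0 (orient eps x us); first by exists us.
(* A negatively oriented frame is corrected by reversing its first vector. *)
pose a0 := Ordinal m0; pose d : 'rV[R]_m := \row_a (-1) ^+ (a == a0).
exists (diag_mx d *m us); have [t o] := fr.
have rowE a : row a (diag_mx d *m us) = d 0 a *: row a us.
  by apply/rowP => j; rewrite mul_diag_mx !mxE.
have gl v v' (a : R) : tangent x v -> tangent x v' -> g x (a *: v) v' = a * g x v v'.
  move=> tv tv'; have [_] := metric_sum_l gR (fun _ : 'I_1 => a) sx (fun _ => tv) tv'.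
  by rewrite !big_ord1.
have td a : tangent x (d 0 a *: row a us) by rewrite /tangent dotpZr t mulr0.
split.
  split=> [a|a b]; rewrite !rowE //.
  rewrite gl // (metric_sym gR) // gl // o eq_sym mulrCA mulrA.
  have [->|_] := eqVneq a b; last by rewrite mulr0.
  by rewrite mulr1 mxE -expr2 sqrr_sign.
have -> : orient eps x (diag_mx d *m us) = - orient eps x us.
  pose B : 'M[R]_(1 + m) := block_mx 1%:M 0 0 (diag_mx d).
  have dB : \det B = -1.
    rewrite det_ublock det1 mul1r det_diag (bigD1 a0) //= big1 => [|a /negPf an].
      by rewrite mxE eqxx mulr1 expr1.
    by rewrite mxE an.
  rewrite /orient; have -> : col_mx x (diag_mx d *m us) = B *m col_mx x us.
    by rewrite mul_block_col mul1mx !mul0mx addr0 add0r.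
  by rewrite det_mulmx [\det B]dB mulN1r mulrN.
by rewrite oppr_gt0 lt_neqAle le0 andbT /orient mulf_eq0 signr_eq0.
Qed.

(** The frame has volume 1 for [g]. Its round volume is [r^m] times the absolute value of the
    determinant: since [x] is a Euclidean unit normal, the Euclidean Gram determinant of the frame
    is the square of that determinant. *)
Lemma frame_det (r : R) eps x vs : 0 < r -> same_volume_form eps g (round r) ->
  sphere x -> orthonormal_frame g x vs -> 0 < orient eps x vs ->
  \det (col_mx x vs : 'M[R]_(1 + m)) = (-1) ^+ eps * (r ^+ m)^-1.
Proof.
move=> r0 sv sx [t o] op; have := sv x vs sx t; rewrite /volume_form gtr0_sg // !mul1r.
have -> : \matrix_(a, b) g x (row a vs) (row b vs) = 1%:M.
  by apply/matrixP => a b; rewrite !mxE o.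
have -> : \matrix_(a, b) round r x (row a vs) (row b vs) = r ^+ 2 *: (vs *m vs^T).
  apply/matrixP => a b; rewrite !mxE; congr (_ * _).
  by apply: eq_bigr => j _; rewrite !mxE.
set Q := (col_mx x vs : 'M[R]_(1 + m)).
have QE : \det (vs *m vs^T) = (\det Q) ^+ 2.
  rewrite expr2 -[in X in _ * X]det_tr -det_mulmx /Q tr_col_mx mul_col_row.
  have -> : x *m x^T = 1%:M.
    apply/matrixP => a b; rewrite (ord1 a) (ord1 b) !mxE -[RHS]sx.
    by apply: eq_bigr => j _; rewrite mxE.
  have -> : x *m vs^T = 0.
    apply/matrixP => a b; rewrite (ord1 a) !mxE -[RHS](t b).
    by apply: eq_bigr => j _; rewrite !mxE.
  by rewrite det_lblock det1 mul1r.
rewrite det1 sqrtr1 detZ QE -exprM mulnC exprM -exprMn sqrtr_sqr.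
have sgn : (-1) ^+ eps * \det Q = `|\det Q|.
  by rewrite -[LHS]gtr0_norm // normrM normr_sign mul1r.
rewrite normrM (ger0_norm (exprn_ge0 _ (ltW r0))) -sgn => h.
have rn0 : r ^+ m != 0 by rewrite gt_eqF // exprn_gt0.
have <- : (-1) ^+ eps * \det Q = (r ^+ m)^-1 by apply: (mulfI rn0); rewrite -h mulfV.
by rewrite mulrA -expr2 sqrr_sign mul1r.
Qed.

End Frames.

(** * Leibniz rule and torus equivariance *)

Section DiracLeibniz.
Variables (R : realType) (m : nat).
Let E := 'rV[R]_m.+1.
Let C := R[i].
Let N := (2 ^ m./2)%N.
Implicit Types (x v w : E) (psi : E -> 'cV[C]_N).
Variable g : E -> E -> E -> R.
Hypothesis gR : riemannian g.
Variable c : E -> E -> 'M[C]_N.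
Hypothesis cP : clifford_mult g c.

Lemma clifford_sum x (I : finType) (a : I -> R) (u : I -> E) : sphere x ->
  (forall i, tangent x (u i)) ->
  c x (\sum_i a i *: u i) = \sum_i (a i)%:C%C *: c x (u i).
Proof.
have [clin _ _ _] := cP; move=> sx tu.
have c0 : c x 0 = 0.
  have := clin x 1 0 0 sx (tangent0 x) (tangent0 x).
  by rewrite scaler0 addr0 scale1r => /eqP; rewrite addrC -subr_eq subrr => /eqP.
suff : tangent x (\sum_i a i *: u i) /\
  c x (\sum_i a i *: u i) = \sum_i (a i)%:C%C *: c x (u i) by case.
apply: (big_rec2 (fun v s => tangent x v /\ c x v = s)); first by split=> //; exact: tangent0.
by move=> i s v _ [tv <-]; split; [exact: tangentD|rewrite clin].
Qed.

(** Clifford multiplication by the [g]-gradient of the [j]-th coordinate, written without a frame so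
    that its smoothness is visible. *)
Definition cgrad (j : 'I_m.+1) x : 'M[C]_N :=
  \sum_b (invmx (gram_hat g x) j b)%:C%C *: c x (coord_field b x).

Lemma cgrad_frame x vs j : sphere x -> orthonormal_frame g x vs ->
  cgrad j x = \sum_a (vs a j)%:C%C *: c x (row a vs).
Proof.
move=> sx fr; have [t o] := fr.
have E1 b : c x (coord_field b x) =
    \sum_a (g x (coord_field b x) (row a vs))%:C%C *: c x (row a vs).
  by rewrite {1}(frame_expansion gR sx fr (tangent_coord_field b sx)) clifford_sum.
rewrite /cgrad; under eq_bigr do rewrite E1 scaler_sumr.
rewrite exchange_big; apply: eq_bigr => a _ /=.
under eq_bigr do rewrite scalerA; rewrite -scaler_suml; congr (_ *: _).
rewrite -(gradient_frame gR sx fr) rmorph_sum; apply: eq_bigr => b _.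
by rewrite rmorphM.
Qed.

Lemma cgrad_smooth j : smxsmooth (cgrad j).
Proof.
move=> a b; rewrite (_ : (fun x => _) = fun x =>
  \sum_i (invmx (gram_hat g (sproj x)) j i)%:C%C * c (sproj x) (coord_field i (sproj x)) a b).
  apply: csmooth_sum => [|i]; first exact: open_punctured.
  apply: csmoothM; first exact: open_punctured.
    exact/csmooth_real/ssmooth_gram_inv.
  by have [_ _ _ H] := cP; exact: (H _ (@vector_field_coord R m i)).
by apply/funext => x; rewrite /= summxE; apply: eq_bigr => i _; rewrite mxE.
Qed.

Lemma frame_clifford_anti x vs : sphere x -> orthonormal_frame g x vs ->
  forall a b, a != b ->
  c x (row a vs) *m c x (row b vs) = - (c x (row b vs) *m c x (row a vs)).
Proof.
move=> sx [t o] a b ab; have [_ H _ _] := cP; apply/eqP; rewrite -addr_eq0 H // o.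
by rewrite (negPf ab) mulr0 raddf0.
Qed.

Section Smooth.
Variables (p q : nat).
Implicit Types (f h : E -> 'M[C]_(p, q)).

Lemma smxsmooth_sum (I : Type) (s : seq I) (F : I -> E -> 'M[C]_(p, q)) :
  (forall i, smxsmooth (F i)) -> smxsmooth (fun x => \sum_(i <- s) F i x).
Proof.
move=> sF i j; rewrite (_ : (fun x => _) =
  fun x => \sum_(k <- s) (F k \o sproj (m := m)) x i j).
  by apply: csmooth_sum => [|k]; [exact: open_punctured|exact: sF].
by apply/funext => x; rewrite /= summxE.
Qed.

Lemma smxsmoothZ (a : C) f : smxsmooth f -> smxsmooth (fun x => a *: f x).
Proof.
move=> sf i j; rewrite (_ : (fun x => _) = fun x => a * (f \o sproj (m := m)) x i j).
  by apply: csmoothZ => //; exact: open_punctured.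
by apply/funext => x; rewrite /= mxE.
Qed.

Lemma smxsmooth_coordM (k : 'I_m.+1) f : smxsmooth f ->
  smxsmooth (fun x => (x 0 k)%:C%C *: f x).
Proof.
move=> sf i j; rewrite (_ : (fun x => _) =
  fun x => ((sproj x) 0 k)%:C%C * (f \o sproj (m := m)) x i j).
  apply: csmoothM => //; first exact: open_punctured.
  exact/csmooth_real/ssmooth_coord.
by apply/funext => x; rewrite /= mxE.
Qed.

Lemma smxsmooth_cdiff f i j x : smxsmooth f -> sphere x ->
  cdiff (fun y => (f \o sproj (m := m)) y i j) x.
Proof.
move=> sf sx; apply: csmooth_cdiff (sphere_punctured sx); exact: sf.
Qed.

Lemma smxderive_sum (I : Type) (s : seq I) (a : I -> C) (F : I -> E -> 'M[C]_(p, q)) v x :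
  (forall i, smxsmooth (F i)) -> sphere x ->
  smxderive (fun y => \sum_(i <- s) a i *: F i y) v x =
  \sum_(i <- s) a i *: smxderive (F i) v x.
Proof.
move=> sF sx; apply/matrixP => i j; rewrite summxE mxderiveE.
rewrite (_ : (fun y => _) = fun y => \sum_(k <- s) a k * (F k \o sproj (m := m)) y i j).
  have [_ ->] := @cderive_sum R E I s (fun k y => a k * (F k \o sproj (m := m)) y i j) v x
     (fun k => cdiffZ (a k) (smxsmooth_cdiff i j (sF k) sx)).
  apply: eq_bigr => k _; rewrite cderiveZ; last exact: smxsmooth_cdiff.
  by rewrite mxE mxderiveE.
by apply/funext => y; rewrite /= summxE; apply: eq_bigr => k _; rewrite mxE.
Qed.

Lemma smxderive_coordM (k : 'I_m.+1) f v x : smxsmooth f -> sphere x -> tangent x v ->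
  smxderive (fun y => (y 0 k)%:C%C *: f y) v x =
  (x 0 k)%:C%C *: smxderive f v x + (v 0 k)%:C%C *: f x.
Proof.
move=> sf sx tv; apply/matrixP => i j; rewrite mxderiveE.
rewrite (_ : (fun y => _) =
  fun y => ((fun y : E => (sproj y) 0 k : R) y)%:C%C * (f \o sproj (m := m)) y i j).
  rewrite cderive_realM; last exact: smxsmooth_cdiff.
    have vk : 'D_v (fun y : E => (sproj y) 0 k : R) x = v 0 k := sderive_coord k sx tv.
    by rewrite vk [RHS]mxE [X in _ = X + _]mxE [X in _ = _ + X]mxE mxderiveE /= sproj_sphere.
  exact: (ssmooth_coord k [::] (sphere_punctured sx)).
by apply/funext => y; rewrite /= mxE.
Qed.

End Smooth.

Variables (A : E -> E -> 'M[C]_N) (D : (E -> 'cV[C]_N) -> (E -> 'cV[C]_N)).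
Hypothesis DP : dirac_operator g c A D.

(** [D] is specified on smooth sections through an orthonormal frame at the point, and its linearity
    is read off from that formula. *)
Lemma dirac_sum (I : Type) (s : seq I) (a : I -> C) (F : I -> E -> 'cV[C]_N) x :
  (forall i, smxsmooth (F i)) -> sphere x ->
  D (fun y => \sum_(i <- s) a i *: F i y) x = \sum_(i <- s) a i *: D (F i) x.
Proof.
move=> sF sx; have [vs [t o]] := orthonormal_family gR sx (leqnn m).
rewrite (@DP _ x vs) //; last by apply: smxsmooth_sum => i; exact: smxsmoothZ.
under [RHS]eq_bigr do rewrite (DP (sF _) sx (conj t o)) scalerA mulrC -scalerA scaler_sumr.
rewrite -scaler_sumr exchange_big; congr (_ *: _); apply: eq_bigr => b _ /=.
rewrite /spin_deriv smxderive_sum // mulmx_sumr -big_split /= mulmx_sumr.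
by apply: eq_bigr => i _; rewrite -scalemxAr -scalerDr -scalemxAr.
Qed.

(** Only the derivative in the connection sees the scalar factor; it contributes the [k]-th entries
    of the frame vectors, which [cgrad_frame] assembles. *)
Lemma dirac_coordM (k : 'I_m.+1) psi x : smxsmooth psi -> sphere x ->
  D (fun y => (y 0 k)%:C%C *: psi y) x =
  (x 0 k)%:C%C *: D psi x - 'i%C *: (cgrad k x *m psi x).
Proof.
move=> sp sx; have [vs fr] := orthonormal_family gR sx (leqnn m).
have [t o] := fr; rewrite (@DP _ x vs) //; last exact: smxsmooth_coordM.
rewrite (DP sp sx fr) (cgrad_frame _ sx fr) scalerA mulrC -scalerA -scaleNr -scalerDr.
congr (_ *: _); rewrite mulmx_suml scaler_sumr -big_split; apply: eq_bigr => a _ /=.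
rewrite /spin_deriv smxderive_coordM // -scalemxAr addrAC -scalerDr.
by rewrite mulmxDr -!scalemxAr -scalemxAl mxE.
Qed.

End DiracLeibniz.

(** * The torus action in coordinates *)

Section Rotation.
Variables (R : realType) (m n : nat).
Let E := 'rV[R]_m.+1.
Let C := R[i].
Implicit Types (x y : E) (s : 'rV[R]_n).

Lemma rot_linear s (a : R) x y : Defs.rot s (a *: x + y) = a *: Defs.rot s x + Defs.rot s y.
Proof.
apply/rowP => j; rewrite !mxE; case: insub => [mu|]; rewrite ?mxE //.
by case: odd; rewrite ?mxE /=; ring.
Qed.

Lemma rot_expansion s x (j : 'I_m.+1) :
  Defs.rot s x 0 j = \sum_i Defs.rot s (delta_mx 0 i) 0 j * x 0 i.
Proof.
have rot0 : Defs.rot s (0 : E) = 0.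
  apply: (addrI (Defs.rot s (0 : E))); rewrite -{2}(scale1r (Defs.rot s 0)).
  by rewrite addrC -rot_linear scale1r !addr0.
rewrite {1}[x]row_sum_delta.
have -> : Defs.rot s (\sum_i x 0 i *: delta_mx 0 i) = \sum_i x 0 i *: Defs.rot s (delta_mx 0 i).
  by elim/big_rec2: _ => [|i u v _ <-]; rewrite ?rot0 // rot_linear.
by rewrite summxE; apply: eq_bigr => i _; rewrite mxE mulrC.
Qed.

Let nat_coord x (j : nat) : R := x 0 (inord j).

Lemma rot_even s x (mu : 'I_n) : (mu.*2 < m)%N -> let t := 2 * pi * s 0 mu in
  nat_coord (Defs.rot s x) mu.*2 =
  cos t * nat_coord x mu.*2 - sin t * nat_coord x mu.*2.+1.
Proof.
move=> lt t; rewrite /nat_coord mxE inordK; last by rewrite ltnS ltnW.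
by rewrite doubleK valK odd_double.
Qed.

Lemma rot_odd s x (mu : 'I_n) : (mu.*2 < m)%N -> let t := 2 * pi * s 0 mu in
  nat_coord (Defs.rot s x) mu.*2.+1 =
  sin t * nat_coord x mu.*2 + cos t * nat_coord x mu.*2.+1.
Proof.
move=> lt t; rewrite /nat_coord mxE inordK; last by rewrite ltnS.
by rewrite /= uphalf_double valK odd_double.
Qed.

(** The second alternative is the odd sphere, where the coordinate of index [2n] does not exist and
    [inord] takes its default value. *)
Lemma rot_top s x : Defs.rot s x 0 (inord n.*2) = x 0 (inord n.*2) \/ (m < n.*2)%N.
Proof.
have [lt|] := ltnP m n.*2; [by right|left].
by rewrite mxE inordK ?ltnS // doubleK insubF // ltnn.
Qed.

Hypothesis mn : m = n.*2 \/ m.+1 = n.*2.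

Lemma double_lt (mu : 'I_n) : (mu.*2 < m)%N.
Proof. by case: mn (ltn_ord mu) => h; lia. Qed.

Lemma dotp_rot s x : dotp (Defs.rot s x) (Defs.rot s x) = dotp x x.
Proof.
have E1 y : dotp y y = \sum_(j < m.+1) (fun j => nat_coord y j ^+ 2) j.
  by apply: eq_bigr => j _; rewrite /nat_coord inord_val expr2.
have step (mu : 'I_n) :
  nat_coord (Defs.rot s x) mu.*2 ^+ 2 + nat_coord (Defs.rot s x) mu.*2.+1 ^+ 2 =
  nat_coord x mu.*2 ^+ 2 + nat_coord x mu.*2.+1 ^+ 2.
  rewrite rot_even ?double_lt // rot_odd ?double_lt //; set t := 2 * pi * _.
  have := cos2Dsin2 t; move: (cos t) (sin t) => a b ab.
  transitivity ((a ^+ 2 + b ^+ 2) * (nat_coord x mu.*2 ^+ 2 + nat_coord x mu.*2.+1 ^+ 2)).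
    by ring.
  by rewrite ab mul1r.
have sumE (F F' : nat -> R) :
    (forall mu : 'I_n, F mu.*2 + F mu.*2.+1 = F' mu.*2 + F' mu.*2.+1) ->
    (m = n.*2 -> F n.*2 = F' n.*2) -> \sum_(j < m.+1) F j = \sum_(j < m.+1) F' j.
  move=> FF Ft; case: mn => h; last by rewrite h !sum_ord_double; exact: eq_bigr.
  rewrite h !big_ord_recr /= !sum_ord_double Ft //; congr (_ + _); exact: eq_bigr.
rewrite !E1; apply: (sumE (fun j => nat_coord (Defs.rot s x) j ^+ 2) (fun j => nat_coord x j ^+ 2)) => // h.
rewrite /nat_coord.
by have [->//|] := rot_top s x; move=> lt; move: (lt); rewrite {1}h ltnn.
Qed.

Lemma sphere_rot s x : sphere x -> sphere (Defs.rot s x).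
Proof. by rewrite /sphere /= dotp_rot. Qed.

Lemma zcoord_rot s x (mu : 'I_n) : zcoord mu (Defs.rot s x) = cis (2 * pi * s 0 mu) * zcoord mu x.
Proof.
rewrite /zcoord -/(nat_coord _ _) -/(nat_coord (Defs.rot s x) _) rot_even ?double_lt //.
rewrite rot_odd ?double_lt // /cis; apply/eqP; rewrite eq_complex /= eqxx /=.
by apply/eqP; rewrite addrC.
Qed.

End Rotation.

(** * Equivariance of the Clifford gradients under the lifted torus *)

Section Equivariance.
Variables (R : realType) (m n : nat).
Let E := 'rV[R]_m.+1.
Let C := R[i].
Let N := (2 ^ m./2)%N.
Implicit Types (x v w : E).
Hypothesis mn : m = n.*2 \/ m.+1 = n.*2.
Variable g : E -> E -> E -> R.
Hypothesis gR : riemannian g.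
Variable c : E -> E -> 'M[C]_N.
Hypothesis cP : clifford_mult g c.
Variables (A : E -> E -> 'M[C]_N) (D : (E -> 'cV[C]_N) -> (E -> 'cV[C]_N)).
Hypothesis DP : dirac_operator g c A D.
Variable V : 'rV[R]_n -> E -> 'M[C]_N.
Hypothesis VP : torus_lift D V.

(** The lift is smooth jointly in [s] and [x]. Derivatives in [x] alone are those along the vectors
    [(0, v)], which gives smoothness for each fixed [s]. *)
Lemma iter_derive_section (F : 'rV[R]_n * E -> R) (s : 'rV[R]_n) (vs : seq E) :
  iter_derive vs (fun x => F (s, x)) =
  (fun x => iter_derive [seq (0, v) | v <- vs] F (s, x)).
Proof.
elim: vs => [|v vs IH] //=; apply/funext => x; rewrite IH /derive.
congr (lim _); apply/funext => B; apply/propext.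
have -> // : (fun h : R => h^-1 *: (((fun x0 : E => iter_derive [seq (0, v0) | v0 <- vs] F (s, x0)) \o
       shift x) (h *: v) - iter_derive [seq (0, v0) | v0 <- vs] F (s, x))) =
   (fun h : R => h^-1 *: ((iter_derive [seq (0, v0) | v0 <- vs] F \o shift (s, x)) (h *: (0, v)) -
      iter_derive [seq (0, v0) | v0 <- vs] F (s, x))).
apply/funext => h /=; congr (_ *: (iter_derive _ _ _ - _)).
by rewrite /= -[RHS]/(h *: 0 + s, h *: v + x) scaler0 add0r.
Qed.

Lemma smooth_section (F : 'rV[R]_n * E -> R) (s : 'rV[R]_n) :
  smooth_on [set p : 'rV[R]_n * E | p.2 != 0] F ->
  smooth_on (@punctured R m) (fun x => F (s, x)).
Proof.
move=> sF vs x px; rewrite iter_derive_section.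
rewrite -[fun x => _]/(iter_derive [seq (0, v) | v <- vs] F \o (fun x => (s, x))).
apply: differentiable_comp; last exact: sF.
by apply: differentiable_pair => //; exact: differentiable_cst.
Qed.

Lemma spin_lift_smooth s : smxsmooth (V s).
Proof.
have [sV _ _ _ _] := VP; move=> i j; have [sr si] := sV i j.
by split; [exact: (smooth_section s sr)|exact: (smooth_section s si)].
Qed.

Lemma smxsmooth_mulmx_cst (p q r : nat) (F : E -> 'M[C]_(p, q)) (u : 'M[C]_(q, r)) :
  smxsmooth F -> smxsmooth (fun x => F x *m u).
Proof.
move=> sF i j; rewrite (_ : (fun x => _) =
    fun x => \sum_k (u k j * (F \o sproj (m := m)) x i k)).
  apply: csmooth_sum => [|k]; first exact: open_punctured.
  by apply: csmoothZ => //; exact: open_punctured.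
by apply/funext => x; rewrite mxE; apply: eq_bigr => k _; rewrite mulrC.
Qed.

Lemma smxsmooth_cst (p q : nat) (u : 'M[C]_(p, q)) : smxsmooth (fun _ : E => u).
Proof. by move=> i j; exact: csmooth_cst. Qed.

(* Compare the Dirac operator on the lift of y_j u and of u, for a constant
   spinor u. *)
Lemma cgrad_equivariant s j x : sphere x ->
  \sum_i (Defs.rot s (delta_mx 0 i : E) 0 j)%:C%C *: (cgrad g c i x *m V s x) =
  V s x *m cgrad g c j (Defs.rot s x).
Proof.
move=> sx; have sr := sphere_rot mn s sx.
have [_ _ _ _ DV] := VP.
have eqmx (X Y : 'M[C]_N) : (forall u : 'cV[C]_N, X *m u = Y *m u) -> X = Y.
  move=> H; apply/matrixP => a b; have := H (delta_mx b 0).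
  by rewrite -!colE => /matrixP/(_ a 0); rewrite !mxE.
apply: eqmx => u; pose su := @smxsmooth_cst _ _ u.
have sV : smxsmooth (lift_act V s (fun=> u)).
  by apply: smxsmooth_mulmx_cst; exact: spin_lift_smooth.
have H1 := DV s _ x su sx.
have H2 := DV s _ x (smxsmooth_coordM j su) sx.
move: H2; rewrite {2}/lift_act (dirac_coordM gR cP DP) //.
have -> : lift_act V s (fun y : E => (y 0 j)%:C%C *: u) =
  (fun y => \sum_i (Defs.rot s (delta_mx 0 i : E) 0 j)%:C%C *: ((y 0 i)%:C%C *: lift_act V s (fun=> u) y)).
  apply/funext => y; rewrite /lift_act rot_expansion rmorph_sum -scalemxAr /=.
  by rewrite scaler_suml; apply: eq_bigr => i _; rewrite rmorphM scalerA.
rewrite (dirac_sum gR DP) //; last by move=> i; exact: smxsmooth_coordM.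
under eq_bigr do rewrite (dirac_coordM gR cP DP) // H1 scalerBr scalerA -rmorphM.
rewrite big_split /= -scaler_suml -rmorph_sum -rot_expansion.
(* The terms containing [D u] agree on both sides by [H1]; the gradient terms that remain are the
   claim, up to the factor [-i]. *)
rewrite mulmxBr /lift_act -scalemxAr => /addrI; rewrite sumrN => /oppr_inj.
rewrite -[X in _ = X -> _]scalemxAr => H.
rewrite mulmx_suml -mulmxA; apply: (scalerI (a := 'i%C : C)).
  by rewrite eq_complex /= oner_eq0 andbF.
rewrite -H scaler_sumr; apply: eq_bigr => i _.
by rewrite -scalemxAl -mulmxA !scalerA mulrC.
Qed.

End Equivariance.

(** * The algebra acting on sections *)

Section AlgebraAction.
Variables (R : realType) (m n N : nat) (theta : 'M[R]_n).
Let E := 'rV[R]_m.+1.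
Let C := R[i].
Let weight := 'rV[int]_n.

Lemma clim_near_cst (u : nat -> C) (c : C) (B : nat) :
  (forall M, (B <= M)%N -> u M = c) -> clim u = c.
Proof.
move=> H; rewrite /clim; case: c H => a b H; congr (_ +i* _)%C;
  apply: lim_near_cst => //; exists B => // M /= BM; by rewrite H.
Qed.

Variables (L : finType) (wt : L -> weight).

Definition weight_bound : nat := \max_(l : L) \max_(nu : 'I_n) `|wt l ord0 nu|%N.

Lemma weight_of_box_inj M : injective (@weight_of_box n M).
Proof.
move=> l l' /rowP H; apply/ffunP => nu; apply/val_inj.
by have := H nu; rewrite !mxE => /addIr [].
Qed.

Lemma weight_of_box_surj M l : (weight_bound <= M)%N ->
  exists f : {ffun 'I_n -> 'I_(M.*2.+1)}, weight_of_box f = wt l.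
Proof.
move=> bM; exists [ffun nu => inord (absz (wt l ord0 nu + M%:Z))].
apply/rowP => nu; rewrite !mxE ffunE.
have : (`|wt l ord0 nu| <= M)%N.
  apply: leq_trans bM; apply: leq_trans (leq_bigmax l).
  exact: (leq_bigmax (F := fun nu => absz (wt l ord0 nu)) nu).
move: (wt l ord0 nu) => z h; have h2 : (absz (z + M%:Z)%R < M.*2.+1)%N by lia.
by rewrite inordK //; lia.
Qed.

(* The box sums of a finitely supported element are eventually constant. *)
Lemma alg_act_finite (coef : L -> E -> C) (psi : sections R m n N) k x :
  alg_act theta (fun w y => \sum_l (w == wt l)%:R * coef l y) psi k x =
  \sum_l (weyl_phase theta (wt l) (k - wt l) * coef l x) *: psi (k - wt l) x.
Proof.
apply/colP => j; rewrite mxE summxE; apply: (@clim_near_cst _ _ weight_bound) => M bM /=.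
transitivity (\sum_(f : {ffun 'I_n -> 'I_(M.*2.+1)}) \sum_l
   (weight_of_box f == wt l)%:R * (weyl_phase theta (wt l) (k - wt l) * coef l x *
     psi (k - wt l) x j 0)).
  apply: eq_bigr => f _; rewrite mulr_sumr mulr_suml; apply: eq_bigr => l _.
  by have [->|_] := eqVneq (weight_of_box f) (wt l); rewrite ?mul1r // !mul0r mulr0 mul0r.
rewrite exchange_big; apply: eq_bigr => l _ /=; rewrite -mulr_suml mxE.
have [f0 f0E] := weight_of_box_surj l bM; rewrite (bigD1 f0) //= f0E eqxx big1 => [|f ff0].
  by rewrite addr0 mul1r.
by rewrite -f0E (inj_eq (@weight_of_box_inj M)) (negPf ff0).
Qed.

Variables (p : nat) (Mx : L -> 'M[C]_p).

(** A finite sum of matrices [Mx l] times [f l (x) W(wt l / 2)]. Different letters may share a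
    weight, as the unit and the real coordinate of an even sphere do. *)
Definition letter_alg (f : L -> E -> C) : 'I_p -> 'I_p -> alg R m n :=
  fun i j w x => \sum_l (w == wt l)%:R * (Mx l i j * f l x).

(** Allowing a spinor endomorphism [Y l x] in place of a scalar covers both an algebra element and
    its commutator with the Dirac operator. *)
Definition letter_action (Y : L -> E -> 'M[C]_N) (Phi : msections R m n N p) :
    msections R m n N p := fun i k x =>
  \sum_l \sum_j (weyl_phase theta (wt l) (k - wt l) * Mx l i j) *:
     (Y l x *m Phi j (k - wt l) x).

Lemma mact_letter (f : L -> E -> C) Phi :
  mact theta (letter_alg f) Phi = letter_action (fun l x => (f l x)%:M) Phi.
Proof.
apply/funext => i; apply/funext => k; apply/funext => x; rewrite /mact /letter_action.
rewrite exchange_big; apply: eq_bigr => j _ /=; rewrite /letter_alg.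
rewrite (alg_act_finite (fun l y => Mx l i j * f l y)); apply: eq_bigr => l _.
by rewrite mul_scalar_mx scalerA -!mulrA.
Qed.

End AlgebraAction.

(** * Measurability on the sphere *)

Section SphereMeasurability.
Variables (R : realType) (m : nat).
Let E := 'rV[R]_m.+1.
Let BE := g_sigma_algebraType (@open E).
Let C := R[i].

Definition sphere_set : set BE := @sphere R m.

Lemma measurable_open (U : set E) : open U -> measurable (U : set BE).
Proof. by move=> oU; apply: sub_sigma_algebra. Qed.

Lemma measurable_sphere : measurable sphere_set.
Proof.
rewrite -[sphere_set]setCK; apply: measurableC; apply: measurable_open.
apply: closed_openC; apply: compact_closed; first exact: norm_hausdorff.
exact: compact_sphere.
Qed.

Lemma measurable_sphere_continuous (f : E -> R) :
  (forall x, punctured x -> {for x, continuous f}) -> measurable_fun sphere_set (f : BE -> R).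
Proof.
move=> cf; apply: (measurability _ (measurable_realfun.RGenOpens.measurableE R)).
move=> _ [_ [a [b ->] <-]].
have -> : sphere_set `&` (f : BE -> R) @^-1` `]a, b[ =
    sphere_set `&` ((@punctured R m) `&` f @^-1` `]a, b[).
  apply/seteqP; split=> x [sx fx]; split=> //; last by case: fx.
  by split=> //; exact: sphere_punctured.
apply: measurableI; first exact: measurable_sphere.
apply: measurable_open; rewrite openE => x [px fx]; apply: filterI.
  by apply: open_nbhs_nbhs; split=> //; exact: open_punctured.
apply: (cf x px); apply: open_nbhs_nbhs; split=> //; exact: interval_open.
Qed.

Lemma ssmooth_measurable (f : E -> R) : ssmooth f -> measurable_fun sphere_set (f : BE -> R).
Proof.
move=> sf; apply: (@eq_measurable_fun _ _ _ _ _ ((f \o sproj (m := m)) : BE -> R)).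
  by move=> x; rewrite inE => sx /=; rewrite sproj_sphere.
apply: measurable_sphere_continuous => x px; apply: differentiable_continuous.
exact: (sf [::]).
Qed.

Definition cmeasurable (f : BE -> C) : Prop :=
  measurable_fun sphere_set (fun x => complex.Re (f x)) /\
  measurable_fun sphere_set (fun x => complex.Im (f x)).

Lemma cmeasurable_cst c : cmeasurable (fun=> c).
Proof. by split; exact: measurable_cst. Qed.

Lemma cmeasurableD f g : cmeasurable f -> cmeasurable g -> cmeasurable (fun x => f x + g x).
Proof.
move=> [fr fi] [gr gi]; split.
  by under eq_fun do rewrite raddfD /=; exact: measurable_funD.
by under eq_fun do rewrite raddfD /=; exact: measurable_funD.
Qed.

Lemma cmeasurableM f g : cmeasurable f -> cmeasurable g -> cmeasurable (fun x => f x * g x).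
Proof.
move=> [fr fi] [gr gi]; split.
  rewrite (_ : (fun x => _) = fun x => complex.Re (f x) * complex.Re (g x) -
     (complex.Im (f x) * complex.Im (g x))); last first.
    by apply/funext => x; case: (f x) (g x) => [a b] [c d].
  by apply: measurable_funB; exact: measurable_funM.
rewrite (_ : (fun x => _) = fun x => complex.Re (f x) * complex.Im (g x) +
     complex.Im (f x) * complex.Re (g x)); last first.
  by apply/funext => x; case: (f x) (g x) => [a b] [c d].
by apply: measurable_funD; exact: measurable_funM.
Qed.

Lemma cmeasurable_sum (I : Type) (s : seq I) (F : I -> BE -> C) :
  (forall i, cmeasurable (F i)) -> cmeasurable (fun x => \sum_(i <- s) F i x).
Proof.
move=> mF; elim: s => [|i s IH].
  by under eq_fun do rewrite big_nil; exact: cmeasurable_cst.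
by under eq_fun do rewrite big_cons; exact: cmeasurableD.
Qed.

Lemma cmeasurable_normsq f : cmeasurable f ->
  measurable_fun sphere_set (fun x => normsq (f x)).
Proof.
by move=> [fr fi]; apply: measurable_funD; exact: measurable_funX.
Qed.

End SphereMeasurability.

Section Normsq.
Variable R : realType.
Let C := R[i].

Lemma normsq_ge0 (z : C) : 0 <= normsq z.
Proof. by rewrite addr_ge0 ?sqr_ge0. Qed.

Lemma normsqM (z w : C) : normsq (z * w) = normsq z * normsq w.
Proof. by case: z w => [a b] [c d]; rewrite /normsq /=; ring. Qed.

Lemma normsqD (z w : C) : normsq (z + w) <= 2 * normsq z + 2 * normsq w.
Proof.
case: z w => [a b] [c d]; rewrite /normsq /= -subr_ge0.
have -> : 2 * (a ^+ 2 + b ^+ 2) + 2 * (c ^+ 2 + d ^+ 2) - ((a + c) ^+ 2 + (b + d) ^+ 2) =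
  (a - c) ^+ 2 + (b - d) ^+ 2 by ring.
by rewrite addr_ge0 ?sqr_ge0.
Qed.

(** Each further summand doubles the constant; the bound is crude, but depends only on the number of
    terms. *)
Lemma normsq_sum (I : Type) (s : seq I) (z : I -> C) :
  normsq (\sum_(i <- s) z i) <= 2 ^+ size s * \sum_(i <- s) normsq (z i).
Proof.
elim: s => [|i s IH]; first by rewrite !big_nil /normsq /= expr0n addr0 mulr0.
rewrite !big_cons /= exprS mulrDr; apply: le_trans (normsqD _ _) _.
apply: lerD; last by rewrite -mulrA ler_pM2l.
rewrite ler_wpM2r ?normsq_ge0 // ler_peMr //.
by rewrite exprn_ege1 // ler1n.
Qed.

End Normsq.

Lemma ge0_sume_const (R : realType) (I : Type) (s : seq I) (X : \bar R) : (0 <= X)%E ->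
  (\sum_(i <- s) X = (size s)%:R%:E * X)%E.
Proof.
move=> X0; elim: s => [|i s IH]; first by rewrite big_nil mul0e.
by rewrite big_cons IH -{1}[X]mul1e -ge0_muleDl // -EFinD -natr1 addrC.
Qed.

Lemma esum_le_scale (R : realType) (T : choiceType) (K : R) (a : T -> \bar R) : 0 <= K ->
  (forall t, 0 <= a t)%E ->
  (\esum_(t in [set: T]) (K%:E * a t) <= K%:E * \esum_(t in [set: T]) a t)%E.
Proof.
move=> K0 a0; rewrite [X in (X <= _)%E]/esum; apply: ge_ereal_sup => _ [F FT <-].
have [finF _] := FT; rewrite -ge0_mule_fsumr //; apply: lee_wpmul2l; first by rewrite lee_fin.
apply: esum_ge; exists F => //.
Qed.

(** * Letter actions are bounded and preserve the Hilbert space *)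

Section LetterAction.
Variables (R : realType) (m n N : nat) (theta : 'M[R]_n).
Let E := 'rV[R]_m.+1.
Let BE := g_sigma_algebraType (@open E).
Let C := R[i].
Let weight := 'rV[int]_n.
Variables (mu : {measure set BE -> \bar R}) (V : 'rV[R]_n -> E -> 'M[C]_N).
Variables (L : finType) (wt : L -> weight) (p : nat) (Mx : L -> 'M[C]_p).
Variable Y : L -> E -> 'M[C]_N.
Hypothesis sY : forall l, smxsmooth (Y l).
Hypothesis wt_base : forall l, base_weight (wt l).
Hypothesis Y_equiv : forall s l x, sphere x ->
  weight_char (wt l) s *: (V s x *m Y l (Defs.rot s x)) = Y l x *m V s x.

Let T := letter_action theta wt Mx Y.
Let coef i j l k : C := weyl_phase theta (wt l) (k - wt l) * Mx l i j.

Lemma letter_action_entry (Phi : msections R m n N p) i k x a :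
  T Phi i k x a 0 = \sum_(t : L * 'I_p * 'I_N)
    coef i t.1.2 t.1.1 k * (Y t.1.1 x a t.2 * Phi t.1.2 (k - wt t.1.1) x t.2 0).
Proof.
rewrite -(pair_bigA _ (fun t b => coef i t.2 t.1 k *
   (Y t.1 x a b * Phi t.2 (k - wt t.1) x b 0))) /=.
rewrite -(pair_bigA _ (fun l j => \sum_b coef i j l k *
   (Y l x a b * Phi j (k - wt l) x b 0))) /=.
rewrite summxE; apply: eq_bigr => l _; rewrite summxE; apply: eq_bigr => j _.
by rewrite mxE mxE mulr_sumr.
Qed.

Lemma letter_cmeasurable l a b : cmeasurable (fun x : BE => Y l x a b).
Proof.
have [sr si] := sY l a b; split.
  exact: (@ssmooth_measurable R m (fun x => complex.Re (Y l x a b)) sr).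
exact: (@ssmooth_measurable R m (fun x => complex.Im (Y l x a b)) si).
Qed.

Lemma letter_bounded : exists2 K, 0 <= K & forall l a b x, sphere x -> normsq (Y l x a b) <= K.
Proof.
have H t : exists K, forall x, sphere x -> normsq (Y t.1.1 x t.1.2 t.2) <= K.
  have [sr si] := sY t.1.1 t.1.2 t.2.
  have [K1 H1] := @ssmooth_bounded R m (fun x => complex.Re (Y t.1.1 x t.1.2 t.2)) sr.
  have [K2 H2] := @ssmooth_bounded R m (fun x => complex.Im (Y t.1.1 x t.1.2 t.2)) si.
  exists (K1 ^+ 2 + K2 ^+ 2) => x sx; apply: lerD.
    rewrite -[leLHS]ger0_norm ?sqr_ge0 // normrX ler_pXn2r ?nnegrE ?H1 //.
    exact: le_trans (H1 x sx).
  rewrite -[leLHS]ger0_norm ?sqr_ge0 // normrX ler_pXn2r ?nnegrE ?H2 //.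
  exact: le_trans (H2 x sx).
have [K HK] := choice H.
exists (\sum_(t : L * 'I_N * 'I_N) `|K t|); first exact: sumr_ge0.
move=> l a b x sx; apply: le_trans (HK (l, a, b) x sx) _.
rewrite (bigD1 (l, a, b)) //=; apply: le_trans (ler_norm _) _.
by rewrite lerDl sumr_ge0.
Qed.

Lemma weyl_phase_normsq w k : normsq (weyl_phase theta w k) = 1.
Proof. by rewrite weyl_phaseE /normsq /= cos2Dsin2. Qed.

Definition section_density (psi : sections R m n N) k (x : BE) : \bar R :=
  (\sum_(j < N) normsq (psi k x j ord0))%:E.

Lemma section_density_ge0 psi k x : (0 <= section_density psi k x)%E.
Proof. by rewrite lee_fin sumr_ge0 // => j _; exact: normsq_ge0. Qed.

Lemma section_density_measurable (psi : sections R m n N) k :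
  (forall j, cmeasurable (fun x : BE => psi k x j 0)) ->
  measurable_fun (@sphere_set R m) (section_density psi k).
Proof.
move=> H; apply/measurable_EFinP; apply: measurable_sum => j.
exact: (cmeasurable_normsq (H j)).
Qed.

Lemma in_H_cmeasurable (psi : sections R m n N) k j :
  in_H mu V psi -> cmeasurable (fun x : BE => psi k x j 0).
Proof. by case=> H _ _ _; case: (H k j). Qed.

Lemma letter_action_cmeasurable Phi i k a : in_MH mu V Phi ->
  cmeasurable (fun x : BE => T Phi i k x a 0).
Proof.
move=> H; under eq_fun do rewrite letter_action_entry.
apply: cmeasurable_sum => t; apply: cmeasurableM; first exact: cmeasurable_cst.
apply: cmeasurableM; first exact: letter_cmeasurable.
exact: in_H_cmeasurable.
Qed.

(** Weyl phases have modulus 1 and the coefficients are bounded on the compact sphere, so the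
    constant is uniform in the weight and in the point. *)
Lemma letter_action_density : exists2 K, 0 <= K & forall Phi i k x, sphere x ->
  (section_density (T Phi i) k x <=
   K%:E * \sum_(t : L * 'I_p) section_density (Phi t.2) (k - wt t.1) x)%E.
Proof.
have [K1 K10 HK1] := letter_bounded.
pose K2 := \sum_(t : L * 'I_p * 'I_p) normsq (Mx t.1.1 t.1.2 t.2).
have HK2 i j l : normsq (Mx l i j) <= K2.
  rewrite /K2 (bigD1 (l, i, j)) //= lerDl sumr_ge0 // => t _; exact: normsq_ge0.
have K20 : 0 <= K2 by apply: sumr_ge0 => t _; exact: normsq_ge0.
pose c := (2 ^+ size (index_enum (L * 'I_p * 'I_N)%type) : R).
have c0 : 0 <= c by rewrite exprn_ge0.
exists (N%:R * (c * (K2 * K1))).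
  by rewrite !mulr_ge0.
move=> Phi i k x sx; rewrite /section_density sumEFin -EFinM lee_fin.
rewrite -mulrA mulr_natl; apply: (@le_trans _ _ (\sum_(a < N) (c * (K2 * K1) *
    \sum_(t : L * 'I_p) \sum_(b < N) normsq (Phi t.2 (k - wt t.1) x b ord0)))); last first.
  by rewrite sumr_const card_ord.
apply: ler_sum => a _; rewrite letter_action_entry.
apply: le_trans (normsq_sum _ _) _; rewrite -/c -mulrA ler_wpM2l //.
rewrite mulr_sumr -(pair_bigA _ (fun t b => normsq (coef i t.2 t.1 k *
   (Y t.1 x a b * Phi t.2 (k - wt t.1) x b 0)))) /=.
apply: ler_sum => t _; rewrite mulr_sumr; apply: ler_sum => b _.
rewrite !normsqM weyl_phase_normsq mul1r mulrA ler_wpM2r ?normsq_ge0 //.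
by apply: ler_pM; rewrite ?normsq_ge0 ?HK1 ?HK2.
Qed.

Lemma norm2_ge0 (psi : sections R m n N) : (0 <= norm2 mu psi)%E.
Proof.
apply: esum_ge0 => k _; apply: integral_ge0 => x _; exact: section_density_ge0.
Qed.

(** A shift is a bijection of the weights, so a letter does not change the sum of the squared norms
    over all weights. *)
Lemma norm2_shift (psi : sections R m n N) (w : weight) :
  (\esum_(k in [set: weight]) \int[mu]_(x in @sphere_set R m) section_density psi (k - w) x
   = norm2 mu psi)%E.
Proof.
apply/esym/(@reindex_esum _ _ _ [set: weight] [set: weight] (fun k => k - w)
  (fun k => \int[mu]_(x in @sphere_set R m) section_density psi k x)%E).
split=> [k _ //|k k' _ _ /addIr //|k _].
by exists (k + w) => //; rewrite addrK.
Qed.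

Lemma letter_action_norm2 : exists2 K, 0 <= K & forall Phi i, in_MH mu V Phi ->
  (norm2 mu (T Phi i) <= K%:E * \sum_(t : L * 'I_p) norm2 mu (Phi t.2))%E.
Proof.
have [K K0 HK] := letter_action_density; exists K => // Phi i hPhi.
pose J psi k := (\int[mu]_(x in @sphere_set R m) section_density psi k x)%E.
have J0 psi k : (0 <= J psi k)%E.
  by apply: integral_ge0 => x _; exact: section_density_ge0.
have JT k : (J (T Phi i) k <= K%:E * \sum_(t : L * 'I_p) J (Phi t.2) (k - wt t.1)%R)%E.
  have md j k' : measurable_fun (@sphere_set R m) (section_density (Phi j) k').
    by apply: section_density_measurable => b; exact: in_H_cmeasurable.
  rewrite /J -ge0_integral_sum //; last 2 first.
  - exact: measurable_sphere.
  - by move=> t x _; exact: section_density_ge0.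
  rewrite -ge0_integralZl_EFin //; last 3 first.
  - exact: measurable_sphere.
  - by move=> x _; apply: sume_ge0 => t _; exact: section_density_ge0.
  - by apply: emeasurable_sum => t; exact: md.
  apply: ge0_le_integral; first exact: measurable_sphere.
  - by move=> x _; exact: section_density_ge0.
  - by apply: section_density_measurable => b; exact: letter_action_cmeasurable.
  - apply: measurable_funeM; apply: emeasurable_sum => t; exact: md.
  - by move=> x sx; exact: HK.
rewrite {1}/norm2; apply: (@le_trans _ _ (\esum_(k in [set: weight])
   (K%:E * \sum_(t : L * 'I_p) J (Phi t.2) (k - wt t.1)%R))%E).
  by apply: le_esum => k _; exact: JT.
apply: le_trans (esum_le_scale K0 _) _.
  by move=> k; apply: sume_ge0 => t _; exact: J0.
rewrite esum_sum; last by move=> k t _ _; exact: J0.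
by apply: lee_wpmul2l; [rewrite lee_fin|apply: lee_sum => t _; rewrite norm2_shift].
Qed.

Lemma cover_weight_sub k l : cover_weight (k - wt l) -> cover_weight k.
Proof.
move=> ck a b; have := ck a b; have := wt_base l a; have := wt_base l b.
rewrite !mxE; move: (wt l 0 a) (wt l 0 b) (k 0 a) (k 0 b) => x y z t hy hx h.
have -> : z - t = (z - x - (t - y)) + (x - y) by ring.
by rewrite rpredD // rpredB.
Qed.

Lemma weight_charD (k l : weight) (s : 'rV[R]_n) : weight_char (k + l) s = weight_char k s * weight_char l s.
Proof.
rewrite /weight_char -cisD -mulrDr -big_split; congr (cis (_ * _)).
by apply: eq_bigr => nu _; rewrite mxE intrD mulrDl.
Qed.

(** The shift by [wt l] changes the character of a component, and [Y_equiv] says that the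
    coefficient compensates it. Even shifts preserve the parity condition on the weights of the
    cover. *)
Lemma letter_action_in_H Phi i : in_MH mu V Phi -> in_H mu V (T Phi i).
Proof.
move=> hPhi; split.
- by move=> k j; exact: letter_action_cmeasurable.
- have [K K0 HK] := letter_action_norm2; apply: le_lt_trans (HK Phi i hPhi) _.
  rewrite lte_mul_pinfty ?lee_fin //; apply: lte_sum_pinfty => t _.
  by case: (hPhi t.2).
- move=> k ck.
  (* There are finitely many pairs of a letter and a matrix index, so the almost everywhere
     statements can be combined. *)
  have H (t : L * 'I_p) : {ae mu, forall x, sphere x -> Phi t.2 (k - wt t.1) x = 0}.
    have [_ _ h _] := hPhi t.2; apply: h; apply: contra_not ck; exact: cover_weight_sub.
  have := filter_forall (ae_filter_ringOfSetsType mu) H.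
  apply: filterS => x Hx sx; rewrite /T /letter_action big1 // => l _.
  by rewrite big1 // => j _; rewrite (Hx (l, j)) // mulmx0 scaler0.
- move=> s k.
  have H (t : L * 'I_p) : {ae mu, forall x, sphere x ->
      weight_char (k - wt t.1) s *: lift_act V s (Phi t.2 (k - wt t.1)) x =
      Phi t.2 (k - wt t.1) x}.
    by have [_ _ _ h] := hPhi t.2; exact: h.
  have := filter_forall (ae_filter_ringOfSetsType mu) H.
  apply: filterS => x Hx sx; rewrite /T /letter_action /lift_act.
  rewrite mulmx_sumr scaler_sumr; apply: eq_bigr => l _.
  rewrite mulmx_sumr scaler_sumr; apply: eq_bigr => j _.
  rewrite -[in RHS](Hx (l, j) sx) /lift_act /=.
  have wk : weight_char k s = weight_char (k - wt l) s * weight_char (wt l) s.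
    by rewrite -weight_charD subrK.
  rewrite wk -!scalemxAr !scalerA [in RHS]mulmxA -Y_equiv // -scalemxAl scalerA -mulmxA.
  congr (_ *: _); rewrite mulrC !mulrA; congr (_ * _).
Qed.

End LetterAction.

Lemma size_index_enum (T : finType) : size (index_enum T) = #|T|.
Proof. by rewrite cardT enumT /index_enum; case: index_enum_key. Qed.

Section LetterActionBounded.
Variables (R : realType) (m n N : nat) (theta : 'M[R]_n).
Let E := 'rV[R]_m.+1.
Let BE := g_sigma_algebraType (@open E).
Let C := R[i].
Let weight := 'rV[int]_n.
Variables (mu : {measure set BE -> \bar R}) (V : 'rV[R]_n -> E -> 'M[C]_N).
Variables (L : finType) (wt : L -> weight) (p : nat) (Mx : L -> 'M[C]_p).
Variable Y : L -> E -> 'M[C]_N.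
Hypothesis sY : forall l, smxsmooth (Y l).
Hypothesis wt_base : forall l, base_weight (wt l).
Hypothesis Y_equiv : forall s l x, sphere x ->
  weight_char (wt l) s *: (V s x *m Y l (Defs.rot s x)) = Y l x *m V s x.

Lemma letter_action_bounded : bounded_op mu V (letter_action theta wt Mx Y).
Proof.
split=> [Phi hPhi i|a Phi Psi _ _ i k|].
- exact: letter_action_in_H.
- apply: aeW => x _; rewrite /letter_action scaler_sumr -big_split.
  apply: eq_bigr => l _ /=; rewrite scaler_sumr -big_split; apply: eq_bigr => j _ /=.
  by rewrite mulmxDr scalerDr -scalemxAr !scalerA mulrC.
- have [K K0 HK] := letter_action_norm2 theta mu V wt Mx sY.
  exists (p%:R * (K * #|L|%:R)) => Phi hPhi.
  have n0 j : (0 <= norm2 mu (Phi j))%E by exact: norm2_ge0.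
  have SE : (\sum_(t : L * 'I_p) norm2 mu (Phi t.2) = #|L|%:R%:E * mnorm2 mu Phi)%E.
    rewrite -(pair_bigA _ (fun (l : L) j => norm2 mu (Phi j))) /=.
    rewrite (ge0_sume_const (index_enum L) (X := mnorm2 mu Phi)); last first.
      by apply: sume_ge0 => j _.
    by rewrite size_index_enum.
  rewrite /mnorm2; apply: (@le_trans _ _ (\sum_(i < p) (K%:E * (#|L|%:R%:E * mnorm2 mu Phi)))%E).
    by apply: lee_sum => i _; rewrite -SE; exact: HK.
  have X0 : (0 <= K%:E * (#|L|%:R%:E * mnorm2 mu Phi))%E.
    rewrite !mule_ge0 ?lee_fin //; by apply: sume_ge0 => j _.
  rewrite ge0_sume_const //.
  by rewrite size_index_enum card_ord EFinM EFinM !muleA.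
Qed.

End LetterActionBounded.

(** * Commutators with affine functions of the coordinates *)

Section AffineLetters.
Variables (R : realType) (m n : nat) (theta : 'M[R]_n).
Let E := 'rV[R]_m.+1.
Let BE := g_sigma_algebraType (@open E).
Let C := R[i].
Let N := (2 ^ m./2)%N.
Let weight := 'rV[int]_n.
Variables (L : finType) (wt : L -> weight) (p : nat) (Mx : L -> 'M[C]_p).
Variables (al0 : L -> C) (al : L -> 'I_m.+1 -> C).
Hypothesis wt_base : forall l, base_weight (wt l).
Hypothesis al0_equiv : forall s l, weight_char (wt l) s * al0 l = al0 l.
Hypothesis al_equiv : forall s l i,
  weight_char (wt l) s * (\sum_j al l j * (Defs.rot s (delta_mx 0 i : E) 0 j)%:C%C) = al l i.

Definition affine (l : L) (x : E) : C := al0 l + \sum_j al l j * (x 0 j)%:C%C.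

Lemma affine_rot s l x : weight_char (wt l) s * affine l (Defs.rot s x) = affine l x.
Proof.
rewrite /affine mulrDr al0_equiv; congr (_ + _).
under [RHS]eq_bigr do rewrite -(al_equiv s) -mulrA mulr_suml.
rewrite -mulr_sumr exchange_big /=; congr (_ * _); apply: eq_bigr => j _.
rewrite rot_expansion rmorph_sum mulr_sumr; apply: eq_bigr => i _.
by rewrite rmorphM mulrA.
Qed.

Lemma affine_smooth l : csmooth_on (@punctured R m) (affine l \o sproj (m := m)).
Proof.
apply: csmoothD; [exact: open_punctured|exact: csmooth_cst|].
apply: csmooth_sum => [|j]; first exact: open_punctured.
apply: csmoothZ; first exact: open_punctured.
exact/csmooth_real/ssmooth_coord.
Qed.

Let a := letter_alg wt Mx affine.

Lemma letter_alg_smooth i j k : csmooth_on (@punctured R m) (a i j k \o sproj (m := m)).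
Proof.
apply: csmooth_sum => [|l]; first exact: open_punctured.
by do 2 (apply: csmoothZ; first exact: open_punctured); exact: affine_smooth.
Qed.

Lemma iter_derive_zero (vs : seq E) x : iter_derive vs (fun _ : E => 0 : R) x = 0.
Proof.
elim: vs x => [|v vs IH] x //=.
by rewrite (_ : iter_derive vs _ = cst 0) ?derive_cst //; apply/funext.
Qed.

(** Only finitely many weights carry a nonzero coefficient, so rapid decay reduces to finitely many
    bounds on the compact sphere. *)
Lemma letter_alg_Cinf i j : Cinf_theta (a i j).
Proof.
split=> [|k x nb _|k s x sx].
- have aM k : (fun x => (a i j k x)%:M : 'cV[C]_1) = fun x => const_mx (a i j k x).
    by apply/funext => x; apply/matrixP => b b'; rewrite (ord1 b) (ord1 b') !mxE eqxx.
  have sa k : smxsmooth (fun x => (a i j k x)%:M : 'cV[C]_1).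
    move=> b b'; rewrite aM.
    rewrite (_ : (fun x => _) = a i j k \o sproj (m := m)); first exact: letter_alg_smooth.
    by apply/funext => x; rewrite /= mxE.
  split=> // vs d b.
  have bd k : exists K, forall x, sphere x ->
      `|iter_derive vs (fun y => complex.Re (((a i j k (sproj y))%:M : 'cV[C]_1) b 0)) x|
         * weight_size R k ^+ d <= K /\
      `|iter_derive vs (fun y => complex.Im (((a i j k (sproj y))%:M : 'cV[C]_1) b 0)) x|
         * weight_size R k ^+ d <= K.
    have w0 : 0 <= weight_size R k ^+ d.
      by rewrite exprn_ge0 // addr_ge0 // sumr_ge0 // => nu _; rewrite ler0z.
    have [sr si] := sa k b 0.
    have [K1 H1] := smooth_bounded_on_sphere vs sr.
    have [K2 H2] := smooth_bounded_on_sphere vs si.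
    exists (Num.max K1 K2 * weight_size R k ^+ d) => x sx; split; apply: ler_wpM2r => //.
      by apply: le_trans (H1 x sx) _; rewrite le_max lexx.
    by apply: le_trans (H2 x sx) _; rewrite le_max lexx orbT.
  have [K HK] := choice bd; exists (\sum_l `|K (wt l)|) => k x sx.
  have [/existsP[l /eqP ->]|/existsPn nk] := boolP [exists l, k == wt l].
    have [h1 h2] := HK (wt l) x sx.
    have le : K (wt l) <= \sum_l `|K (wt l)|.
      rewrite (bigD1 l) //=; apply: le_trans (ler_norm _) _.
      by rewrite lerDl sumr_ge0.
    by split; [exact: le_trans h1 le|exact: le_trans h2 le].
  have a0 y : a i j k y = 0.
    by rewrite /a /letter_alg big1 // => l _; rewrite (negPf (nk l)) mul0r.
  have Z : 0 <= \sum_l `|K (wt l)| by exact: sumr_ge0.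
  under [fun y => complex.Re _]eq_fun do rewrite a0 mxE mul0rn /=.
  under [fun y => complex.Im _]eq_fun do rewrite a0 mxE mul0rn /=.
  by rewrite iter_derive_zero normr0 mul0r.
- rewrite /a /letter_alg big1 // => l _; have [kl|_] := eqVneq k (wt l); last by rewrite mul0r.
  by case: nb; rewrite kl.
- rewrite /a /letter_alg mulr_sumr; apply: eq_bigr => l _.
  have [->|_] := eqVneq k (wt l); last by rewrite !mul0r mulr0.
  by rewrite !mul1r mulrCA affine_rot.
Qed.

Hypothesis mn : m = n.*2 \/ m.+1 = n.*2.
Variable g : E -> E -> E -> R.
Hypothesis gR : riemannian g.
Variable c : E -> E -> 'M[C]_N.
Hypothesis cP : clifford_mult g c.
Variables (A : E -> E -> 'M[C]_N) (D : (E -> 'cV[C]_N) -> (E -> 'cV[C]_N)).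
Hypothesis DP : dirac_operator g c A D.
Variable V : 'rV[R]_n -> E -> 'M[C]_N.
Hypothesis VP : torus_lift D V.
Variable mu : {measure set BE -> \bar R}.

(* The matrix of Clifford multiplication giving [[D, affine l]]. *)
Definition affine_grad (l : L) (x : E) : 'M[C]_N :=
  - 'i%C *: \sum_j al l j *: cgrad g c j x.

Lemma affine_grad_smooth l : smxsmooth (affine_grad l).
Proof.
apply: smxsmoothZ; apply: smxsmooth_sum => j; apply: smxsmoothZ; exact: cgrad_smooth.
Qed.

(** The rotation matrix that [cgrad_equivariant] puts on the gradients is transferred to the
    coefficients, where [al_equiv] absorbs it together with the character. *)
Lemma affine_grad_equiv s l x : sphere x ->
  weight_char (wt l) s *: (V s x *m affine_grad l (Defs.rot s x)) = affine_grad l x *m V s x.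
Proof.
move=> sx; rewrite /affine_grad -scalemxAr -scalemxAl scalerA mulrC -scalerA; congr (_ *: _).
rewrite mulmx_suml mulmx_sumr scaler_sumr.
under eq_bigr do rewrite -scalemxAr -(cgrad_equivariant mn gR cP DP VP) // scaler_sumr scaler_sumr.
rewrite exchange_big; apply: eq_bigr => i _ /=.
rewrite -scalemxAl -[in RHS](al_equiv s) mulr_sumr scaler_suml.
by apply: eq_bigr => j _; rewrite !scalerA mulrA.
Qed.

Lemma dirac_affine l (psi : E -> 'cV[C]_N) x : smxsmooth psi -> sphere x ->
  smxsmooth (fun y => affine l y *: psi y) /\
  D (fun y => affine l y *: psi y) x = affine l x *: D psi x + affine_grad l x *m psi x.
Proof.
(* [None] carries the constant term and [Some j] the coordinate [j], so that linearity of [D] is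
   applied once to the whole affine function. *)
move=> sp sx; pose F (o : option 'I_m.+1) : E -> 'cV[C]_N :=
  if o is Some j then fun y => (y 0 j)%:C%C *: psi y else psi.
pose b o := if o is Some j then al l j else al0 l.
have sF o : smxsmooth (F o) by case: o => [j|] //; exact: smxsmooth_coordM.
pose s := None :: map Some (index_enum 'I_m.+1).
have -> : (fun y => affine l y *: psi y) = fun y => \sum_(o <- s) b o *: F o y.
  apply/funext => y; rewrite big_cons big_map /affine scalerDl; congr (_ + _).
  by rewrite scaler_suml; apply: eq_bigr => j _; rewrite scalerA.
split; first by apply: smxsmooth_sum => o; exact: smxsmoothZ.
rewrite (dirac_sum gR DP) // big_cons big_map /affine scalerDl -addrA; congr (_ + _).
under eq_bigr do rewrite (dirac_coordM gR cP DP) // scalerBr scalerA.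
rewrite sumrB -scaler_suml; congr (_ + _).
rewrite /affine_grad -scalemxAl scaleNr; congr (- _).
rewrite mulmx_suml scaler_sumr; apply: eq_bigr => j _.
by rewrite -scalemxAl !scalerA mulrC.
Qed.

(** Letter by letter the Leibniz rule cancels the terms in which [D] acts on the section. What is
    left contains no derivative of it, hence is bounded and is the required extension. *)
Lemma letter_dirac_comm :
  is_dirac_comm theta mu V D a (letter_action theta wt Mx affine_grad).
Proof.
split; first by apply: letter_action_bounded => //; [exact: affine_grad_smooth|exact: affine_grad_equiv].
move=> Phi sPhi i k; apply: aeW => x sx.
have sP j l : smxsmooth (Phi j l) by have [[]] := sPhi j.
rewrite /dirac_comm /dirac_theta mact_letter [in X in _ - X]mact_letter.
have -> : letter_action theta wt Mx (fun l y => (affine l y)%:M) Phi i k =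
  fun y => \sum_(t : L * 'I_p) (weyl_phase theta (wt t.1) (k - wt t.1) * Mx t.1 i t.2) *:
    (affine t.1 y *: Phi t.2 (k - wt t.1) y).
  apply/funext => y; rewrite -(pair_bigA _ (fun l j => (weyl_phase theta (wt l) (k - wt l) *
     Mx l i j) *: (affine l y *: Phi j (k - wt l) y))) /=.
  by apply: eq_bigr => l _; apply: eq_bigr => j _; rewrite mul_scalar_mx.
rewrite (dirac_sum gR DP) //; last by move=> t; have [] := dirac_affine t.1 (sP t.2 (k - wt t.1)) sx.
rewrite -(pair_bigA _ (fun l j => (weyl_phase theta (wt l) (k - wt l) * Mx l i j) *:
    D (fun y => affine l y *: Phi j (k - wt l) y) x)) /=.
rewrite /letter_action -sumrB; apply: eq_bigr => l _; rewrite -sumrB; apply: eq_bigr => j _.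
have [_ ->] := dirac_affine l (sP j (k - wt l)) sx.
by rewrite mul_scalar_mx scalerDr addrAC subrr add0r.
Qed.

End AffineLetters.

Lemma sum_option (U : nmodType) (T : finType) (F : option T -> U) :
  \sum_o F o = F None + \sum_t F (Some t).
Proof.
rewrite (bigD1 None) //=; congr (_ + _).
rewrite (reindex_omap Some id) => [|[t|]] //=.
by apply: eq_bigl => t; rewrite eqxx.
Qed.

(** * Complex coordinates as letters *)

Section CoordinateLetters.
Variables (R : realType) (m n : nat).
Let E := 'rV[R]_m.+1.
Let C := R[i].
Let N := (2 ^ m./2)%N.
Let weight := 'rV[int]_n.
Hypothesis mn : m = n.*2 \/ m.+1 = n.*2.

(* The letter (mu, true) stands for z^mu U^mu and (mu, false) for its adjoint. *)
Definition coord_letter (l : 'I_n * bool) (j : 'I_m.+1) : C :=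
  (j == inord l.1.*2)%:R + (-1) ^+ (~~ l.2) * 'i%C * (j == inord l.1.*2.+1)%:R.

Definition pair_weight (l : 'I_n * bool) : weight := letter_weight l.1 l.2.

Lemma coord_letter_sum l (v : 'I_m.+1 -> C) : \sum_j coord_letter l j * v j =
  v (inord l.1.*2) + (-1) ^+ (~~ l.2) * 'i%C * v (inord l.1.*2.+1).
Proof.
have D (k : 'I_m.+1) : \sum_j (j == k)%:R * v j = v k.
  rewrite (bigD1 k) //= eqxx mul1r big1 ?addr0 // => j /negPf ->.
  by rewrite mul0r.
transitivity (\sum_j ((j == inord l.1.*2)%:R * v j +
    (-1) ^+ (~~ l.2) * 'i%C * ((j == inord l.1.*2.+1)%:R * v j))).
  by apply: eq_bigr => j _; rewrite mulrDl !mulrA.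
by rewrite big_split /= -mulr_sumr !D.
Qed.

Lemma coord_letter_zcoord l (x : E) : \sum_j coord_letter l j * (x 0 j)%:C%C =
  if l.2 then zcoord l.1 x else (zcoord l.1 x)^*.
Proof.
rewrite coord_letter_sum /zcoord; case: l.2; rewrite /= ?mul1r ?mulN1r.
  by apply/eqP; rewrite eq_complex /=; apply/andP; split; apply/eqP; ring.
by apply/eqP; rewrite eq_complex /=; apply/andP; split; apply/eqP; ring.
Qed.

Lemma pair_weight_base l : base_weight (pair_weight l).
Proof.
move=> nu; rewrite !mxE dvdz_mulr //; by case: l.2.
Qed.

Lemma pair_weight_char l (s : 'rV[R]_n) : weight_char (pair_weight l) s =
  cis ((-1) ^+ l.2 * (2 * pi * s 0 l.1)).
Proof.
rewrite /weight_char; congr cis; rewrite (bigD1 l.1) //= big1 ?addr0 => [|nu /negPf ne].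
  by rewrite !mxE !eqxx /= mulr1; case: l.2; rewrite /= ?expr0 ?expr1 ?rmorphN /=; ring.
by rewrite !mxE ne andbF mulr0 mul0r.
Qed.

(** The rotation multiplies [z^mu] by the phase of the angle [2 pi s_mu] and its conjugate by the
    inverse; the character of the attached weight is the opposite phase in each case. *)
Lemma coord_letter_equiv s l i : weight_char (pair_weight l) s *
  (\sum_j coord_letter l j * (Defs.rot s (delta_mx 0 i : E) 0 j)%:C%C) = coord_letter l i.
Proof.
rewrite coord_letter_zcoord zcoord_rot // pair_weight_char.
set t := 2 * pi * _; have H : cis (- t) * cis t = 1 by rewrite -cisD addNr cis0.
have -> : (-1) ^+ l.2 * t = if l.2 then - t else t.
  by case: l.2; rewrite ?expr1 ?mulN1r ?mul1r.
have F : coord_letter l i = if l.2 then zcoord l.1 (delta_mx 0 i : E) else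
    (zcoord l.1 (delta_mx 0 i : E))^*.
  rewrite -coord_letter_zcoord (bigD1 i) //= big1 => [|j /negPf ji].
    by rewrite mxE !eqxx mulr1 addr0.
  by rewrite mxE ji andbF mulr0.
rewrite F; case: l.2; first by rewrite mulrA H mul1r.
by rewrite rmorphM /= -cisN mulrA [cis t * _]mulrC H mul1r.
Qed.

End CoordinateLetters.

(** * Operators at a point of the sphere *)

Section Packing.
Variables (R : realType) (m n p N : nat) (theta : 'M[R]_n).
Let E := 'rV[R]_m.+1.
Let C := R[i].
Let weight := 'rV[int]_n.
Let V := (weight -> 'M[C]_(p, N)).

(** The value of a letter action at [x] depends on the sections at [x] only. Freezing the point
    turns it into an element of the ring [lin_end], with spinors stored as rows. *)
Definition pack (Phi : msections R m n N p) (x : E) : V :=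
  fun k => \matrix_(i, j) Phi i k x j 0.

Lemma pack_letter_action (L : finType) (wt : L -> weight) (Mx : L -> 'M[C]_p)
    (Y : L -> E -> 'M[C]_N) (Phi : msections R m n N p) x :
  pack (letter_action theta wt Mx Y Phi) x =
  (\sum_l tw_op N theta (Mx l) (wt l) * right_op n p (Y l x)) (pack Phi x).
Proof.
apply/funext => k; rewrite lin_sumE fct_sumE; apply/matrixP => i j.
rewrite mxE summxE summxE; apply: eq_bigr => l _; rewrite lin_mulE /= /twisted.
rewrite summxE !mxE mulr_sumr; apply: eq_bigr => j' _.
rewrite !mxE -mulrA; congr (_ * (_ * _)); apply: eq_bigr => b _.
by rewrite !mxE mulrC.
Qed.

Lemma right_opZ (a : C) (Y : 'M[C]_N) :
  right_op n p (a *: Y) = lin_scalar V a * right_op n p Y.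
Proof.
apply: lin_end_ext => Phi; apply/funext => k.
by rewrite lin_mulE /= fctE linearZ /= -scalemxAr.
Qed.

Lemma right_op_sum (I : finType) (Y : I -> 'M[C]_N) :
  right_op n p (\sum_i Y i) = \sum_i right_op n p (Y i).
Proof.
apply: lin_end_ext => Phi; apply/funext => k.
rewrite lin_sumE fct_sumE /= linear_sum mulmx_sumr.
by [].
Qed.

Lemma commutant_proj_pack (T : msections R m n N p -> msections R m n N p)
    (X : lin_end V) x :
  (forall Phi, pack (T Phi) x = X (pack Phi x)) ->
  forall psi k j, commutant_proj T psi k x j 0 =
    partial_trace (fun l => (psi l x)^T) k j X.
Proof.
move=> TX psi k j; rewrite /commutant_proj /partial_trace mxE summxE; congr (_ * _).
apply: eq_bigr => i _.
have -> : (fun l : weight => delta_mx i 0 *m (psi l x)^T) =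
    pack (fun j l y => if j == i then psi l y else 0) x.
  apply/funext => l; apply/matrixP => a b; rewrite !mxE big_ord1 !mxE eqxx andbT.
  by case: eqP => _; rewrite ?mul1r // mul0r mxE.
by rewrite -TX mxE.
Qed.

End Packing.

(** * From complex letters to real generators *)

Section LettersAndGenerators.
Variables (R : realType) (m n p N : nat) (theta : 'M[R]_n).
Hypothesis asym : antisymmetric_mx theta.
Let E := 'rV[R]_m.+1.
Let C := R[i].
Let weight := 'rV[int]_n.
Let V := (weight -> 'M[C]_(p, N)).
Variable Gam : 'I_n -> 'M[C]_p.
Let sc : {rmorphism C -> lin_end V} := lin_scalar V.

Lemma sum_ord_even (U : nmodType) (F : nat -> U) : m = n.*2 ->
  \sum_(j < m.+1) F j = \sum_(nu < n) (F nu.*2 + F nu.*2.+1) + F n.*2.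
Proof. by move=> ->; rewrite big_ord_recr /= sum_ord_double. Qed.

Lemma sum_ord_odd (U : nmodType) (F : nat -> U) : m.+1 = n.*2 ->
  \sum_(j < m.+1) F j = \sum_(nu < n) (F nu.*2 + F nu.*2.+1).
Proof. by move=> ->; rewrite sum_ord_double. Qed.

Definition pair_op (l : 'I_n * bool) : lin_end V := letter_op N theta Gam l.1 l.2.

(** Two real coordinates on the pair of generators equal [v + i v'] on one letter and [v - i v'] on
    the other. *)
Lemma pair_op_sum (v : 'I_m.+1 -> C) (nu : 'I_n) :
  sc (v (inord nu.*2)) * gen N theta Gam nu.*2 +
  sc (v (inord nu.*2.+1)) * gen N theta Gam nu.*2.+1 =
  \sum_b sc (\sum_j coord_letter R (nu, b) j * v j) * pair_op (nu, b).
Proof.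
rewrite big_bool !coord_letter_sum /gen generator_double generator_doubleS /= expr0 expr1.
rewrite mul1r mulN1r !rmorphD /= !mulrDl mulrDr.
rewrite [X in _ + X = _]mulrA -(rmorphM sc) /= mulrBr [v _ * 'i%C]mulrC addrACA.
by rewrite mulNr rmorphN mulNr.
Qed.

Lemma gens_letters_odd (v : 'I_m.+1 -> C) : m.+1 = n.*2 ->
  \sum_j sc (v j) * gen N theta Gam j =
  \sum_l sc (\sum_j coord_letter R l j * v j) * pair_op l.
Proof.
move=> mE; transitivity (\sum_(j < m.+1) (fun j => sc (v (inord j)) * gen N theta Gam j) j).
  by apply: eq_bigr => j _; rewrite inord_val.
rewrite (sum_ord_odd (fun j => sc (v (inord j)) * gen N theta Gam j) mE) -(pair_bigA _ (fun nu b =>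
   sc (\sum_j coord_letter R (nu, b) j * v j) * pair_op (nu, b))) /=.
by apply: eq_bigr => nu _; rewrite pair_op_sum.
Qed.

Lemma gens_letters_even (v : 'I_m.+1 -> C) : m = n.*2 ->
  \sum_j sc (v j) * gen N theta Gam j =
  \sum_l sc (\sum_j coord_letter R l j * v j) * pair_op l +
  sc (v ord_max) * chiral (letter_op N theta Gam).
Proof.
move=> mE; transitivity (\sum_(j < m.+1) (fun j => sc (v (inord j)) * gen N theta Gam j) j).
  by apply: eq_bigr => j _; rewrite inord_val.
rewrite (sum_ord_even (fun j => sc (v (inord j)) * gen N theta Gam j) mE) -(pair_bigA _ (fun nu b =>
   sc (\sum_j coord_letter R (nu, b) j * v j) * pair_op (nu, b))) /=.
congr (_ + _); first by apply: eq_bigr => nu _; rewrite pair_op_sum.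
congr (sc (v _) * _); last by rewrite /gen generator_top.
by apply: val_inj; rewrite /= inordK mE.
Qed.

End LettersAndGenerators.

Section GradientLetters.
Variables (R : realType) (m n p : nat) (theta : 'M[R]_n).
Let E := 'rV[R]_m.+1.
Let C := R[i].
Let N := (2 ^ m./2)%N.
Let weight := 'rV[int]_n.
Let V := (weight -> 'M[C]_(p, N)).
Let sc : {rmorphism C -> lin_end V} := lin_scalar V.
Variable g : E -> E -> E -> R.
Hypothesis gR : riemannian g.
Variable c : E -> E -> 'M[C]_N.
Hypothesis cP : clifford_mult g c.
Variables (L : finType) (wt : L -> weight) (Mx : L -> 'M[C]_p) (al : L -> 'I_m.+1 -> C).

Lemma affine_grad_frame l x vs : sphere x -> orthonormal_frame g x vs ->
  affine_grad al g c l x =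
  - 'i%C *: \sum_a (\sum_j al l j * (vs a j)%:C%C) *: c x (row a vs).
Proof.
move=> sx fr; congr (_ *: _).
under eq_bigr do rewrite (cgrad_frame gR cP _ sx fr) scaler_sumr.
rewrite exchange_big; apply: eq_bigr => a _ /=; rewrite scaler_suml.
by apply: eq_bigr => j _; rewrite scalerA.
Qed.

(** Expanding every gradient in the frame and exchanging the sums collects, for each frame vector,
    the linear part of the letters evaluated on that vector. *)
Lemma gradient_letters x vs : sphere x -> orthonormal_frame g x vs ->
  \sum_l tw_op N theta (Mx l) (wt l) * right_op n p (affine_grad al g c l x) =
  sc (- 'i%C) * \sum_a (\sum_l sc (\sum_j al l j * (vs a j)%:C%C) *
      tw_op N theta (Mx l) (wt l)) * right_op n p (c x (row a vs)).
Proof.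
move=> sx fr; rewrite mulr_sumr.
transitivity (\sum_l \sum_a sc (- 'i%C) * (sc (\sum_j al l j * (vs a j)%:C%C) *
    tw_op N theta (Mx l) (wt l) * right_op n p (c x (row a vs)))).
  apply: eq_bigr => l _; rewrite (affine_grad_frame _ sx fr) right_opZ right_op_sum.
  rewrite !mulr_sumr; apply: eq_bigr => a _; rewrite right_opZ.
  by rewrite (mulrA (tw_op _ _ _ _)) -lin_scalarC -!mulrA; congr (_ * _);
    rewrite (mulrA (tw_op _ _ _ _)) -lin_scalarC -!mulrA.
rewrite exchange_big; apply: eq_bigr => a _ /=.
by rewrite mulr_suml mulr_sumr.
Qed.

End GradientLetters.

Lemma positive_root (R : realType) (a : R) (k : nat) : 0 < a -> (0 < k)%N ->
  exists2 r, 0 < r & r ^+ k = a.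
Proof.
move=> a0 k0; exists (a `^ (k%:R^-1)); first exact: powR_gt0.
by rewrite -powR_mulrn ?powR_ge0 // -powRrM mulVf ?powRr1 ?ltW // pnatr_eq0 -lt0n.
Qed.

Lemma det_frame_complex (R : realType) (m : nat) (x : 'rV[R]_m.+1) (vs : 'M[R]_(m, m.+1)) :
  \det (col_mx (map_mx (real_complex R) x) (map_mx (real_complex R) vs) : 'M[R[i]]_(1 + m)) =
  (\det (col_mx x vs : 'M[R]_(1 + m)))%:C%C.
Proof. by rewrite -map_col_mx det_map_mx. Qed.

Lemma weight_char0 (R : realType) (n : nat) (s : 'rV[R]_n) : weight_char (0 : 'rV[int]_n) s = 1.
Proof. by rewrite /weight_char big1 ?mulr0 ?cis0 // => nu _; rewrite mxE mul0r. Qed.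

Lemma astar_ugen (R : realType) (m n : nat) (nu : 'I_n) k (x : 'rV[R]_m.+1) :
  astar (@ugen R m n nu) k x = (k == pair_weight (nu, false))%:R * (zcoord nu x)^*.
Proof.
rewrite /astar /ugen /atens /pair_weight /letter_weight /= scaleNr eqr_oppLR.
by case: eqP => _; rewrite ?mul1r // mul0r conjC0.
Qed.

Lemma ugenE (R : realType) (m n : nat) (nu : 'I_n) k (x : 'rV[R]_m.+1) :
  @ugen R m n nu k x = (k == pair_weight (nu, true))%:R * zcoord nu x.
Proof.
rewrite /ugen /atens /pair_weight /letter_weight /=.
by case: eqP => _; rewrite ?mul1r // mul0r.
Qed.

(** * Even spheres *)

Section EvenLetters.
Variables (R : realType) (n p : nat).
Let m := n.*2.
Let E := 'rV[R]_m.+1.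
Let C := R[i].
Let weight := 'rV[int]_n.
Variable Gam : 'I_n -> 'M[C]_p.

(** [None] is the letter of the real coordinate [u]: weight zero, matrix [gamma]. *)
Definition even_weight (l : option ('I_n * bool)) : weight :=
  if l is Some q then pair_weight q else 0.
Definition even_mx (l : option ('I_n * bool)) : 'M[C]_p :=
  if l is Some q then letter_mx Gam q.1 q.2 else gamma_elt Gam.
Definition even_coef (l : option ('I_n * bool)) (j : 'I_m.+1) : C :=
  if l is Some q then coord_letter R q j else (j == ord_max)%:R.

(** The outer [None] is the unit in [e], the only letter with a constant coefficient; it drops out
    of [e - 1/2] and of the commutator. *)
Definition unital_weight (l : option (option ('I_n * bool))) : weight :=
  if l is Some q then even_weight q else 0.
Definition unital_mx (l : option (option ('I_n * bool))) : 'M[C]_p :=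
  if l is Some q then 2^-1 *: even_mx q else (2^-1)%:M.
Definition unital_cst (l : option (option ('I_n * bool))) : C := (l == None)%:R.
Definition unital_coef (l : option (option ('I_n * bool))) (j : 'I_m.+1) : C :=
  if l is Some q then even_coef q j else 0.

Lemma even_weight_base l : base_weight (even_weight l).
Proof. by case: l => [q|] nu; [exact: pair_weight_base|rewrite mxE]. Qed.

Lemma even_coef_equiv s l i : weight_char (even_weight l) s *
  (\sum_j even_coef l j * (Defs.rot s (delta_mx 0 i : E) 0 j)%:C%C) = even_coef l i.
Proof.
case: l => [q|] /=; first by apply: coord_letter_equiv; left.
rewrite weight_char0 mul1r (bigD1 ord_max) //= eqxx mul1r big1 ?addr0 => [|j /negPf ->].
  have -> : ord_max = inord n.*2 :> 'I_m.+1 by apply: val_inj; rewrite /= inordK.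
  have [->|] := rot_top s (delta_mx 0 i : E); last by rewrite ltnn.
  by rewrite mxE eqxx eq_sym; case: eqP.
by rewrite mul0r.
Qed.

Lemma unital_weight_base l : base_weight (unital_weight l).
Proof. by case: l => [q|] nu; [exact: even_weight_base|rewrite mxE]. Qed.

Lemma unital_cst_equiv s l : weight_char (unital_weight l) s * unital_cst l = unital_cst l.
Proof. by case: l => [q|]; rewrite /unital_cst ?mulr0 //= weight_char0 mul1r. Qed.

Lemma unital_coef_equiv s l i : weight_char (unital_weight l) s *
  (\sum_j unital_coef l j * (Defs.rot s (delta_mx 0 i : E) 0 j)%:C%C) = unital_coef l i.
Proof.
case: l => [q|] /=; first exact: even_coef_equiv.
by rewrite big1 ?mulr0 // => j _; rewrite mul0r.
Qed.

Lemma even_part i j k (x : E) :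
  2^-1 * (\sum_nu (adjmx (Gam nu) i j * @ugen R m n nu k x +
                   Gam nu i j * astar (@ugen R m n nu) k x)
          + gamma_elt Gam i j * @ureal R m n k x) =
  \sum_l (k == even_weight l)%:R *
     ((2^-1 *: even_mx l) i j * affine (fun=> 0) even_coef l x).
Proof.
rewrite sum_option mulrDr [LHS]addrC; congr (_ + _).
  rewrite /affine /= add0r (bigD1 ord_max) //= eqxx mul1r big1 ?addr0; last first.
    by move=> b /negPf ->; rewrite mul0r.
  rewrite mxE /ureal /atens; case: (k == 0); rewrite ?mul1r ?mul0r ?mulr0 //.
  by rewrite -mulrA.
rewrite mulr_sumr -(pair_bigA _ (fun nu b => (k == pair_weight (nu, b))%:R *
   ((2^-1 *: letter_mx Gam nu b) i j * affine (fun=> 0) even_coef (Some (nu, b)) x))) /=.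
apply: eq_bigr => nu _; rewrite big_bool /affine /= !add0r !coord_letter_zcoord /=.
rewrite ugenE astar_ugen mulrDr !mxE.
by congr (_ + _); ring.
Qed.

Lemma proj_e_letters :
  (proj_e Gam : 'I_p -> 'I_p -> alg R m n) =
  letter_alg unital_weight unital_mx (affine unital_cst unital_coef).
Proof.
apply/funext => i; apply/funext => j; apply/funext => k; apply/funext => x.
rewrite /proj_e -addrA mulrDr even_part /letter_alg [RHS]sum_option; congr (_ + _).
  rewrite /affine /unital_cst /= big1 ?addr0 => [|b _]; last by rewrite mul0r.
  by rewrite mulr1 mxE /aone; case: (i == j); rewrite ?mulr1n ?mulr0n /=; ring.
Qed.

Lemma proj_e_sub_half :
  asub (proj_e Gam : 'I_p -> 'I_p -> alg R m n) (@half_one _ _ _ _) =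
  letter_alg even_weight (fun l => 2^-1 *: even_mx l) (affine (fun=> 0) even_coef).
Proof.
apply/funext => i; apply/funext => j; apply/funext => k; apply/funext => x.
rewrite /asub /half_one /proj_e -addrA mulrDr even_part /letter_alg.
by rewrite mulrA addrAC subrr add0r.
Qed.

End EvenLetters.

Section EvenSphere.
Variables (R : realType) (n : nat).
Hypothesis n_gt0 : (0 < n)%N.
Let m := n.*2.
Let E := 'rV[R]_m.+1.
Let C := R[i].
Let N := (2 ^ m./2)%N.
Let p := (2 ^ n)%N.
Let weight := 'rV[int]_n.
Let V := (weight -> 'M[C]_(p, N)).
Variables (theta : 'M[R]_n) (Gam : 'I_n -> 'M[C]_p).
Hypothesis asym : antisymmetric_mx theta.
Hypothesis GamP : theta_clifford theta Gam.
Variables (r : R) (eps : bool) (g : E -> E -> E -> R).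
Hypothesis r_gt0 : 0 < r.
Hypothesis gR : riemannian g.
Hypothesis gvol : same_volume_form eps g (round r).
Variable S : spin_geometry n g eps.

Let sc : {rmorphism C -> lin_end V} := lin_scalar V.
Let mn : m = n.*2 \/ m.+1 = n.*2 := or_introl erefl.

Lemma even_letters_celt (v : 'I_m.+1 -> C) (w : 'rV[C]_(1 + m)) : (forall j, w 0 j = v j) ->
  \sum_l sc (\sum_j even_coef R l j * v j) * tw_op N theta (even_mx Gam l) (even_weight l) =
  celt N theta Gam w.
Proof.
move=> wv; rewrite sum_option /= addrC.
transitivity (\sum_j sc (v j) * gen N theta Gam j).
  rewrite (gens_letters_even N theta Gam v) //; congr (_ + _).
  rewrite -chiral_letter_op //; congr (sc _ * _).
  by rewrite (bigD1 ord_max) //= eqxx mul1r big1 ?addr0 // => j /negPf ->; rewrite mul0r.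
by apply: eq_bigr => j _; rewrite wv.
Qed.

Definition even_comm := letter_action theta (@unital_weight n) (unital_mx Gam)
  (affine_grad (@unital_coef R n) g (cliff S)).

Section AtPoint.
Variables (x : E) (vs : 'M[R]_(m, m.+1)).
Hypotheses (sx : sphere x) (fr : orthonormal_frame g x vs).

Let ex : 'rV[C]_(1 + m) := map_mx (real_complex R) x.
Let ev : 'M[C]_(m, 1 + m) := map_mx (real_complex R) vs.

Let Z : lin_end V := \sum_a celt N theta Gam (row a ev) *
  right_op n p (cliff S x (row a vs)).

(** The scalar combines the [-i] of the Dirac operator with the 1/2 in [e]; the unit letter has zero
    gradient. *)
Lemma even_comm_pack Phi : pack (even_comm Phi) x = (sc (- ('i%C / 2)) * Z) (pack Phi x).
Proof.
rewrite pack_letter_action (gradient_letters theta gR (cliffP S) _ _ _ sx fr).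
have -> : - ('i%C / 2) = - 'i%C * (2^-1 : C) by rewrite mulNr.
rewrite (rmorphM sc) -mulrA; congr ((_ * _ : lin_end V) _).
rewrite /Z mulr_sumr; apply: eq_bigr => a _; rewrite mulrA; congr (_ * _).
rewrite sum_option /= big1 => [|j _]; last by rewrite mul0r.
rewrite rmorph0 mul0r add0r.
rewrite -(even_letters_celt (v := fun j => (vs a j)%:C%C)) => [|j]; last by rewrite !mxE.
rewrite mulr_sumr; apply: eq_bigr => l _.
by rewrite tw_opZ mulrA -lin_scalarC !mulrA lin_scalarC.
Qed.

Lemma even_mact_pack Phi :
  pack (mact theta (asub (proj_e Gam) (@half_one _ _ _ _)) Phi) x =
  (sc (2^-1) * celt N theta Gam ex) (pack Phi x).
Proof.
rewrite proj_e_sub_half mact_letter pack_letter_action; congr ((_ : lin_end V) _).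
rewrite -(even_letters_celt (v := fun j => (x 0 j)%:C%C)) => [|j]; last by rewrite !mxE.
rewrite mulr_sumr; apply: eq_bigr => l _.
have -> : right_op n p ((affine (fun=> 0) (@even_coef R n) l x)%:M : 'M[C]_N) =
    sc (\sum_j even_coef R l j * (x 0 j)%:C%C).
  by rewrite -scalemx1 right_opZ right_op1 mulr1 /affine add0r.
by rewrite -lin_scalarC tw_opZ !mulrA lin_scalarC.
Qed.

Lemma even_iter_pack k Phi : pack (iter k even_comm Phi) x =
  (sc ((- ('i%C / 2)) ^+ k) * Z ^+ k) (pack Phi x).
Proof.
elim: k => [|k IH]; first by rewrite !expr0 rmorph1 mulr1.
rewrite iterS even_comm_pack IH -lin_mulE; congr ((_ : lin_end V) _).
by rewrite !exprS (rmorphM sc) -!mulrA; congr (_ * _); rewrite mulrA -lin_scalarC -mulrA.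
Qed.

Lemma even_pointwise (psi : sections R m n N) k : 0 < orient eps x vs ->
  commutant_proj (fun Phi => mact theta (asub (proj_e Gam) (@half_one _ _ _ _))
     (iter n.*2 even_comm Phi)) psi k x =
  ((2^-1 * (- ('i%C / 2)) ^+ n.*2) * ((n.*2)`!%:R * ((-1) ^+ eps * (r ^+ n.*2)^-1)%:C%C)) *:
  grade (grading S) psi k x.
Proof.
move=> op; apply/colP => j.
rewrite (commutant_proj_pack (X := sc (2^-1 * (- ('i%C / 2)) ^+ n.*2) *
   (celt N theta Gam ex * Z ^+ n.*2))); last first.
  move=> Phi; rewrite even_mact_pack even_iter_pack -lin_mulE; congr ((_ : lin_end V) _).
  by rewrite (rmorphM sc) -!mulrA; congr (_ * _); rewrite mulrA -lin_scalarC -mulrA.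
rewrite partial_traceZ partial_trace_even //; last 2 first.
- by rewrite expn_gt0.
- exact: (frame_clifford_anti (cliffP S) sx fr).
rewrite det_frame_complex (frame_det r_gt0 gvol sx fr op).
have [gr _] := gradingP S.
(* The scalar [(-i)^n] produced by the product of all generators is the one in the definition of the
   complex volume element, since [m./2 = n]. *)
have grE : grading S x = (- 'i%C) ^+ n *: \prod_(a < m) cliff S x (row a vs).
  by rewrite (gr x vs sx fr op); congr (_ ^+ _ *: _); exact: doubleK.
rewrite -trmx_mul [(_ *m _)^T _ _]mxE [RHS]mxE /grade grE -scalemxAl [X in _ = _ * X]mxE.
by rewrite !mulrA.
Qed.

End AtPoint.

Hypothesis r_pow : r ^+ n.*2 = (n.*2)`!%:R / 2 ^+ n.*2.+1.
Hypothesis eps_n : eps = odd n.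

(** Here [(-i/2)^(2n) = (-1)^n / 2^(2n)]. The parity of [n] as orientation cancels the sign, and
    [r^(2n)] cancels the factorial and the remaining power [2^(2n+1)]. *)
Lemma even_constant :
  2^-1 * (- ('i%C / 2)) ^+ n.*2 *
   ((n.*2)`!%:R * ((-1) ^+ eps * (r ^+ n.*2)^-1)%:C%C) = 1 :> C.
Proof.
have f0 : (n.*2)`!%:R != 0 :> C by rewrite pnatr_eq0 -lt0n fact_gt0.
have t0 : 2 ^+ n != 0 :> C by rewrite expf_neq0 // pnatr_eq0.
rewrite r_pow eps_n signr_odd invf_div rmorphM rmorphM /= rmorphV ?unitfE ?pnatr_eq0 -?lt0n ?fact_gt0 //.
rewrite !rmorphXn rmorphN1 !rmorph_nat.
have -> : (- ('i%C / 2)) ^+ n.*2 = (-1) ^+ n / (2 ^+ n * 2 ^+ n) :> C.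
  rewrite -muln2 mulnC exprM sqrrN expr_div_n sqr_i expr_div_n -exprM mulnC muln2.
  by rewrite -addnn exprD.
have -> : 2 ^+ n.*2.+1 = 2 * (2 ^+ n * 2 ^+ n) :> C by rewrite exprS -addnn exprD.
have s2 : (-1) ^+ n * (-1) ^+ n = 1 :> C by rewrite -exprMn mulrNN mulr1 expr1n.
transitivity ((-1) ^+ n * (-1) ^+ n : C) => //.
by field; rewrite f0 t0.
Qed.

Variable mu : {measure set (g_sigma_algebraType (@open E)) -> \bar R}.

Lemma even_sphere_theorem :
  let e : 'I_p -> 'I_p -> alg R m n := proj_e Gam in
  (forall i j, Cinf_theta (e i j)) /\
  exists De : msections R m n N p -> msections R m n N p,
    is_dirac_comm theta mu (spin_lift S) (dirac_op S) e De /\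
    forall psi, in_H mu (spin_lift S) psi ->
      ae_eq_sec mu
        (commutant_proj
           (fun Phi => mact theta (asub e (@half_one _ _ _ _)) (iter n.*2 De Phi)) psi)
        (grade (grading S) psi).
Proof.
move=> e; have eE : e = letter_alg (@unital_weight n) (unital_mx Gam)
    (affine (@unital_cst R n) (@unital_coef R n)) by exact: proj_e_letters.
split=> [i j|].
  rewrite eE; apply: letter_alg_Cinf.
  - exact: unital_weight_base.
  - exact: unital_cst_equiv.
  - exact: unital_coef_equiv.
exists even_comm; split.
  rewrite eE; apply: (letter_dirac_comm _ _ _ _ _ mn gR (cliffP S) (diracP S) (liftP S)).
  - exact: unital_weight_base.
  - exact: unital_coef_equiv.
(* The identity holds at every point of the sphere, with an oriented frame chosen at that point. *)
move=> psi _ k; apply: aeW => x sx.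
have [|vs [fr op]] := oriented_frame gR eps sx; first by rewrite double_gt0.
by rewrite (even_pointwise sx fr) // even_constant scale1r.
Qed.

End EvenSphere.

(** * Odd spheres *)

Section OffDiagonal.
Variables (R : realType) (n h N : nat) (theta : 'M[R]_n).
Let C := R[i].
Let weight := 'rV[int]_n.

(** The two halves of the doubled matrix factor. Off-diagonal operators exchange them, so
    alternating products of the blocks are powers of a single operator. *)
Definition upper (Phi : weight -> 'M[C]_(h, N)) : weight -> 'M[C]_(h + h, N) :=
  fun k => col_mx (Phi k) 0.
Definition lower (Phi : weight -> 'M[C]_(h, N)) : weight -> 'M[C]_(h + h, N) :=
  fun k => col_mx 0 (Phi k).

Variables (L : finType) (wt : L -> weight) (P Q : L -> 'M[C]_h) (Y : L -> 'M[C]_N).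

Lemma off_diagonal_upper Phi :
  (\sum_l tw_op N theta (block_mx 0 (P l) (Q l) 0) (wt l) * right_op n (h + h) (Y l))
    (upper Phi) =
  lower ((\sum_l tw_op N theta (Q l) (wt l) * right_op n h (Y l)) Phi).
Proof.
apply/funext => k; rewrite /lower !lin_sumE !fct_sumE.
elim/big_rec2: _ => [|l u v _ ->]; first by rewrite col_mx0.
rewrite !lin_mulE /= /twisted /upper /= [col_mx _ _ *m (Y l)^T]mul_col_mx mul0mx mul_block_col !mul0mx mulmx0.
by rewrite !addr0 ?add0r scale_col_mx scaler0 add_col_mx ?addr0 ?add0r.
Qed.

Lemma off_diagonal_lower Phi :
  (\sum_l tw_op N theta (block_mx 0 (P l) (Q l) 0) (wt l) * right_op n (h + h) (Y l))
    (lower Phi) =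
  upper ((\sum_l tw_op N theta (P l) (wt l) * right_op n h (Y l)) Phi).
Proof.
apply/funext => k; rewrite /upper !lin_sumE !fct_sumE.
elim/big_rec2: _ => [|l u v _ ->]; first by rewrite col_mx0.
rewrite !lin_mulE /= /twisted /lower /= [col_mx _ _ *m (Y l)^T]mul_col_mx mul0mx mul_block_col !mul0mx mulmx0.
by rewrite !addr0 ?add0r scale_col_mx scaler0 add_col_mx ?addr0 ?add0r.
Qed.

(** [1 + gamma] is twice the projection on the upper half; the factor 2 turns the normalization
    [1/(2h)] of the doubled space into [1/h]. *)
Lemma partial_trace_upper (X : lin_end (weight -> 'M[C]_(h + h, N)))
    (psi : weight -> 'rV[C]_N) k j :
  partial_trace psi k j
    ((1 + tw_op N theta (block_mx 1%:M 0 0 (- 1%:M)) 0) * X) =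
  h%:R^-1 * \sum_(i < h) X (upper (fun l => delta_mx i 0 *m psi l)) k (lshift h i) j.
Proof.
rewrite /partial_trace big_split_ord /=.
have E (Phi : weight -> 'M[C]_(h + h, N)) :
    (1 + tw_op N theta (block_mx 1%:M 0 0 (- 1%:M)) 0) Phi k = col_mx (usubmx (Phi k) *+ 2) 0.
  rewrite lin_addE fctE /= /twisted subr0 weyl_phaseE.
  have -> : phase_form theta 0 k = 0.
    by apply: (addrI (phase_form theta 0 k)); rewrite -phase_formDl !addr0.
  rewrite cis0 scale1r -{1 2}[Phi k]vsubmxK mul_block_col !mul0mx mulNmx !mul1mx addr0 add0r.
  by rewrite add_col_mx subrr mulr2n.
have H1 i : ((1 + tw_op N theta (block_mx 1%:M 0 0 (- 1%:M)) 0) * X)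
    (fun l => delta_mx (lshift h i) 0 *m psi l) k (lshift h i) j =
    2 * X (upper (fun l => delta_mx i 0 *m psi l)) k (lshift h i) j.
  rewrite lin_mulE E col_mxEu mulr2n !mxE mulr_natl mulr2n.
  suff -> : (fun l => delta_mx (lshift h i) 0 *m psi l) =
    upper (fun l => delta_mx i 0 *m psi l) by [].
  apply/funext => l; transitivity ((col_mx (delta_mx i 0) 0 : 'cV[C]_(h + h)) *m psi l); last first.
    by rewrite mul_col_mx mul0mx.
  congr (_ *m _).
  apply/matrixP => a b; rewrite (ord1 b); case: (split_ordP a) => a' ->.
    by rewrite col_mxEu !mxE (inj_eq (@lshift_inj _ _)).
  by rewrite col_mxEd !mxE eq_rlshift.
have H2 i : ((1 + tw_op N theta (block_mx 1%:M 0 0 (- 1%:M)) 0) * X)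
    (fun l => delta_mx (rshift h i) 0 *m psi l) k (rshift h i) j = 0.
  by rewrite lin_mulE E col_mxEd mxE.
rewrite (eq_bigr _ (fun i _ => H1 i)) [X in _ + X]big1 ?addr0 => [|i _]; last exact: H2.
rewrite -mulr_sumr mulrA; congr (_ * _).
(* For [h = 0] both sides are zero because the inverse of 0 is 0. *)
have [->|] := posnP h; first by rewrite !invr0 mul0r.
rewrite lt0n => h0.
have hn : h%:R != 0 :> C by rewrite pnatr_eq0.
have h2 : (h + h)%:R = 2 * h%:R :> C by rewrite natrD mulr_natl mulr2n.
by rewrite h2; field.
Qed.

End OffDiagonal.

Section OddSphere.
Variables (R : realType) (n : nat).
Hypothesis n_gt0 : (0 < n)%N.
Let m := n.*2.-1.
Let E := 'rV[R]_m.+1.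
Let C := R[i].
Let N := (2 ^ m./2)%N.
Let h := (2 ^ n.-1)%N.
Let weight := 'rV[int]_n.
Let V := (weight -> 'M[C]_(h + h, N)).
Variables (theta : 'M[R]_n) (sig sigb : 'I_n -> 'M[C]_h).
Let Gam := block_Gam sig sigb.
Hypothesis asym : antisymmetric_mx theta.
Hypothesis GamP : theta_clifford theta Gam.
Hypothesis gammaE : gamma_elt Gam = block_mx 1%:M 0 0 (- 1%:M).
Variables (r : R) (eps : bool) (g : E -> E -> E -> R).
Hypothesis r_gt0 : 0 < r.
Hypothesis gR : riemannian g.
Hypothesis gvol : same_volume_form eps g (round r).
Variable S : spin_geometry n g eps.

Let sc : {rmorphism C -> lin_end V} := lin_scalar V.

Lemma odd_dim : m.+1 = n.*2.
Proof. by rewrite /m prednK // double_gt0. Qed.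

Let mn : m = n.*2 \/ m.+1 = n.*2 := or_intror odd_dim.

Definition odd_mx (q : 'I_n * bool) : 'M[C]_h := if q.2 then sigb q.1 else sig q.1.
Definition odd_mx_star (q : 'I_n * bool) : 'M[C]_h :=
  if q.2 then adjmx (sig q.1) else adjmx (sigb q.1).

Lemma letter_mx_block q : letter_mx Gam q.1 q.2 = block_mx 0 (odd_mx q) (odd_mx_star q) 0.
Proof.
rewrite /letter_mx /odd_mx /odd_mx_star /Gam /block_Gam; case: q.2 => //.
apply/matrixP => i j; rewrite 2!mxE.
by case: (split_ordP i) => i' ->; case: (split_ordP j) => j' ->;
  rewrite ?block_mxEul ?block_mxEur ?block_mxEdl ?block_mxEdr !mxE ?conjC0 ?conjCK.
Qed.

Let coord0 := affine (fun=> 0) (@coord_letter R m n).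

Lemma unit_U_letters : (unit_U sig sigb : 'I_h -> 'I_h -> alg R m n) =
  letter_alg (@pair_weight n) odd_mx coord0.
Proof.
apply/funext => i; apply/funext => j; apply/funext => k; apply/funext => x.
rewrite /unit_U /letter_alg -(pair_bigA _ (fun nu b => (k == pair_weight (nu, b))%:R *
   (odd_mx (nu, b) i j * coord0 (nu, b) x))) /=.
apply: eq_bigr => nu _; rewrite big_bool /coord0 /affine /= !add0r !coord_letter_zcoord /=.
by rewrite ugenE astar_ugen /odd_mx /=; congr (_ + _); ring.
Qed.

(** The adjoint negates weights and conjugates coordinates, hence exchanges the two letters of each
    [mu]; the matrix of a letter in the adjoint of [U] is the adjoint of the matrix of the opposite
    letter in [U]. *)
Lemma unit_U_star_letters : (mstar (unit_U sig sigb) : 'I_h -> 'I_h -> alg R m n) =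
  letter_alg (@pair_weight n) odd_mx_star coord0.
Proof.
apply/funext => i; apply/funext => j; apply/funext => k; apply/funext => x.
rewrite /mstar /astar /unit_U /letter_alg rmorph_sum.
rewrite -(pair_bigA _ (fun nu b => (k == pair_weight (nu, b))%:R *
   (odd_mx_star (nu, b) i j * coord0 (nu, b) x))) /=.
apply: eq_bigr => nu _; rewrite big_bool /coord0 /affine /= !add0r !coord_letter_zcoord /=.
rewrite ugenE astar_ugen /odd_mx_star /= rmorphD !rmorphM /= !rmorph_nat conjCK !mxE.
have W b : (- k == pair_weight (nu, b)) = (k == pair_weight (nu, ~~ b)).
  rewrite /pair_weight /letter_weight /= eqr_oppLR -scaleNr; congr (_ == _ *: _).
  by case: b; rewrite ?opprK.
by rewrite !W /= addrC; congr (_ + _); ring.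
Qed.

Lemma odd_letters_celt (v : 'I_m.+1 -> C) (w : 'rV[C]_(1 + m)) : (forall j, w 0 j = v j) ->
  \sum_q sc (\sum_j coord_letter R q j * v j) *
     tw_op N theta (letter_mx Gam q.1 q.2) (pair_weight q) = celt N theta Gam w.
Proof.
move=> wv; transitivity (\sum_j sc (v j) * gen N theta Gam j).
  by rewrite (gens_letters_odd N theta Gam v odd_dim).
by apply: eq_bigr => j _; rewrite wv.
Qed.

Let grad := affine_grad (@coord_letter R m n) g (cliff S).

Definition odd_comm := letter_action theta (@pair_weight n) odd_mx grad.
Definition odd_comm_star := letter_action theta (@pair_weight n) odd_mx_star grad.

Section AtPoint.
Variables (x : E) (vs : 'M[R]_(m, m.+1)).
Hypotheses (sx : sphere x) (fr : orthonormal_frame g x vs).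

Let ex : 'rV[C]_(1 + m) := map_mx (real_complex R) x.
Let ev : 'M[C]_(m, 1 + m) := map_mx (real_complex R) vs.

Let Z : lin_end V := \sum_a celt N theta Gam (row a ev) *
  right_op n (h + h) (cliff S x (row a vs)).
Let dF : lin_end V := sc (- 'i%C) * Z.
Let F : lin_end V := celt N theta Gam ex.

Lemma odd_gradient : dF = \sum_q tw_op N theta (block_mx 0 (odd_mx q) (odd_mx_star q) 0)
  (pair_weight q) * right_op n (h + h) (grad q x).
Proof.
under [RHS]eq_bigr do rewrite -letter_mx_block.
rewrite (gradient_letters theta gR (cliffP S) _ _ _ sx fr) /dF; congr (_ * _).
apply: eq_bigr => a _; congr (_ * _).
by rewrite -(odd_letters_celt (v := fun j => (vs a j)%:C%C)) => [|j] //; rewrite !mxE.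
Qed.

Lemma odd_function : F = \sum_q tw_op N theta (block_mx 0 (odd_mx q) (odd_mx_star q) 0)
  (pair_weight q) * right_op n (h + h) ((coord0 q x)%:M).
Proof.
rewrite /F -(odd_letters_celt (v := fun j => (x 0 j)%:C%C)) => [|j]; last by rewrite !mxE.
apply: eq_bigr => q _; rewrite -letter_mx_block -scalemx1 right_opZ right_op1 mulr1.
by rewrite lin_scalarC /coord0 /affine add0r.
Qed.

(** The full gradient [dF] contains both commutators: the one with [U] maps the lower half to the
    upper, the one with its adjoint maps back. *)
Lemma odd_comm_lower Phi : dF (lower (pack Phi x)) = upper (pack (odd_comm Phi) x).
Proof. by rewrite odd_gradient off_diagonal_lower pack_letter_action. Qed.

Lemma odd_comm_upper Phi : dF (upper (pack Phi x)) = lower (pack (odd_comm_star Phi) x).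
Proof. by rewrite odd_gradient off_diagonal_upper pack_letter_action. Qed.

Lemma odd_function_lower Phi :
  F (lower (pack Phi x)) = upper (pack (mact theta (unit_U sig sigb) Phi) x).
Proof.
by rewrite odd_function off_diagonal_lower unit_U_letters mact_letter pack_letter_action.
Qed.

Lemma odd_iter k Phi : upper (pack (iter k (fun Psi => odd_comm (odd_comm_star Psi)) Phi) x) =
  (dF ^+ k.*2) (upper (pack Phi x)).
Proof.
elim: k => [|k IH]; first by rewrite expr0.
by rewrite iterS -odd_comm_lower -odd_comm_upper IH doubleS !exprS.
Qed.

Lemma odd_product Phi :
  upper (pack (mact theta (unit_U sig sigb) (odd_comm_star
     (iter n.-1 (fun Psi => odd_comm (odd_comm_star Psi)) Phi))) x) =
  (F * dF ^+ m) (upper (pack Phi x)).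
Proof.
rewrite -odd_function_lower -odd_comm_upper odd_iter.
(* One commutator with the adjoint and [n - 1] pairs make [2(n - 1) + 1 = m] factors. *)
have -> : dF ^+ m = dF ^+ n.-1.*2.+1.
  by congr (_ ^+ _); have := odd_dim; lia.
by rewrite exprS.
Qed.

Lemma odd_pointwise (psi : sections R m n N) k : 0 < orient eps x vs ->
  commutant_proj (fun Phi => mact theta (unit_U sig sigb) (odd_comm_star
     (iter n.-1 (fun Psi => odd_comm (odd_comm_star Psi)) Phi))) psi k x =
  ((- 'i%C) ^+ m.+1 * (m`!%:R * ((-1) ^+ eps * (r ^+ m)^-1)%:C%C)) *: psi k x.
Proof.
move=> op; apply/colP => j.
pose psiT l := (psi l x)^T.
have -> : forall T : msections R m n N h -> msections R m n N h,
  (forall Phi, upper (pack (T Phi) x) = (F * dF ^+ m) (upper (pack Phi x))) ->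
  commutant_proj T psi k x j 0 = partial_trace psiT k j ((1 + chi_op N theta Gam) * (F * dF ^+ m)).
- move=> T TE; rewrite /chi_op chiral_letter_op // gammaE partial_trace_upper.
  rewrite /commutant_proj mxE summxE; congr (_ * _); apply: eq_bigr => i _.
  have -> : (fun l => delta_mx i 0 *m psiT l) =
      pack (fun j l y => if j == i then psi l y else 0) x.
    apply/funext => l; apply/matrixP => a b; rewrite !mxE big_ord1 !mxE eqxx andbT.
    by case: eqP => _; rewrite ?mul1r // mul0r mxE.
  by rewrite -TE /upper col_mxEu mxE.
- rewrite /dF exprMn_comm; last exact: lin_scalarC.
  have -> : (1 + chi_op N theta Gam) * (F * (sc (- 'i%C) ^+ m * Z ^+ m)) =
    sc ((- 'i%C) ^+ m) * ((1 + chi_op N theta Gam) * (F * Z ^+ m)).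
    by rewrite rmorphXn (mulrA F) -(rmorphXn sc) -(lin_scalarC _ F) -mulrA [LHS]mulrA
      -lin_scalarC !mulrA.
  rewrite partial_traceZ partial_trace_odd //; last 5 first.
  + by rewrite addn_gt0 expn_gt0.
  + exact: (frame_clifford_anti (cliffP S) sx fr).
  + by rewrite -odd_dim.
  + exact: odd_dim.
  + move=> a; have [t _] := fr; transitivity ((dotp x (row a vs))%:C%C : C).
      by rewrite rmorph_sum; apply: eq_bigr => b _; rewrite !mxE rmorphM.
    by rewrite (t a : dotp _ _ = 0).
  rewrite det_frame_complex (frame_det r_gt0 gvol sx fr op).
  have [gr go] := gradingP S.
  have om : odd m by have := odd_double n; rewrite -odd_dim /= => /negbFE.
  have half_m : m./2 = n.-1.
    by have := odd_double_half m; rewrite om; have := odd_dim; lia.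
  (* The product of generators carries [(-i)^n], whereas the volume element equal to 1 carries
     [(-i)^(n-1)]; the extra [-i] raises the power in the final scalar from [m] to [m + 1]. *)
  have cE : (- 'i%C) ^+ n *: \prod_(a < m) cliff S x (row a vs) = (- 'i%C)%:M.
    have := go om x sx; rewrite (gr x vs sx fr op) => H1.
    have -> : (- 'i%C) ^+ n = - 'i%C * (- 'i%C) ^+ m./2 :> C.
      by rewrite half_m -exprS prednK.
    by rewrite -scalerA H1 scalemx1.
  have trE : (- 'i%C) ^+ n * (psiT k *m (\prod_(a < m) cliff S x (row a vs))^T) 0 j =
      - 'i%C * psi k x j 0.
    transitivity ((((- 'i%C) ^+ n *: \prod_(a < m) cliff S x (row a vs)) *m psi k x) j 0).
      by rewrite -scalemxAl [RHS]mxE -trmx_mul [(_ *m _)^T _ _]mxE.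
    by rewrite cE mul_scalar_mx mxE.
  by rewrite trE [RHS]mxE exprSr; ring.
- exact: odd_product.
Qed.

End AtPoint.

Hypothesis r_pow : r ^+ m = m`!%:R.
Hypothesis eps_n : eps = odd n.

(** The exponent [m + 1 = 2n] gives [(-1)^n], which the orientation cancels, and [r^m] is the
    factorial. *)
Lemma odd_constant :
  (- 'i%C) ^+ m.+1 * (m`!%:R * ((-1) ^+ eps * (r ^+ m)^-1)%:C%C) = 1 :> C.
Proof.
have f0 : m`!%:R != 0 :> C by rewrite pnatr_eq0 -lt0n fact_gt0.
rewrite r_pow eps_n signr_odd rmorphM /= fmorphV rmorphXn rmorphN1 rmorph_nat.
rewrite odd_dim -muln2 mulnC exprM sqrrN sqr_i.
have s2 : (-1) ^+ n * (-1) ^+ n = 1 :> C by rewrite -exprMn mulrNN mulr1 expr1n.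
by transitivity ((-1) ^+ n * (-1) ^+ n : C) => //; field.
Qed.

Variable mu : {measure set (g_sigma_algebraType (@open E)) -> \bar R}.

Lemma odd_sphere_theorem :
  let U : 'I_h -> 'I_h -> alg R m n := unit_U sig sigb in
  (forall i j, Cinf_theta (U i j)) /\
  exists DU DUs : msections R m n N h -> msections R m n N h,
    is_dirac_comm theta mu (spin_lift S) (dirac_op S) U DU /\
    is_dirac_comm theta mu (spin_lift S) (dirac_op S) (mstar U) DUs /\
    forall psi, in_H mu (spin_lift S) psi ->
      ae_eq_sec mu
        (commutant_proj
           (fun Phi => mact theta U
              (DUs (iter n.-1 (fun Psi => DU (DUs Psi)) Phi))) psi)
        psi.
Proof.
move=> U; have UE : U = letter_alg (@pair_weight n) odd_mx coord0 := unit_U_letters.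
have c0 s (q : 'I_n * bool) : weight_char (pair_weight q) s * (0 : C) = 0 by rewrite mulr0.
have cq s q i := coord_letter_equiv mn s q i.
split=> [i j|].
  by rewrite UE; apply: letter_alg_Cinf => //; exact: pair_weight_base.
exists odd_comm, odd_comm_star; split; last split.
- rewrite UE; apply: (letter_dirac_comm _ _ _ _ _ mn gR (cliffP S) (diracP S) (liftP S)) => //.
  exact: pair_weight_base.
- rewrite unit_U_star_letters.
  apply: (letter_dirac_comm _ _ _ _ _ mn gR (cliffP S) (diracP S) (liftP S)) => //.
  exact: pair_weight_base.
- move=> psi _ k; apply: aeW => x sx.
  have [|vs [fr op]] := oriented_frame gR eps sx.
    by rewrite -ltnS odd_dim; case: (n) n_gt0.
  by rewrite (odd_pointwise sx fr) // odd_constant scale1r.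
Qed.

End OddSphere.

Theorem theorem10 (R : realType) (n : nat) (hn : (2 <= n)%N) :
  (exists (r : R) (eps : bool), 0 < r /\
    forall (theta : 'M[R]_n)
      (g : 'rV[R]_n.*2.+1 -> 'rV[R]_n.*2.+1 -> 'rV[R]_n.*2.+1 -> R)
      (S : spin_geometry n g eps)
      (mu : {measure set (g_sigma_algebraType
               (@open 'rV[R]_n.*2.+1)) -> \bar R})
      (Gam : 'I_n -> 'M[R[i]]_(2 ^ n)),
    antisymmetric_mx theta ->
    riemannian g -> torus_invariant n g ->
    same_volume_form eps g (round r) ->
    round_measure mu ->
    theta_clifford theta Gam -> irreducible_rep Gam ->
    let e : 'I_(2 ^ n) -> 'I_(2 ^ n) -> alg R n.*2 n := proj_e Gam in
    (forall i j, Cinf_theta (e i j)) /\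
    exists De : msections R n.*2 n _ (2 ^ n) -> msections R n.*2 n _ (2 ^ n),
      is_dirac_comm theta mu (spin_lift S) (dirac_op S) e De /\
      forall psi, in_H mu (spin_lift S) psi ->
        ae_eq_sec mu
          (commutant_proj
             (fun Phi => mact theta (asub e (@half_one _ _ _ _))
                              (iter n.*2 De Phi)) psi)
          (grade (grading S) psi))
  /\
  (exists (r : R) (eps : bool), 0 < r /\
    forall (theta : 'M[R]_n)
      (g : 'rV[R]_n.*2.-1.+1 -> 'rV[R]_n.*2.-1.+1 ->
           'rV[R]_n.*2.-1.+1 -> R)
      (S : spin_geometry n g eps)
      (mu : {measure set (g_sigma_algebraType
               (@open 'rV[R]_n.*2.-1.+1)) -> \bar R})
      (sig sigb : 'I_n -> 'M[R[i]]_(2 ^ n.-1)),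
    antisymmetric_mx theta ->
    riemannian g -> torus_invariant n g ->
    same_volume_form eps g (round r) ->
    round_measure mu ->
    theta_clifford theta (block_Gam sig sigb) ->
    irreducible_rep (block_Gam sig sigb) ->
    gamma_elt (block_Gam sig sigb) = block_mx 1%:M 0 0 (- 1%:M) ->
    let U : 'I_(2 ^ n.-1) -> 'I_(2 ^ n.-1) -> alg R n.*2.-1 n :=
      unit_U sig sigb in
    (forall i j, Cinf_theta (U i j)) /\
    exists DU DUs : msections R n.*2.-1 n _ (2 ^ n.-1) ->
                    msections R n.*2.-1 n _ (2 ^ n.-1),
      is_dirac_comm theta mu (spin_lift S) (dirac_op S) U DU /\
      is_dirac_comm theta mu (spin_lift S) (dirac_op S) (mstar U) DUs /\
      forall psi, in_H mu (spin_lift S) psi ->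
        ae_eq_sec mu
          (commutant_proj
             (fun Phi => mact theta U
                (DUs (iter n.-1 (fun Psi => DU (DUs Psi)) Phi))) psi)
          psi).
Proof.
have n0 : (0 < n)%N := ltnW hn.
split.
  have [||r r0 rE] := @positive_root R ((n.*2)`!%:R / 2 ^+ n.*2.+1) n.*2.
  - by rewrite divr_gt0 ?exprn_gt0 // ltr0n fact_gt0.
  - by rewrite double_gt0.
  (* Radius and orientation are fixed by [n] before [theta] and [g] enter. *)
  exists r, (odd n); split=> // theta g S mu Gam asym gR _ gvol _ GamP _.
  exact: (@even_sphere_theorem R n n0 theta Gam asym GamP r (odd n) g r0 gR gvol).
have [||r r0 rE] := @positive_root R ((n.*2.-1)`!%:R) n.*2.-1.
- by rewrite ltr0n fact_gt0.
- by lia.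
exists r, (odd n); split=> // theta g S mu sig sigb asym gR _ gvol _ GamP _ gammaE.
exact: (@odd_sphere_theorem R n n0 theta sig sigb asym GamP gammaE r (odd n) g r0 gR gvol).
Qed.
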